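(* Let $H_{22}:(0,\infty)\to\mathbb{R}$ be a smooth function and put $H_{11}=\tfrac12 rH_{22}'$. Assume that $H_{11}>0$ and $H_{22}>0$, so that $H_{11}v_1\wedge\bar v_1+H_{22}v_2\wedge\bar v_2$ (more precisely $i$ times it) defines an $SU(2)$-invariant Kähler metric on $\mathbb{C}^2\setminus\{0\}$. Let $(J_1,J_2)$ be the $SU(2)$-invariant generalized Kähler structure on $\mathbb{C}^2\setminus\{0\}$ associated to $H_{22}$ as described in the context. If the Kähler metric $H_{11}v_1\bar v_1+H_{22}v_2\bar v_2$ extends to a Kähler metric on $\mathbb{CP}^2\supset\mathbb{C}^2\setminus\{0\}$, then the generalized Kähler structure $(J_1,J_2)$ extends to a generalized Kähler structure on $\mathbb{CP}^2$.
   Context: Generalized geometry: on $T\oplus T^*$ use the natural indefinite inner product (given up to scale by $(X+\xi,X+\xi)=-i_X\xi$) and the Courant bracket $[X+\xi,Y+\eta]=[X,Y]+\mathcal{L}_X\eta-\mathcal{L}_Y\xi-\frac12 d(i_X\eta-i_Y\xi)$. A generalized complex structure is a complex structure $J$ on $T\oplus T^*$, orthogonal for the inner product, such that the sections of its $+i$ eigenbundle are closed under the Courant bracket. A generalized Kähler structure is a pair of commuting generalized complex structures $J_1,J_2$ such that the quadratic form $(J_1J_2A,A)$ on $T\oplus T^*$ is definite. If $\beta=B+i\omega$ is a closed complex 2-form with $\omega$ non-degenerate, then $\exp\beta$ defines the generalized complex structure whose $+i$ eigenbundle is $\{X+\xi\in(T\oplus T^* )\otimes\mathbb{C}: i_X\rho+\xi\wedge\rho=0\}$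 with $\rho=\exp\beta$, i.e. $\{X-i_X\beta\}$. Coordinates: $(z_1,z_2)$ are the standard coordinates on $\mathbb{C}^2$, with $\mathbb{CP}^2=\mathbb{C}^2\cup\{\text{line at infinity}\}$ via $[1,z_1,z_2]$; $r^2=|z_1|^2+|z_2|^2$; $'$ denotes $d/dr$. The $SU(2)$-invariant $(1,0)$-forms $v_1,v_2$ on $\mathbb{C}^2\setminus\{0\}$ are $$v_1=\frac{\bar z_1dz_1+\bar z_2dz_2}{r^2},\qquad v_2=\frac{z_1dz_2-z_2dz_1}{r^2}.$$ The structure: given $H_{22}$ and $H_{11}=\frac12 rH_{22}'$, define real functions of $r$ by $$L=\frac{r^4}{8}\left[1-\sqrt{1+\frac{4H_{22}^2}{r^4}}\right],\qquad \lambda=\frac{L'}{r},\qquad H_{12}=\frac{rL'-4L}{r^2},\qquad H_{21}=-H_{12},$$ and closed 2-forms $$\beta_1=dz_1\wedge dz_2=r^2v_1\wedge v_2,\qquad \beta_2=\sum_{i,j=1}^2H_{ij}\,v_i\wedge\bar v_j+\lambda\,(v_1\wedge v_2+\bar v_1\wedge\bar v_2).$$ Then $J_1,J_2$ are the generalized complex structures on $\mathbb{C}^2\setminus\{0\}$ defined by $\exp\beta_1$ and $\exp\beta_2$; they form a generalized Kähler structure there. *)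

(* Defs.v *)
From HB Require Import structures.
From mathcomp Require Import all_boot all_order all_algebra.
From mathcomp Require Import all_classical all_reals all_analysis.
From mathcomp Require Import complex.
Set Implicit Arguments.
Unset Strict Implicit.
Unset Printing Implicit Defensive.
Import Order.TTheory GRing.Theory Num.Theory.
Import numFieldNormedType.Exports.
Local Open Scope classical_set_scope.
Local Open Scope complex_scope.
Local Open Scope ring_scope.

(* Tensors on an open subset U of R^n are written in the
   coordinate frame: a vector field or a 1-form is a 'rV_n-valued function, a
   section X + xi of T (+) T* is the 'rV_(n + n)-valued function
   row_mx X xi, an endomorphism is a matrix acting on row vectors on the right
   (J A is A *m J, and J1 J2 A is A *m J2 *m J1), and a bilinear form b is the
   matrix with b(X, Y) = X *m b *m Y^T, so that i_X b = b(X, -) is X *m b. *)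

Section Smooth.
Variables (R : realType) (V W : normedModType R).

Fixpoint Ck_on (k : nat) (U : set V) (f : V -> W) : Prop :=
  (forall x, U x -> {for x, continuous f}) /\
  (if k is k'.+1 then
     forall v : V, (forall x, U x -> derivable f x v) /\
                   Ck_on k' U (fun x => 'D_v f x)
   else True).

Definition smooth_on (U : set V) (f : V -> W) : Prop :=
  forall k, Ck_on k U f.

End Smooth.

Section GeneralizedGeometry.
Variables (R : realType) (n : nat).
Implicit Types (U : set 'rV[R]_n) (x : 'rV[R]_n).

Definition complexify p q (A : 'M[R]_(p, q)) : 'M[R[i]]_(p, q) :=
  map_mx (real_complex R) A.

Definition smooth_complex_on p U (u : 'rV[R]_n -> 'rV[R[i]]_p) : Prop :=
  smooth_on U (fun x => map_mx (@complex.Re R) (u x)) /\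
  smooth_on U (fun x => map_mx (@complex.Im R) (u x)).

Definition partial (i : 'I_n) (f : 'rV[R]_n -> R[i]) x : R[i] :=
  ('D_(delta_mx 0 i) (fun y => complex.Re (f y)) x) +i*
  ('D_(delta_mx 0 i) (fun y => complex.Im (f y)) x).

Definition lie_bracket (X Y : 'rV[R]_n -> 'rV[R[i]]_n) x : 'rV[R[i]]_n :=
  \row_j \sum_i (X x 0 i * partial i (fun y => Y y 0 j) x
                 - Y x 0 i * partial i (fun y => X y 0 j) x).

Definition lie_form (X eta : 'rV[R]_n -> 'rV[R[i]]_n) x : 'rV[R[i]]_n :=
  \row_j \sum_i (X x 0 i * partial i (fun y => eta y 0 j) x
                 + eta x 0 i * partial j (fun y => X y 0 i) x).

Definition contraction (F : pzRingType) (X xi : 'rV[F]_n) : F :=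
  \sum_i X 0 i * xi 0 i.

Definition exterior_d0 (f : 'rV[R]_n -> R[i]) x : 'rV[R[i]]_n :=
  \row_j partial j f x.

Definition courant (u v : 'rV[R]_n -> 'rV[R[i]]_(n + n)) x :
    'rV[R[i]]_(n + n) :=
  let X y := lsubmx (u y) in let xi y := rsubmx (u y) in
  let Y y := lsubmx (v y) in let eta y := rsubmx (v y) in
  row_mx (lie_bracket X Y x)
    (lie_form X eta x - lie_form Y xi x
     - 2^-1 *: exterior_d0 (fun y => contraction (X y) (eta y)
                                     - contraction (Y y) (xi y)) x).

(* The polarization of (X + xi, X + xi) = - i_X xi. *)
Definition inner (A B : 'rV[R]_(n + n)) : R :=
  - 2^-1 * (contraction (lsubmx A) (rsubmx B)
            + contraction (lsubmx B) (rsubmx A)).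

Definition in_plus_i (J : 'M[R]_(n + n)) (A : 'rV[R[i]]_(n + n)) : Prop :=
  A *m complexify J = 'i%C *: A.

Definition gen_complex_on U (J : 'rV[R]_n -> 'M[R]_(n + n)) : Prop :=
  [/\ smooth_on U J,
      forall x, U x -> J x *m J x = - 1%:M,
      forall x, U x -> forall A B, inner (A *m J x) (B *m J x) = inner A B &
      forall V : set 'rV[R]_n, open V -> V `<=` U ->
      forall u v : 'rV[R]_n -> 'rV[R[i]]_(n + n),
        smooth_complex_on V u -> smooth_complex_on V v ->
        (forall x, V x -> in_plus_i (J x) (u x)) ->
        (forall x, V x -> in_plus_i (J x) (v x)) ->
        forall x, V x -> in_plus_i (J x) (courant u v x)].

Definition definite (q : 'rV[R]_(n + n) -> R) : Prop :=
  (forall A, A != 0 -> 0 < q A) \/ (forall A, A != 0 -> q A < 0).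

Definition gen_kahler_on U (J1 J2 : 'rV[R]_n -> 'M[R]_(n + n)) : Prop :=
  [/\ gen_complex_on U J1,
      gen_complex_on U J2,
      forall x, U x -> J1 x *m J2 x = J2 x *m J1 x &
      forall x, U x -> definite (fun A => inner (A *m J2 x *m J1 x) A)].

(* At a point, J is the structure defined by exp beta: its +i eigenbundle is
   {X - i_X beta}. As J is real, this determines J. *)
Definition defined_by_exp (beta : 'M[R[i]]_n) (J : 'M[R]_(n + n)) : Prop :=
  forall A : 'rV[R[i]]_(n + n),
    in_plus_i J A <-> exists X : 'rV[R[i]]_n, A = row_mx X (- (X *m beta)).

(* (a /\ b)(X, Y) = a(X) b(Y) - a(Y) b(X) *)
Definition wedge (a b : 'rV[R[i]]_n) : 'M[R[i]]_n := a^T *m b - b^T *m a.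

End GeneralizedGeometry.

(* C^m is R^(m + m) with coordinates (Re z_1, .., Re z_m, Im z_1, .., Im z_m). *)
Section ComplexCoordinates.
Variables (R : realType) (m : nat).

Definition toC (x : 'rV[R]_(m + m)) : 'rV[R[i]]_m :=
  \row_j ((lsubmx x 0 j) +i* (rsubmx x 0 j)).

Definition ofC (z : 'rV[R[i]]_m) : 'rV[R]_(m + m) :=
  row_mx (map_mx (@complex.Re R) z) (map_mx (@complex.Im R) z).

Definition dz (j : 'I_m) : 'rV[R[i]]_(m + m) :=
  row_mx (delta_mx 0 j) ('i%C *: delta_mx 0 j).

Definition conj_form (a : 'rV[R[i]]_(m + m)) : 'rV[R[i]]_(m + m) :=
  map_mx conjc a.

(* The complex structure d/dx_j |-> d/dy_j, d/dy_j |-> - d/dx_j. *)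
Definition stdI : 'M[R]_(m + m) := block_mx 0 1%:M (- 1%:M) 0.

(* (X, Y) |-> g(I X, Y) *)
Definition fundamental_form (g : 'M[R]_(m + m)) : 'M[R]_(m + m) := stdI *m g.

Definition closed2_on (U : set 'rV[R]_(m + m))
    (w : 'rV[R]_(m + m) -> 'M[R]_(m + m)) : Prop :=
  forall x, U x -> forall i j k,
    'D_(delta_mx 0 i) (fun y => w y j k) x
    + 'D_(delta_mx 0 j) (fun y => w y k i) x
    + 'D_(delta_mx 0 k) (fun y => w y i j) x = 0.

Definition kahler_metric_on (U : set 'rV[R]_(m + m))
    (g : 'rV[R]_(m + m) -> 'M[R]_(m + m)) : Prop :=
  [/\ smooth_on U g,
      forall x, U x -> (g x)^T = g x,
      forall x, U x -> forall X : 'rV[R]_(m + m),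
        X != 0 -> 0 < (X *m g x *m X^T) 0 0,
      forall x, U x -> stdI *m g x *m stdI^T = g x &
      closed2_on U (fun x => fundamental_form (g x))].

End ComplexCoordinates.

(* CP^m is described by its standard atlas: the chart k, for k : 'I_m.+1, is
   C^m -> CP^m, sending z to the point whose homogeneous coordinates are those
   of z with a 1 inserted at position k. In particular chart 0 is
   [1, z_1, .., z_m]. A tensor on CP^m is the family of its expressions in the
   m + 1 charts, subject to the transformation law on the overlaps. *)
Section ProjectiveSpace.
Variables (R : realType) (m : nat).

Definition homog (k : 'I_m.+1) (z : 'rV[R[i]]_m) : 'rV[R[i]]_m.+1 :=
  \row_l (if unlift k l is Some j then z 0 j else 1).

Definition overlap (k l : 'I_m.+1) (x : 'rV[R]_(m + m)) : Prop :=
  homog k (toC x) 0 l != 0.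

Definition transition (k l : 'I_m.+1) (x : 'rV[R]_(m + m)) :
    'rV[R]_(m + m) :=
  ofC (\row_j (homog k (toC x) 0 (lift l j) / homog k (toC x) 0 l)).

(* The isomorphism of T (+) T* induced by a diffeomorphism with Jacobian D:
   vectors are pushed forward, covectors pulled back by the inverse. *)
Definition pushTT n (D : 'M[R]_n) : 'M[R]_(n + n) :=
  block_mx D 0 0 (invmx D)^T.

Definition endo_CP
    (J : 'I_m.+1 -> 'rV[R]_(m + m) -> 'M[R]_((m + m) + (m + m))) : Prop :=
  forall k l x, overlap k l x ->
    let P := pushTT (jacobian (transition k l) x) in
    J k x *m P = P *m J l (transition k l x).

Definition metric_CP (g : 'I_m.+1 -> 'rV[R]_(m + m) -> 'M[R]_(m + m)) : Prop :=
  forall k l x, overlap k l x ->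
    let D := jacobian (transition k l) x in
    g k x = D *m g l (transition k l x) *m D^T.

Definition kahler_metric_CP
    (g : 'I_m.+1 -> 'rV[R]_(m + m) -> 'M[R]_(m + m)) : Prop :=
  metric_CP g /\ forall k, kahler_metric_on setT (g k).

Definition gen_kahler_CP
    (J1 J2 : 'I_m.+1 -> 'rV[R]_(m + m) -> 'M[R]_((m + m) + (m + m))) : Prop :=
  [/\ endo_CP J1, endo_CP J2 & forall k, gen_kahler_on setT (J1 k) (J2 k)].

End ProjectiveSpace.

Section SU2Structure.
Variable R : realType.
Implicit Type x : 'rV[R]_(2 + 2).

Definition rnorm x : R := Num.sqrt (\sum_i x 0 i ^+ 2).

Definition v1 x : 'rV[R[i]]_(2 + 2) :=
  let z := toC x in
  ((rnorm x ^+ 2)%:C)^-1 *: (conjc (z 0 0) *: dz R 0 + conjc (z 0 1) *: dz R 1).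

Definition v2 x : 'rV[R[i]]_(2 + 2) :=
  let z := toC x in
  ((rnorm x ^+ 2)%:C)^-1 *: (z 0 0 *: dz R 1 - z 0 1 *: dz R 0).

Variable H22 : R -> R.

Definition H11 (r : R) : R := 2^-1 * r * derive1 H22 r.

Definition L_of (r : R) : R :=
  r ^+ 4 / 8 * (1 - Num.sqrt (1 + 4 * H22 r ^+ 2 / r ^+ 4)).

Definition lambda (r : R) : R := derive1 L_of r / r.

Definition H12 (r : R) : R := (r * derive1 L_of r - 4 * L_of r) / r ^+ 2.

Definition H21 (r : R) : R := - H12 r.

(* The fundamental form of the metric g = H11 v1 v1bar + H22 v2 v2bar. *)
Definition hermitian_form x : 'M[R[i]]_(2 + 2) :=
  'i%C *: ((H11 (rnorm x))%:C *: wedge (v1 x) (conj_form (v1 x))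
         + (H22 (rnorm x))%:C *: wedge (v2 x) (conj_form (v2 x))).

Definition beta1 : 'M[R[i]]_(2 + 2) := wedge (dz R 0) (dz R 1).

Definition beta2 x : 'M[R[i]]_(2 + 2) :=
  let r := rnorm x in
  (H11 r)%:C *: wedge (v1 x) (conj_form (v1 x))
  + (H12 r)%:C *: wedge (v1 x) (conj_form (v2 x))
  + (H21 r)%:C *: wedge (v2 x) (conj_form (v1 x))
  + (H22 r)%:C *: wedge (v2 x) (conj_form (v2 x))
  + (lambda r)%:C *: (wedge (v1 x) (v2 x)
                      + wedge (conj_form (v1 x)) (conj_form (v2 x))).

End SU2Structure.

(* Main.v *)
(* Write beta_2 = B - iF with F the fundamental form of the Kaehler metric.

   J_1 is determined by the holomorphic Poisson bivector inverse to beta_1. As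
   dz1 /\ dz2 has a pole of order 3 on the line at infinity, this bivector extends
   to CP^2, and its zeros do no harm. F extends by hypothesis, so that J_2 extends
   as soon as the closed form B does. On C^2 \ 0, B is the exterior derivative of
   4 (L / r^4) Re (z1 dz2 - z2 dz1), in which L / r^4 is a smooth function of
   H22 / r^2; the latter is a radial integral of the trace of the metric, hence
   smooth at the origin. In the charts at infinity the same potential is written
   with H22 read off the components of the metric, and is smooth too.

   Commutation and integrability are closed conditions, valid on a dense set.
   Definiteness could be lost at the limit; but there the quadratic form is, up to
   a factor 2 (1 + mu) with mu = - 2 lambda / r^2 >= 0, a sum of squares which
   contains |X|^2 + |Y|^2. *)
Require Import Defs.
From HB Require Import structures.
From mathcomp Require Import all_boot all_order all_algebra.
From mathcomp Require Import all_classical all_reals all_analysis.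
From mathcomp Require Import complex.
From mathcomp Require Import ring lra.
Import Order.TTheory GRing.Theory Num.Theory.
Import numFieldNormedType.Exports.
Import Defs.
Local Open Scope classical_set_scope.
Local Open Scope complex_scope.
Local Open Scope ring_scope.
Set Implicit Arguments.
Unset Strict Implicit.
Unset Printing Implicit Defensive.

(** Both structures are explicit matrix fields: J_1 is built from the complex structure I and a real
    bivector S, J_2 from B and F. The only inverse taken is that of F, which is nondegenerate on all
    of CP^2. With beta = B - iF, the two structures commute once beta I - I beta = beta S beta. This
    is polynomial in S, hence meaningful where S vanishes and beta_1 is infinite; in the frame v_1,
    v_2 it becomes the single scalar relation (beta_1 - beta_2)^2 = 0. At the origin the obstacle is
    that v_1 and v_2 are singular, so smoothness of the metric says nothing directly about H22 as a
    function of r. The trace only gives T = (H11 + H22) / r^2, but p^2 H22(p r) / (2 r^2) is a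
    primitive in p of p^3 T(p y), whence the weight p^3. The sum of squares rests on three relations
    for a = I + BS and n = FS, namely a^2 = n^2 - 1, an = - na and aI + Ia = - 2 (1 + mu). They are
    equalities, so they survive at the limit, where strict inequalities would not. *)

(** * Smooth functions on a normed space *)

Section SmoothCalculus.
Variables (R : realType) (V : normedModType R).
Implicit Types (f g : V -> R).

Lemma Ck_onS (W : normedModType R) k (f : V -> W) :
  Ck_on k.+1 setT f <-> continuous f /\
    forall v, (forall x, derivable f x v) /\ Ck_on k setT ('D_v f).
Proof.
split=> -[cf df]; split.
- by move=> x; exact: cf.
- by move=> v; have [dfv Df] := df v; split=> // x; exact: dfv.
- by move=> x _; exact: cf.
- by move=> v; have [dfv Df] := df v; split=> // x _; exact: dfv.
Qed.

Lemma Ck_on_continuous (W : normedModType R) k (f : V -> W) :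
  Ck_on k setT f -> continuous f.
Proof. by case: k => [|k] [cf _] x; exact: cf. Qed.

Lemma Ck_onW (W : normedModType R) k (f : V -> W) :
  Ck_on k.+1 setT f -> Ck_on k setT f.
Proof.
elim: k f => [|k IH] f /Ck_onS[cf df]; first by split=> // x _; exact: cf.
by apply/Ck_onS; split=> // v; have [dfv /IH] := df v.
Qed.

Lemma smooth_onT_continuous (W : normedModType R) (f : V -> W) :
  smooth_on setT f -> continuous f.
Proof. by move=> /(_ 0); exact: Ck_on_continuous. Qed.

Lemma smooth_onT_derivable (W : normedModType R) (f : V -> W) x v :
  smooth_on setT f -> derivable f x v.
Proof. by move=> /(_ 1)/Ck_onS[_ /(_ v)[]]. Qed.

Lemma smooth_onT_derive (W : normedModType R) (f : V -> W) v :
  smooth_on setT f -> smooth_on setT ('D_v f).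
Proof. by move=> sf k; have /Ck_onS[_ /(_ v)[]] := sf k.+1. Qed.

Lemma Ck_on_cst (W : normedModType R) k (a : W) : Ck_on k setT (cst a : V -> W).
Proof.
elim: k a => [|k IH] a; first by split=> // x _; exact: cst_continuous.
apply/Ck_onS; split; first by move=> x; exact: cst_continuous.
move=> v; split=> [x|]; first exact: derivable_cst.
rewrite (_ : 'D_v _ = cst 0); first exact: IH.
by apply/funext => x; rewrite derive_cst.
Qed.

Lemma smooth_onT_cst (W : normedModType R) (a : W) :
  smooth_on setT (fun _ : V => a).
Proof. by move=> k; exact: Ck_on_cst. Qed.

Lemma Ck_on_linear_comp (W W' : normedModType R) (L : {linear W -> W'}) k (f : V -> W) :
  continuous L -> Ck_on k setT f -> Ck_on k setT (fun x => L (f x)).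
Proof.
move=> cL; elim: k f => [|k IH] f.
  by move=> [cf _]; split=> // x _; apply: continuous_cvg; [exact: cL|exact: cf].
move=> /Ck_onS[cf df]; apply/Ck_onS; split.
  by move=> x; apply: continuous_cvg; [exact: cL|exact: cf].
move=> v; have [dfv Df] := df v.
have dL x : (h^-1 *: (((fun x => L (f x)) \o shift x) (h *: v) - L (f x)))
    @[h --> 0^'] --> L ('D_v f x).
  rewrite (_ : (fun h => _) =
      fun h => L (h^-1 *: ((f \o shift x) (h *: v) - f x))); last first.
    by apply/funext => h /=; rewrite [RHS]linearZZ [in RHS]linearB.
  by apply: continuous_cvg; [exact: cL|exact: dfv].
split=> [x|]; first by apply/cvg_ex; eexists; exact: dL.
rewrite (_ : 'D_v _ = fun x => L ('D_v f x)); first exact: IH.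
by apply/funext => x; exact: cvg_lim (dL x).
Qed.

Lemma smooth_onT_linear_comp (W W' : normedModType R) (L : {linear W -> W'}) (f : V -> W) :
  continuous L -> smooth_on setT f -> smooth_on setT (fun x => L (f x)).
Proof. by move=> cL sf k; exact: Ck_on_linear_comp. Qed.

Lemma Ck_onD (W : normedModType R) k (f g : V -> W) : Ck_on k setT f -> Ck_on k setT g ->
  Ck_on k setT (fun x => f x + g x).
Proof.
elim: k f g => [|k IH] f g.
  by move=> [cf _] [cg _]; split=> // x _; apply: cvgD; [exact: cf|exact: cg].
move=> /Ck_onS[cf df] /Ck_onS[cg dg]; apply/Ck_onS; split.
  by move=> x; apply: cvgD; [exact: cf|exact: cg].
move=> v; have [dfv Df] := df v; have [dgv Dg] := dg v; split=> [x|].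
  exact: derivableD.
rewrite (_ : 'D_v _ = fun x => 'D_v f x + 'D_v g x); first exact: IH.
by apply/funext => x; rewrite deriveD.
Qed.

Lemma Ck_onM k f g : Ck_on k setT f -> Ck_on k setT g ->
  Ck_on k setT (fun x => f x * g x).
Proof.
elim: k f g => [|k IH] f g.
  by move=> [cf _] [cg _]; split=> // x _; apply: cvgM; [exact: cf|exact: cg].
(* The Leibniz rule involves f and g themselves besides their derivatives, so the induction needs
   both at the lower order too. *)
move=> Cf Cg; have Cf' := Ck_onW Cf; have Cg' := Ck_onW Cg.
move: Cf Cg => /Ck_onS[cf df] /Ck_onS[cg dg]; apply/Ck_onS; split.
  by move=> x; apply: cvgM; [exact: cf|exact: cg].
move=> v; have [dfv Df] := df v; have [dgv Dg] := dg v; split=> [x|].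
  exact: derivableM.
rewrite (_ : 'D_v _ = fun x => f x * 'D_v g x + g x * 'D_v f x).
  by apply: Ck_onD; exact: IH.
by apply/funext => x; rewrite deriveM.
Qed.

Lemma smooth_onTD (W : normedModType R) (f g : V -> W) :
  smooth_on setT f -> smooth_on setT g -> smooth_on setT (fun x => f x + g x).
Proof. by move=> sf sg k; exact: Ck_onD. Qed.

Lemma smooth_onTM f g : smooth_on setT f -> smooth_on setT g ->
  smooth_on setT (fun x => f x * g x).
Proof. by move=> sf sg k; exact: Ck_onM. Qed.

Lemma smooth_onTN f : smooth_on setT f -> smooth_on setT (fun x => - f x).
Proof.
move=> sf; rewrite (_ : (fun _ => _) = fun x => (-1) * f x).
  by apply: smooth_onTM => //; exact: smooth_onT_cst.
by apply/funext => x; rewrite mulN1r.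
Qed.

Lemma smooth_onTB f g : smooth_on setT f -> smooth_on setT g ->
  smooth_on setT (fun x => f x - g x).
Proof. by move=> sf sg; apply: smooth_onTD => //; exact: smooth_onTN. Qed.

Lemma smooth_onT_sum (W : normedModType R) (I : Type) (r : seq I) (P : pred I)
    (F : I -> V -> W) :
  (forall i, P i -> smooth_on setT (F i)) ->
  smooth_on setT (fun x => \sum_(i <- r | P i) F i x).
Proof.
move=> sF; elim: r => [|i r IH].
  rewrite (_ : (fun _ => _) = fun _ => 0); first exact: smooth_onT_cst.
  by apply/funext => x; rewrite big_nil.
under eq_fun do rewrite big_cons.
by case: (boolP (P i)) => // Pi; apply: smooth_onTD => //; exact: sF.
Qed.

Lemma smooth_onT_prod (I : Type) (r : seq I) (F : I -> V -> R) :
  (forall i, smooth_on setT (F i)) ->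
  smooth_on setT (fun x => \prod_(i <- r) F i x).
Proof.
move=> sF; elim: r => [|i r IH].
  rewrite (_ : (fun _ => _) = fun _ => 1); first exact: smooth_onT_cst.
  by apply/funext => x; rewrite big_nil.
rewrite (_ : (fun _ => _) = fun x => F i x * \prod_(j <- r) F j x).
  exact: smooth_onTM.
by apply/funext => x; rewrite big_cons.
Qed.

Lemma smooth_onTX f n : smooth_on setT f -> smooth_on setT (fun x => f x ^+ n).
Proof.
move=> sf; elim: n => [|n IH].
  rewrite (_ : (fun _ => _) = fun _ => 1); first exact: smooth_onT_cst.
  by apply/funext => x; rewrite expr0.
rewrite (_ : (fun _ => _) = fun x => f x * f x ^+ n); first exact: smooth_onTM.
by apply/funext => x; rewrite exprS.
Qed.

(** The derivative is a product of inverses of f with a derivative of f, so the induction hypothesis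
    applies to each factor. *)
Lemma Ck_onV k f : (forall x, f x != 0) -> Ck_on k setT f ->
  Ck_on k setT (fun x => (f x)^-1).
Proof.
move=> f0; elim: k => [|k IH] Cf.
  by split=> // x _; apply: cvgV => //; exact: (Ck_on_continuous Cf).
have Cf' := Ck_onW Cf.
move: Cf => /Ck_onS[cf df]; apply/Ck_onS; split.
  by move=> x; apply: cvgV => //; exact: cf.
move=> v; have [dfv Df] := df v; split=> [x|].
  exact: derivableV.
rewrite (_ : 'D_v _ = fun x => (-1) * ((f x)^-1 * (f x)^-1) * 'D_v f x).
  apply: Ck_onM => //; apply: Ck_onM; first exact: Ck_on_cst.
  by apply: Ck_onM; exact: IH.
apply/funext => x; rewrite deriveV// /GRing.scale/=; congr (_ * _).
by rewrite -invfM -expr2 -exprVn mulN1r exprVn.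
Qed.

Lemma smooth_onTV f : (forall x, f x != 0) -> smooth_on setT f ->
  smooth_on setT (fun x => (f x)^-1).
Proof. by move=> f0 sf k; exact: Ck_onV. Qed.

(* Along a line the chain rule only needs a derivative of the outer function. *)
Lemma is_derive_comp1 (phi : R -> R) f x v dphi df :
  is_derive (f x) 1 phi dphi -> is_derive x v f df ->
  is_derive x v (fun y => phi (f y)) (df * dphi).
Proof.
move=> hphi hf; have [df1 df2] := hf; have [dp1 dp2] := hphi.
pose g (h : R) := f (h *: v + x).
have g0 : g 0 = f x by rewrite /g scale0r add0r.
have dg : derivable g 0 1 by apply/(derivable1P f x v).1.
have lineE (F : V -> R) : 'D_1 (fun h : R => F (h *: v + x)) 0 = 'D_v F x.
  rewrite /derive; set G := (X in lim (X @ _)); set H := (X in _ = lim (X @ _)).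
  by rewrite (_ : G = H)//; apply/funext => h; rewrite /G /H /= addr0 scale0r add0r [_%:A]mulr1.
have Dg : 'D_1 g 0 = df by rewrite /g lineE.
have dpg : derivable phi (g 0) 1 by rewrite g0.
have H : is_derive (0 : R) (1 : R) (phi \o g) (df * dphi).
  rewrite -Dg -dp2 -g0.
  have /derivable1_diffP dg' := dg. have /derivable1_diffP dp' := dpg.
  apply: DeriveDef; first by apply/derivable1_diffP/differentiable_comp.
  rewrite -derive1E (derive1_comp dg dpg) 2!derive1E; exact: mulrC.
case: H => H1 H2; apply: DeriveDef; first by apply/(derivable1P _ x v).2.
by rewrite -H2 -lineE.
Qed.

Lemma is_derive_sqrt f x v df : 0 < f x -> is_derive x v f df ->
  is_derive x v (fun y => Num.sqrt (f y)) (df / (2 * Num.sqrt (f x))).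
Proof. by move=> f0; apply: is_derive_comp1; exact: is_derive1_sqrt. Qed.

(** The induction closes because the derivative of the root is expressed through the root itself,
    which stays positive. *)
Lemma Ck_on_sqrt k f : (forall x, 0 < f x) -> Ck_on k setT f ->
  Ck_on k setT (fun x => Num.sqrt (f x)).
Proof.
move=> f0; elim: k => [|k IH] Cf.
  split=> // x _; apply: (@continuous_comp _ _ _ f (@Num.sqrt R)).
    exact: (Ck_on_continuous Cf).
  exact: sqrt_continuous.
have Cf' := Ck_onW Cf.
move: Cf => /Ck_onS[cf df]; apply/Ck_onS; split.
  move=> x; apply: (@continuous_comp _ _ _ f (@Num.sqrt R)); first exact: cf.
  exact: sqrt_continuous.
move=> v; have [dfv Df] := df v.
have ds x : is_derive x v (fun y => Num.sqrt (f y))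
    ('D_v f x / (2 * Num.sqrt (f x))).
  by apply: is_derive_sqrt => //; exact: derivableP.
split=> [x|]; first by have := ds x.
rewrite (_ : 'D_v _ = fun x => 'D_v f x * (2 * Num.sqrt (f x))^-1).
  apply: Ck_onM => //; apply: Ck_onV.
    by move=> x; rewrite mulf_neq0// gt_eqF// sqrtr_gt0.
  by apply: Ck_onM; [exact: Ck_on_cst|exact: IH].
by apply/funext => x; have /@derive_val -> := ds x.
Qed.

Lemma smooth_onT_sqrt f : (forall x, 0 < f x) -> smooth_on setT f ->
  smooth_on setT (fun x => Num.sqrt (f x)).
Proof. by move=> f0 sf k; exact: Ck_on_sqrt. Qed.

End SmoothCalculus.

Lemma mx_addE (R : nmodType) m n (A B : 'M[R]_(m, n)) i j :
  (A + B) i j = A i j + B i j.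
Proof. by rewrite mxE. Qed.

Lemma mx_oppE (R : zmodType) m n (A : 'M[R]_(m, n)) i j : (- A) i j = - A i j.
Proof. by rewrite mxE. Qed.

Lemma mx_scaleE (R : pzRingType) m n c (A : 'M[R]_(m, n)) i j :
  (c *: A) i j = c * A i j.
Proof. by rewrite mxE. Qed.

Lemma mx_zeroE (R : nmodType) m n i j : (0 : 'M[R]_(m, n)) i j = 0.
Proof. by rewrite mxE. Qed.

(** Only the module structure is unfolded: products of matrices remain atoms for [ring]. *)
Ltac mx_ring :=
  apply/matrixP => ? ?; rewrite !(mx_addE, mx_oppE, mx_scaleE, mx_zeroE); ring.

Lemma mul_tr_row (C : comNzRingType) n (a b : 'rV[C]_n) i j : (a^T *m b) i j = a 0 i * b 0 j.
Proof. by rewrite mxE big_ord1 mxE. Qed.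

(** * Linear algebra of the two structures at a point *)

Section GeneralizedLinearAlgebra.
Variables (R : realType) (n : nat).
Implicit Types (B F S D g : 'M[R]_n) (J : 'M[R]_(n + n)) (A : 'rV[R]_(n + n)).

Definition pairing_mx : 'M[R]_(n + n) := block_mx 0 1%:M 1%:M 0.

Lemma contractionE (F' : pzRingType) (X xi : 'rV[F']_n) :
  contraction X xi = (X *m xi^T) 0 0.
Proof. by rewrite mxE; apply: eq_bigr => i _; rewrite mxE. Qed.

Lemma innerE A A' : inner A A' = - 2^-1 * (A *m pairing_mx *m A'^T) 0 0.
Proof.
rewrite /inner !contractionE; congr (_ * _).
have -> : (lsubmx A' *m (rsubmx A)^T) 0 0 = (rsubmx A *m (lsubmx A')^T) 0 0.
  by rewrite -[in RHS](trmxK (rsubmx A)) -trmx_mul [RHS]mxE.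
rewrite -[in RHS](hsubmxK A) -[in RHS](hsubmxK A') /pairing_mx mul_row_block.
rewrite !mulmx0 !mulmx1 add0r addr0 tr_row_mx mul_row_col [RHS]mxE.
exact: addrC.
Qed.

Lemma pairing_orthogonal J A A' : J *m pairing_mx *m J^T = pairing_mx ->
  inner (A *m J) (A' *m J) = inner A A'.
Proof. by move=> JK; rewrite !innerE trmx_mul !mulmxA -[A *m J *m _ *m _]mulmxA -[A *m J *m _]mulmxA (mulmxA J) JK. Qed.

(** The B-field transform X + xi |-> X + xi + i_X B. *)
Definition Bshift B : 'M[R]_(n + n) := block_mx 1%:M B 0 1%:M.

Lemma BshiftNK B : Bshift B *m Bshift (- B) = 1%:M.
Proof.
rewrite /Bshift mulmx_block !mul1mx !mulmx1 !mul0mx !mulmx0 !addr0 add0r addNr.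
by rewrite -scalar_mx_block.
Qed.

Lemma BshiftKN B : Bshift (- B) *m Bshift B = 1%:M.
Proof. by rewrite -{2}[B]opprK BshiftNK. Qed.

Lemma Bshift_orthogonal B : B^T = - B ->
  Bshift B *m pairing_mx *m (Bshift B)^T = pairing_mx.
Proof.
move=> Bskew; rewrite /Bshift /pairing_mx tr_block_mx !mulmx_block !trmx1 trmx0.
by rewrite !(mul1mx, mulmx1, mul0mx, mulmx0, addr0, add0r) Bskew subrr.
Qed.

(* exp (B - iF) defines the conjugate by the B-field transform B of the
   structure defined by exp (- iF). *)
Definition Jsym B F : 'M[R]_(n + n) :=
  Bshift B *m block_mx 0 (- F) (invmx F) 0 *m Bshift (- B).

Lemma Jsym_sq B F : F \in unitmx -> Jsym B F *m Jsym B F = - 1%:M.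
Proof.
move=> uF; rewrite /Jsym; set M := block_mx _ _ _ _.
transitivity (Bshift B *m (M *m (Bshift (- B) *m Bshift B) *m M) *m Bshift (- B)).
  by rewrite !mulmxA.
rewrite BshiftKN mulmx1 /M mulmx_block.
rewrite !(mul0mx, mulmx0, addr0, add0r) mulNmx mulmxN mulmxV// mulVmx//.
rewrite (_ : block_mx _ _ _ _ = - 1%:M) ?mulmxN ?mulmx1 ?mulNmx ?BshiftNK//.
by rewrite scalar_mx_block opp_block_mx !oppr0.
Qed.

Lemma Jsym_orthogonal B F : F \in unitmx -> B^T = - B -> F^T = - F ->
  Jsym B F *m pairing_mx *m (Jsym B F)^T = pairing_mx.
Proof.
move=> uF Bs Fs; rewrite /Jsym !trmx_mul.
have NBs : (- B)^T = - - B by rewrite linearN/= Bs.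
set M := block_mx _ _ _ _.
transitivity (Bshift B *m (M *m (Bshift (- B) *m pairing_mx *m
    (Bshift (- B))^T) *m M^T) *m (Bshift B)^T); first by rewrite !mulmxA.
rewrite Bshift_orthogonal// (_ : M *m _ *m _ = pairing_mx) ?Bshift_orthogonal//.
rewrite /M /pairing_mx tr_block_mx !mulmx_block.
rewrite !(trmx0, mul1mx, mulmx1, mul0mx, mulmx0, addr0, add0r).
rewrite trmx_inv linearN/= Fs opprK mulVmx// mulNmx.
rewrite (_ : invmx (- F) = - invmx F) ?mulmxN ?mulmxV ?opprK//.
have uNF : - F \in unitmx by rewrite -scaleN1r unitmxZ ?unitrN1.
by apply: (can_inj (mulKmx uNF)); rewrite mulmxV// mulNmx mulmxN mulmxV// opprK.
Qed.

Lemma Jsym_push B F B' F' D : D \in unitmx -> F \in unitmx ->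
  B = D *m B' *m D^T -> F = D *m F' *m D^T ->
  Jsym B F *m pushTT D = pushTT D *m Jsym B' F'.
Proof.
move=> uD uF defB defF.
have uDT : D^T \in unitmx by rewrite unitmx_tr.
have uF' : F' \in unitmx.
  by move: uF; rewrite defF !unitmx_mul uD uDT/= andbT.
have pushB E E' : E = D *m E' *m D^T ->
    Bshift E *m pushTT D = pushTT D *m Bshift E'.
  move=> ->; rewrite /Bshift /pushTT !mulmx_block.
  by rewrite !(mul1mx, mulmx1, mul0mx, mulmx0, addr0, add0r) trmx_inv mulmxK.
rewrite /Jsym -[LHS]mulmxA (pushB _ (- B')); last by rewrite defB mulmxN mulNmx.
rewrite mulmxA [RHS]mulmxA [in RHS]mulmxA -(pushB _ _ defB).
congr (_ *m _); rewrite -!mulmxA; congr (_ *m _).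
rewrite /pushTT !mulmx_block !(mul0mx, mulmx0, addr0, add0r) trmx_inv; congr block_mx.
  by rewrite defF mulNmx mulmxK// mulmxN.
apply: (can_inj (mulKmx uF)); rewrite mulmxA mulmxV// mul1mx [in RHS]defF.
by rewrite !mulmxA mulmxK// mulmxK.
Qed.

Variable I : 'M[R]_n.
Hypotheses (I2 : I *m I = - 1%:M) (IT : I^T = - I).

(** For S = 0 this is the generalized complex structure of the ordinary complex structure I: by
    [IT], the block - I on covectors is the transpose of I. The bivector S adds a map from covectors
    to vectors. *)
Definition Jhol S : 'M[R]_(n + n) := block_mx (- I) 0 S (- I).

Lemma Jhol_sq S : S *m I = - (I *m S) -> Jhol S *m Jhol S = - 1%:M.
Proof.
move=> SI; rewrite /Jhol mulmx_block !(mul0mx, mulmx0, addr0, add0r) !mulNmx !mulmxN.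
by rewrite SI !opprK subrr I2 scalar_mx_block opp_block_mx !oppr0.
Qed.

Lemma Jhol_orthogonal S : S *m I = - (I *m S) -> S^T = - S ->
  Jhol S *m pairing_mx *m (Jhol S)^T = pairing_mx.
Proof.
move=> SI Ss; rewrite /Jhol /pairing_mx tr_block_mx !mulmx_block.
rewrite !(trmx0, mul1mx, mulmx1, mul0mx, mulmx0, addr0, add0r).
by rewrite linearN/= IT opprK Ss !mulNmx !mulmxN I2 !opprK SI subrr.
Qed.

Lemma Jhol_push S S' D : D \in unitmx -> D *m I = I *m D ->
  D^T *m S *m D = S' -> Jhol S *m pushTT D = pushTT D *m Jhol S'.
Proof.
move=> uD DI DSD; have uDT : D^T \in unitmx by rewrite unitmx_tr.
rewrite /Jhol /pushTT !mulmx_block !(mul0mx, mulmx0, addr0, add0r) !mulNmx !mulmxN.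
rewrite trmx_inv DI -DSD -mulmxA mulKmx//; congr (block_mx _ _ _ (- _)).
have IDT : I *m D^T = D^T *m I.
  by apply: trmx_inj; rewrite !trmx_mul trmxK IT mulNmx mulmxN DI.
by apply: (can_inj (mulKmx uDT)); rewrite mulmxA -IDT mulmxK// mulKVmx.
Qed.

Section Pair.
Variables (B F S : 'M[R]_n).
Hypotheses (uF : F \in unitmx) (IF : F *m I = I *m F).
Hypotheses (BT : B^T = - B) (ST : S^T = - S) (SI : S *m I = - (I *m S)).
(** With beta = B - iF and given [IF], these are the real and imaginary parts of beta I - I beta =
    beta S beta. *)
Hypotheses (commute1 : B *m I - I *m B - B *m S *m B = - (F *m S *m F))
           (commute2 : B *m S *m F = - (F *m S *m B)).

Let a := I + B *m S.
Let d := I - S *m B.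
Let Jc : 'M[R]_(n + n) := block_mx (- a) (- (F *m S *m F)) S (- d).

(** [Jc] is [Jhol S] seen after removing the B-field; [commute1] identifies its upper right block
    with - FSF. On this side [Jsym B F] depends on F alone, which makes both commutation and
    definiteness computable. *)
Lemma Jhol_conj : Jhol S = Bshift B *m Jc *m Bshift (- B).
Proof.
have -> : Jc = Bshift (- B) *m Jhol S *m Bshift B.
  rewrite /Jc /Jhol /Bshift !mulmx_block !(mul1mx, mulmx1, mul0mx, mulmx0, addr0, add0r).
  rewrite -commute1 !mulNmx !mulmxN opprK /a /d mulmxDl mulNmx.
  congr block_mx.
  - by rewrite opprD.
  - by rewrite !mulNmx; mx_ring.
  - by rewrite opprB addrC.
by rewrite !mulmxA BshiftNK mul1mx -mulmxA BshiftNK mulmx1.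
Qed.

Lemma Fd : F *m d = a *m F.
Proof. by rewrite /a /d mulmxBr mulmxDl IF commute2 mulmxA. Qed.

Lemma Jhol_Jsym_comm : Jhol S *m Jsym B F = Jsym B F *m Jhol S.
Proof.
rewrite Jhol_conj /Jsym; set M := block_mx 0 _ _ _.
have conj X Y : Bshift B *m X *m Bshift (- B) *m (Bshift B *m Y *m Bshift (- B))
    = Bshift B *m (X *m Y) *m Bshift (- B).
  by rewrite !mulmxA -[_ *m Bshift (- B) *m Bshift B]mulmxA BshiftKN mulmx1.
rewrite !conj; congr (_ *m _ *m _).
rewrite /M /Jc !mulmx_block !(mul0mx, mulmx0, addr0, add0r) !mulNmx !mulmxN !opprK.
rewrite -Fd; congr block_mx.
- by rewrite mulmxK.
- congr (- _); apply: (can_inj (mulKmx uF)).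
  by rewrite !mulmxA Fd mulmxK// mulmxV// mul1mx.
- by rewrite !mulmxA mulVmx// mul1mx.
Qed.

Variables (g : 'M[R]_n) (k : R).
Hypotheses (gT : g^T = g) (defF : F = I *m g) (Ig : I *m g = g *m I).
Hypotheses (g_gt0 : forall X : 'rV[R]_n, X != 0 -> 0 < (X *m g *m X^T) 0 0).
Hypotheses (trace_cond : a *m I + I *m a = - (k *+ 2)%:M) (k_gt0 : 0 < k).

Let nn := F *m S.
Let N := F *m S *m F.

Let gIF : g = - (I *m F).
Proof. by rewrite defF mulmxA I2 mulNmx mul1mx opprK. Qed.

Let gFI : g = - (F *m I).
Proof. by rewrite IF gIF. Qed.

Let aT : a^T = - d.
Proof. by rewrite /a /d linearD/= trmx_mul IT ST BT mulmxN mulNmx opprK opprB addrC. Qed.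

Let FT : F^T = - F.
Proof. by rewrite defF trmx_mul gT IT mulmxN Ig. Qed.

Let nT : nn^T = S *m F.
Proof. by rewrite /nn trmx_mul ST FT mulmxN mulNmx opprK. Qed.

Let nI : nn *m I = - (I *m nn).
Proof. by rewrite /nn -mulmxA SI mulmxN !mulmxA IF. Qed.

Let a2 : a *m a = - 1%:M + nn *m nn.
Proof.
have -> : nn *m nn = N *m S by rewrite /nn /N !mulmxA.
have -> : N = - (B *m I - I *m B - B *m S *m B) by rewrite commute1 opprK.
rewrite /a mulmxDl !mulmxDr I2 -addrA; congr (_ + _).
rewrite mulNmx !mulmxBl -!mulmxA SI mulmxN.
by mx_ring.
Qed.

Let an : a *m nn = - (nn *m a).
Proof.
rewrite /nn !mulmxA -Fd -!mulmxA -mulmxN; congr (_ *m _).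
by rewrite /a /d mulmxBl mulmxDr SI opprD opprK !mulmxA.
Qed.

(** From a^T = - d and F d = a F one gets a g a^T = a I a F. Then [trace_cond] replaces a I by - 2k
    - I a, and a^2 = n^2 - 1 leaves terms in n that cancel against n g n^T. *)
Let sum_squares_diag :
  a *m g *m a^T + nn *m g *m nn^T + g = (k *+ 2) *: (- (a *m F)).
Proof.
have -> : a *m g *m a^T = (k *+ 2) *: (- (a *m F)) - g + nn *m nn *m g.
  have -> : a *m g *m a^T = a *m I *m a *m F.
    rewrite aT gIF !(mulmxN, mulNmx) opprK (mulmxA a I F) -(mulmxA (a *m I) F d) Fd.
    by rewrite (mulmxA (a *m I) a F).
  have -> : a *m I *m a = - (k *+ 2)%:M *m a - I *m (a *m a).
    by rewrite -trace_cond mulmxDl mulmxA addrK.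
  rewrite a2 mulmxBl mulNmx mul_scalar_mx mulNmx -scalemxAl scalerN -addrA.
  congr (_ + _); rewrite mulmxDr mulmxN mulmx1 mulmxDl opprD mulNmx -gIF; congr (_ + _).
  have In : I *m nn = - (nn *m I) by rewrite nI opprK.
  rewrite gIF mulmxN; congr (- _); rewrite (mulmxA I nn nn) In mulNmx.
  by rewrite -(mulmxA nn I nn) In mulmxN opprK (mulmxA nn nn) (mulmxA _ I F).
have -> : nn *m g *m nn^T = - (nn *m nn *m g).
  rewrite nT /nn {1}gFI {1}gIF !mulmxN !mulNmx opprK !mulmxA.
  have IS : I *m S = - (S *m I) by rewrite SI opprK.
  by rewrite -(mulmxA _ I S) IS !mulmxN !mulNmx opprK !mulmxA.
by rewrite addrK subrK.
Qed.

Let sum_squares_cross :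
  nn *m g *m a^T - a *m g *m nn^T = - ((k *+ 2) *: N).
Proof.
have -> : nn *m g *m a^T = I *m a *m N.
  rewrite aT gIF !(mulmxN, mulNmx) opprK !mulmxA -(mulmxA (nn *m I)) Fd !mulmxA nI.
  have na : nn *m a = - (a *m nn) by rewrite an opprK.
  by rewrite !mulNmx -(mulmxA I nn) na mulmxN mulNmx opprK /nn /N !mulmxA.
have -> : a *m g *m nn^T = - (a *m I *m N).
  by rewrite nT gIF /N !(mulmxN, mulNmx) !mulmxA.
by rewrite opprK addrC -mulmxDl trace_cond mulNmx mul_scalar_mx.
Qed.

Let sq (X : 'rV[R]_n) := (X *m g *m X^T) 0 0.

Let tr00 (M : 'M[R]_1) : M^T 0 0 = M 0 0. Proof. by rewrite mxE. Qed.

Let gX (X Y : 'rV[R]_n) : (Y *m g *m X^T) 0 0 = (X *m g *m Y^T) 0 0.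
Proof. by rewrite -tr00 !trmx_mul trmxK gT mulmxA. Qed.

(** Twice (J_1 J_2 A, A), where the transform of A by B is X + Y F. *)
Let quadratic_form (X Y : 'rV[R]_n) : R :=
  - (X *m (a *m F) *m X^T) 0 0 - (Y *m (a *m F) *m Y^T) 0 0
  - 2 * (X *m N *m Y^T) 0 0.

Let sum_squares (X Y : 'rV[R]_n) :
  (k *+ 2) * quadratic_form X Y =
  sq (X *m a - Y *m nn) + sq (Y *m a + X *m nn) + sq X + sq Y.
Proof.
have diag (Z : 'rV[R]_n) : (k *+ 2) * - (Z *m (a *m F) *m Z^T) 0 0 =
    sq (Z *m a) + sq (Z *m nn) + sq Z.
  transitivity ((Z *m ((k *+ 2) *: (- (a *m F))) *m Z^T) 0 0).
    by rewrite -scalemxAr -scalemxAl mulmxN mulNmx mx_scaleE mx_oppE.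
  rewrite -sum_squares_diag /sq 2!mulmxDr 2!mulmxDl !mx_addE.
  by rewrite (trmx_mul Z a) (trmx_mul Z nn) !mulmxA.
have cross : (k *+ 2) * - (2 * (X *m N *m Y^T) 0 0) =
    2 * ((X *m nn *m g *m (Y *m a)^T) 0 0 - (X *m a *m g *m (Y *m nn)^T) 0 0).
  transitivity (2 * (X *m (- ((k *+ 2) *: N)) *m Y^T) 0 0).
    by rewrite mulmxN mulNmx -scalemxAr -scalemxAl mx_oppE mx_scaleE; ring.
  rewrite -sum_squares_cross mulmxBr mulmxBl mx_addE mx_oppE.
  by rewrite (trmx_mul Y a) (trmx_mul Y nn) !mulmxA.
have sqD (Z W : 'rV[R]_n) : sq (Z + W) = sq Z + sq W + 2 * (Z *m g *m W^T) 0 0.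
  by rewrite /sq linearD/= !(mulmxDr, mulmxDl) !mx_addE (gX Z W); ring.
have sqN Z : sq (- Z) = sq Z by rewrite /sq linearN/= !(mulmxN, mulNmx) opprK.
rewrite /quadratic_form !mulrDr !diag cross !sqD sqN linearN/= mulmxN mx_oppE.
by rewrite (gX (X *m nn) (Y *m a)); ring.
Qed.

Let quadratic_form_gt0 X Y : (X != 0) || (Y != 0) -> 0 < quadratic_form X Y.
Proof.
move=> XY0; rewrite -(@pmulr_rgt0 _ (k *+ 2)) ?sum_squares ?pmulrn_lgt0//.
have sq_ge0 Z : 0 <= sq Z.
  have [->|Z0] := eqVneq Z 0; first by rewrite /sq !mul0mx mxE.
  exact/ltW/g_gt0.
have sqXY : 0 < sq X + sq Y.
  by case/orP: XY0 => Z0; [apply: ltr_pwDl|apply: ltr_wpDl] => //; exact: g_gt0.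
by rewrite -addrA ltr_wpDl// addr_ge0.
Qed.

Lemma Jsym_Jhol_definite :
  definite (fun A => inner (A *m Jsym B F *m Jhol S) A).
Proof.
left => A A0; rewrite innerE.
have uB : Bshift B \in unitmx.
  by case/mulmx1_unit: (BshiftNK B).
(* Writing the covector part as Y F turns both halves of A into vectors, which g can measure. *)
pose X := lsubmx (A *m Bshift B); pose Y := rsubmx (A *m Bshift B) *m invmx F.
have AE : A *m Bshift B = row_mx X (Y *m F).
  by rewrite /Y mulmxKV// hsubmxK.
have XY0 : (X != 0) || (Y != 0).
  apply: contraNT A0; rewrite negb_or !negbK => /andP[/eqP X0 /eqP Y0].
  rewrite -(mulmxK uB A) AE X0 Y0 mul0mx.
  by rewrite row_mx0 mul0mx.
rewrite Jhol_conj /Jsym; set M := block_mx 0 _ _ _.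
have -> : A *m (Bshift B *m M *m Bshift (- B)) *m (Bshift B *m Jc *m Bshift (- B))
    *m pairing_mx *m A^T =
    A *m Bshift B *m (M *m Jc *m pairing_mx) *m (A *m Bshift B)^T.
  transitivity (A *m Bshift B *m M *m (Bshift (- B) *m Bshift B) *m Jc *m
      (Bshift (- B) *m pairing_mx) *m A^T); first by rewrite !mulmxA.
  rewrite BshiftKN mulmx1 -{1}(Bshift_orthogonal BT) (trmx_mul A).
  rewrite [Bshift (- B) *m _]mulmxA [Bshift (- B) *m _]mulmxA BshiftKN mul1mx.
  by rewrite !mulmxA.
have := quadratic_form_gt0 XY0; rewrite AE.
have -> : M *m Jc *m pairing_mx = block_mx (a *m F) (- nn) (- (S *m F)) (- (invmx F *m a)).
  rewrite /M /Jc /pairing_mx !mulmx_block.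
  rewrite !(mul0mx, mulmx0, addr0, add0r, mulmx1, mul1mx) !mulmxN !mulNmx opprK -Fd.
  by rewrite !mulmxA mulVmx// mul1mx.
rewrite tr_row_mx mul_row_block mul_row_col (trmx_mul Y F) FT.
have NT : N^T = - N.
  by rewrite /N -(mulmxA F) trmx_mul (trmx_mul S) FT ST !(mulmxN, mulNmx) opprK mulmxA.
have YNX : (Y *m N *m X^T) 0 0 = - (X *m N *m Y^T) 0 0.
  by rewrite -(tr00 (Y *m N *m X^T)) trmx_mul trmxK (trmx_mul Y) NT mulNmx mulmxN mx_oppE mulmxA.
set L := (X in _ -> 0 < _ * X).
suff -> : L = - quadratic_form X Y by move=> ?; lra.
rewrite /L 2!mulmxDl 3!mx_addE /quadratic_form.
have -> : (Y *m F *m - (S *m F) *m X^T) 0 0 = (X *m N *m Y^T) 0 0.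
  by rewrite -[RHS]opprK -YNX mulmxN mulNmx mx_oppE /N !mulmxA.
have -> : X *m - nn *m (- F *m Y^T) = X *m N *m Y^T.
  by rewrite !(mulmxN, mulNmx) opprK /N /nn !mulmxA.
have -> : Y *m F *m - (invmx F *m a) *m (- F *m Y^T) = Y *m (a *m F) *m Y^T.
  by rewrite !(mulmxN, mulNmx) opprK (mulmxA (Y *m F)) mulmxK// !mulmxA.
by ring.
Qed.

End Pair.
End GeneralizedLinearAlgebra.

(** * Mean values along lines and the symmetry of second derivatives *)

Section Lines.
Variables (R : realType) (V : normedModType R).
Implicit Types (f : V -> R) (x u v : V).

Lemma is_derive_line f x v (t : R) : derivable f (x + t *: v) v ->
  is_derive t 1 (fun s : R => f (x + s *: v)) ('D_v f (x + t *: v)).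
Proof.
move=> df; have E : (fun h : R => h^-1 *: (((fun s : R => f (x + s *: v)) \o shift t) (h *: 1) - f (x + t *: v)))
    = (fun h => h^-1 *: ((f \o shift (x + t *: v)) (h *: v) - f (x + t *: v))).
  apply/funext => h /=; rewrite [h *: 1]mulr1 scalerDl.
  by congr (_ *: (f _ - _)); rewrite addrCA.
by apply: DeriveDef; rewrite /derivable /derive ?E.
Qed.

Lemma mvt_line f x v (h : R) : (forall y, derivable f y v) ->
  exists2 c : R, `|c| <= `|h| & f (x + h *: v) - f x = h * 'D_v f (x + c *: v).
Proof.
move=> df.
have H (y : V) (w : V) (k : R) : 0 <= k -> (forall y, derivable f y w) ->
    exists2 c : R, 0 <= c <= k & f (y + k *: w) - f y = k * 'D_w f (y + c *: w).
  move=> k0 dfw.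
  have dl (t : R) : is_derive t 1 (fun s : R => f (y + s *: w)) ('D_w f (y + t *: w)).
    exact: is_derive_line.
  have [] := @MVT_segment R (fun s : R => f (y + s *: w)) (fun t => 'D_w f (y + t *: w)) 0 k k0.
    apply: continuous_subspaceT => t.
    by apply/differentiable_continuous/derivable1_diffP; have := dl t.
  move=> c; rewrite in_itv/= => ck; rewrite scale0r addr0 subr0 => ->.
  by exists c => //; rewrite mulrC.
have [h0|h0] := leP 0 h.
  have [c /andP[c0 ch] E] := H x v h h0 df; exists c => //.
  by rewrite !ger0_norm.
(* For h < 0 the segment is run from its other end, with step - h. *)
have [|c /andP[c0 ch] E] := H (x + h *: v) v (- h) _ df; first by rewrite oppr_ge0 ltW.
exists (h + c).
  rewrite (ltr0_norm h0) ler0_norm ?opprD; first by rewrite gerBl.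
  by lra.
move: E; rewrite -addrA -scalerDl subrr scale0r addr0 -addrA -scalerDl => E.
by rewrite -opprB E mulNr opprK.
Qed.

Lemma is_derive_translate f b y a df : is_derive (b + y) a f df ->
  is_derive y a (fun z => f (b + z)) df.
Proof.
have E : (fun h : R => h^-1 *: (((fun z => f (b + z)) \o shift y) (h *: a) - f (b + y)))
    = (fun h => h^-1 *: ((f \o shift (b + y)) (h *: a) - f (b + y))).
  by apply/funext => h /=; rewrite addrCA.
by move=> [d1 d2]; apply: DeriveDef; [rewrite /derivable E|rewrite -d2 /derive E].
Qed.

(** Schwarz's theorem by second differences: the difference over the parallelogram with sides h u
    and h v does not depend on the order of the sides, while two mean value steps turn it into h^2
    times either mixed derivative at a point close to x. *)
Lemma derive_swap f x u v : smooth_on setT f ->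
  'D_u ('D_v f) x = 'D_v ('D_u f) x.
Proof.
move=> sf.
have dft b y a : is_derive y a (fun z => f (b + z)) ('D_a f (b + y)).
  by apply/is_derive_translate/derivableP; exact: smooth_onT_derivable.
have step (a b : V) (h : R) : exists s t : R, [/\ `|s| <= `|h|, `|t| <= `|h| &
    f (x + h *: a + h *: b) - f (x + h *: a) - f (x + h *: b) + f x =
    h * (h * 'D_b ('D_a f) (x + s *: a + t *: b))].
  have dD y : derivable (fun y => f (h *: b + y) - f y) y a.
    by apply: derivableB; [have := dft (h *: b) y a|exact: smooth_onT_derivable].
  have [s sh Es] := mvt_line x h dD.
  have [|t th Et] := @mvt_line ('D_a f) (x + s *: a) b h.
    by move=> y; apply: smooth_onT_derivable; exact: smooth_onT_derive.
  exists s, t; split=> //.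
  have -> : f (x + h *: a + h *: b) - f (x + h *: a) - f (x + h *: b) + f x =
      f (h *: b + (x + h *: a)) - f (x + h *: a) - (f (h *: b + x) - f x).
    by rewrite ![h *: b + _]addrC; ring.
  rewrite Es; congr (_ * _); rewrite -Et deriveB; last 2 first.
  - by have := dft (h *: b) (x + s *: a) a.
  - exact: smooth_onT_derivable.
  by have /@derive_val -> := dft (h *: b) (x + s *: a) a; rewrite [h *: b + _]addrC.
have sD a b : smooth_on setT ('D_a ('D_b f)) by do 2! apply: smooth_onT_derive.
have near_x a b (e : R) : 0 < e -> \forall y \near x,
    `|'D_a ('D_b f) x - 'D_a ('D_b f) y| <= e.
  by have /smooth_onT_continuous/(_ x)/cvgrPdist_le := sD a b; exact.
apply/eqP; rewrite -subr_eq0 -normr_le0; apply/ler_addgt0Pl => e e0; rewrite addr0.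
have e20 : 0 < e / 2 by rewrite divr_gt0.
have /nbhs_ballP[d /= d0 dP] : nbhs x (fun y =>
    `|'D_u ('D_v f) x - 'D_u ('D_v f) y| <= e / 2 /\
    `|'D_v ('D_u f) x - 'D_v ('D_u f) y| <= e / 2) by apply: filterI; exact: near_x.
(* Small enough for s u + t v to have norm less than d when |s|, |t| <= h; the summand 1 covers u =
   v = 0. *)
pose h := d / (2 * (`|u| + `|v| + 1)).
have w0 : 0 < `|u| + `|v| + 1 by rewrite ltr_wpDl// addr_ge0.
have h0 : 0 < h by rewrite divr_gt0// mulr_gt0.
have close a b (s t : R) : `|a| + `|b| = `|u| + `|v| -> `|s| <= `|h| -> `|t| <= `|h| ->
    ball x d (x + s *: a + t *: b).
  move=> ab sh th; rewrite -ball_normE/= -addrA opprD addrA subrr sub0r normrN.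
  apply: (le_lt_trans (ler_normD _ _)); rewrite !normrZ.
  apply: (@le_lt_trans _ _ (h * (`|u| + `|v|))).
    rewrite -ab mulrDr; rewrite (gtr0_norm h0) in sh th.
    by apply: lerD; apply: ler_wpM2r.
  rewrite /h mulrAC ltr_pdivrMr ?mulr_gt0// ltr_pM2l//.
  have : 0 <= `|u| + `|v| by rewrite addr_ge0.
  by move=> ?; lra.
have [s [t [sh th E1]]] := step u v h; have [s' [t' [sh' th' E2]]] := step v u h.
have E : 'D_v ('D_u f) (x + s *: u + t *: v) = 'D_u ('D_v f) (x + s' *: v + t' *: u).
  have hn0 : h != 0 by rewrite gt_eqF.
  have : f (x + h *: u + h *: v) - f (x + h *: u) - f (x + h *: v) + f x =
      f (x + h *: v + h *: u) - f (x + h *: v) - f (x + h *: u) + f x.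
    by rewrite (addrAC x (h *: u)); congr (_ + _); exact: addrAC.
  by rewrite E1 E2 => /(mulfI hn0)/(mulfI hn0).
have [_ H2] := dP _ (close _ _ _ _ erefl sh th).
have [H1 _] := dP _ (close _ _ _ _ (addrC _ _) sh' th').
move: E H1 H2.
generalize ('D_v ('D_u f) (x + s *: u + t *: v)) ('D_u ('D_v f) (x + s' *: v + t' *: u)).
generalize ('D_u ('D_v f) x) ('D_v ('D_u f) x) => p q a _ <- H1 H2.
by rewrite (splitr e) (le_trans (ler_distD a _ _))// lerD// distrC.
Qed.

End Lines.

(** * Weighted integrals along rays depend smoothly on the end point *)

Section RadialIntegral.
Variables (R : realType) (V : normedModType R).
Implicit Types (S : V -> R) (x v : V).
Local Notation mu := (@lebesgue_measure R).

Lemma Rintegral01_dist (F G : R -> R) (e : R) : continuous F -> continuous G ->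
  (forall p, 0 <= p <= 1 -> `|F p - G p| <= e) ->
  `|\int[mu]_(p in `[0, 1]) F p - \int[mu]_(p in `[0, 1]) G p| <= e.
Proof.
move=> cF cG FGe.
have int01 (H : R -> R) : continuous H -> mu.-integrable `[0, 1] (EFin \o H).
  move=> cH; apply: continuous_compact_integrable; first exact: segment_compact.
  exact: continuous_subspaceT.
have cB : continuous (fun p => F p - G p) by move=> p; apply: cvgB; [exact: cF|exact: cG].
rewrite -RintegralB//; [|exact: int01..].
apply: (le_trans (le_normr_Rintegral _ _)) => //; first exact: int01.
apply: (@le_trans _ _ (\int[mu]_(p in `[0, 1]) e)).
  apply: le_Rintegral => //.
  - by apply: int01 => p; apply: cvg_norm; exact: cB.
  - by apply: int01 => p; exact: cvg_cst.
by rewrite Rintegral_cst//= lebesgue_measure_itv/= lte_fin ltr01 oppr0 adde0 mulr1.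
Qed.

(** Compactness of [0, 1] makes the neighbourhood of x independent of p. *)
Lemma near_scale_uniform S x e : continuous S -> 0 < e ->
  \forall y \near x, forall p : R, 0 <= p <= 1 -> `|S (p *: y) - S (p *: x)| <= e.
Proof.
move=> cS e0.
have /compact_near_coveringP/near_covering_withinP := @segment_compact R 0 1.
move=> /(_ _ (nbhs x) (fun y p => `|S (p *: y) - S (p *: x)| <= e)).
have e20 : 0 < e / 2 by rewrite divr_gt0.
move=> H; apply: filterS (H _ _) => [y Hy p p01|p _].
  by apply: Hy; rewrite /= in_itv.
have H1 : \forall py \near (nbhs p, nbhs x), `|S (p *: x) - S (py.1 *: py.2)| <= e / 2.
  have /cvgrPdist_le : S (py.1 *: py.2) @[py --> (nbhs p, nbhs x)] --> S (p *: x).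
    by apply: continuous_cvg; [exact: cS|apply: cvgZ; [exact: cvg_fst|exact: cvg_snd]].
  exact.
have H2 : \forall py \near (nbhs p, nbhs x), `|S (p *: x) - S (py.1 *: x)| <= e / 2.
  have /cvgrPdist_le : S (py.1 *: x) @[py --> (nbhs p, nbhs x)] --> S (p *: x).
    by apply: continuous_cvg; [exact: cS|apply: cvgZ; [exact: cvg_fst|exact: cvg_cst]].
  exact.
apply: filterS2 H1 H2 => -[q y] /= H1 H2 _.
rewrite -(subrKA (S (p *: x))) addrC (le_trans (ler_normD _ _))// [leRHS]splitr.
by rewrite lerD// distrC.
Qed.

(** The exponent is a parameter so that the family is stable under differentiation: deriving S (p x)
    in x produces one more factor p. *)
Definition radial_mean (c : nat) S x : R :=
  \int[mu]_(p in `[0, 1]) (p ^+ c * S (p *: x)).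

Lemma continuous_radial c S x : continuous S ->
  continuous (fun p : R => p ^+ c * S (p *: x)).
Proof.
move=> cS p; apply: cvgM; first exact: exprn_continuous.
apply: (@continuous_comp _ _ _ (fun p : R => p *: x) S); last exact: cS.
exact: scalel_continuous.
Qed.

Lemma radial_mean_continuous c S : continuous S -> continuous (radial_mean c S).
Proof.
move=> cS x; apply/cvgrPdist_le => e e0.
near=> y; rewrite distrC; apply: Rintegral01_dist; [exact: continuous_radial..|].
move=> p p01; rewrite -mulrBr normrM.
apply: (@le_trans _ _ (1 * `|S (p *: y) - S (p *: x)|)).
  rewrite ler_wpM2r// normrX; case/andP: p01 => p0 p1.
  by rewrite ger0_norm// exprn_ile1.
rewrite mul1r; move: p p01; near: y; exact: near_scale_uniform.
Unshelve. all: by end_near. Qed.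

Lemma is_derive_radial_mean c S x v : smooth_on setT S ->
  is_derive x v (radial_mean c S) (radial_mean c.+1 ('D_v S) x).
Proof.
move=> sS.
suff H : h^-1 *: ((radial_mean c S \o shift x) (h *: v) - radial_mean c S x)
    @[h --> 0^'] --> radial_mean c.+1 ('D_v S) x.
  by apply: DeriveDef; [apply/cvg_ex; eexists; exact: H|exact: cvg_lim H].
have cS := smooth_onT_continuous sS.
have cDS : continuous ('D_v S) by apply/smooth_onT_continuous/smooth_onT_derive.
apply/cvgrPdist_le => e e0.
have /nbhs_ballP[d /= d0 dP] := near_scale_uniform x cDS e0.
have w0 : 0 < `|v| + 1 by rewrite ltr_wpDl.
near=> h.
have hn0 : h != 0 by near: h; exact: nbhs_dnbhs_neq.
have hd : `|h| < d / (`|v| + 1).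
  near: h; apply: dnbhs0_lt; exact: divr_gt0.
rewrite -(ler_pM2l (x := `|h|)) ?normr_gt0// -normrM mulrBr.
rewrite -[h^-1 *: _]/(h^-1 * _) mulVKf//=.
have int01 (H : R -> R) : continuous H -> mu.-integrable `[0, 1] (EFin \o H).
  move=> cH; apply: continuous_compact_integrable; first exact: segment_compact.
  exact: continuous_subspaceT.
have cI1 := int01 _ (@continuous_radial c.+1 _ x cDS).
have cI2 y := int01 _ (@continuous_radial c _ y cS).
rewrite /radial_mean -(RintegralZl h _ cI1)// -(RintegralB _ (cI2 _) (cI2 _))//.
apply: (@Rintegral01_dist (fun p : R => h * (p ^+ c.+1 * 'D_v S (p *: x)))
    (fun p : R => p ^+ c * S (p *: (h *: v + x)) - p ^+ c * S (p *: x))).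
- move=> p; apply: cvgM; first exact: cvg_cst.
  exact: (@continuous_radial c.+1 ('D_v S) x cDS p).
- by move=> p; apply: cvgB; exact: continuous_radial.
move=> p p01; have /andP[p0 p1] := p01.
have dS y : derivable S y v by exact: smooth_onT_derivable.
have [c' c'h E] := mvt_line (p *: x) (h * p) dS.
(* The intermediate point p x + c' v is rewritten as p (x + k v), the form to which the uniform
   estimate [dP] applies. For p = 0 the bound forces c' = 0 and k = 0 will do. *)
have [k kh kE] : exists2 k, `|k| <= `|h| & c' = p * k.
  have [p00|pn0] := eqVneq p 0.
    exists 0; first by rewrite normr0.
    by rewrite mulr0; apply/eqP; rewrite -normr_le0 (le_trans c'h)// p00 mulr0 normr0.
  exists (c' / p); last by rewrite mulrCA divff// mulr1.
  have pp : 0 < p by rewrite lt_neqAle eq_sym pn0.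
  by rewrite normrM normfV (gtr0_norm pp) ler_pdivrMr//; move: c'h; rewrite normrM (gtr0_norm pp).
rewrite -mulrBr (_ : p *: (h *: v + x) = p *: x + (h * p) *: v); last first.
  by rewrite scalerDr addrC scalerA mulrC.
rewrite E kE -scalerA -scalerDr exprS.
set A := 'D_v S _; set B := 'D_v S _.
rewrite (_ : _ - _ = h * (p ^+ c.+1 * (A - B))); last by rewrite exprS; ring.
rewrite normrM ler_wpM2l// normrM.
apply: (@le_trans _ _ (1 * `|A - B|)).
  by rewrite ler_wpM2r// normrX ger0_norm// exprn_ile1.
rewrite mul1r distrC; apply: dP p01; rewrite -ball_normE/= opprD addrA subrr sub0r normrN.
rewrite normrZ (@le_lt_trans _ _ (`|h| * (`|v| + 1)))//.
  by rewrite ler_pM// lerDl.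
by rewrite -ltr_pdivlMr.
Unshelve. all: by end_near. Qed.

Lemma smooth_radial_mean c S : smooth_on setT S -> smooth_on setT (radial_mean c S).
Proof.
move=> sS k; elim: k c S sS => [|k IH] c S sS.
  by split=> // x _; apply: radial_mean_continuous; exact: smooth_onT_continuous.
apply/Ck_onS; split; first exact/radial_mean_continuous/smooth_onT_continuous.
move=> v; split=> [x|]; first by have := is_derive_radial_mean c x v sS.
rewrite (_ : 'D_v _ = radial_mean c.+1 ('D_v S)).
  exact/IH/smooth_onT_derive.
by apply/funext => x; have /@derive_val -> := is_derive_radial_mean c x v sS.
Qed.

End RadialIntegral.

(** * Derivatives of complex-valued functions along real directions *)

Section ComplexDerivatives.
Variables (R : realType) (V : normedModType R).
Implicit Types (f g : V -> R[i]) (x v : V) (df dg : R[i]).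
Local Notation Re := (@complex.Re R).
Local Notation Im := (@complex.Im R).

Definition is_cderive x v f df : Prop :=
  is_derive x v (fun y => Re (f y)) (Re df) /\
  is_derive x v (fun y => Im (f y)) (Im df).

Definition cderive v f x : R[i] :=
  'D_v (fun y => Re (f y)) x +i* 'D_v (fun y => Im (f y)) x.

Lemma cderive_val x v f df : is_cderive x v f df -> cderive v f x = df.
Proof.
move=> [h1 h2]; rewrite /cderive (derive_val (is_derive := h1)).
by rewrite (derive_val (is_derive := h2)); case: (df).
Qed.

Lemma is_cderive_eq x v f df dg : is_cderive x v f df -> df = dg ->
  is_cderive x v f dg.
Proof. by move=> h <-. Qed.

Lemma is_cderive_near x v f g df : (\near x, f x = g x) ->
  is_cderive x v f df -> is_cderive x v g df.
Proof.
move=> fg [h1 h2]; split.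
  by apply: near_eq_is_derive h1; apply: filterS fg => y ->.
by apply: near_eq_is_derive h2; apply: filterS fg => y ->.
Qed.

Lemma is_cderive_cst x v (c : R[i]) : is_cderive x v (fun _ => c) 0.
Proof. by split; exact: is_derive_cst. Qed.

Lemma is_cderive_real x v (f : V -> R) (df : R) : is_derive x v f df ->
  is_cderive x v (fun y => (f y)%:C) df%:C.
Proof. by split => //=; exact: is_derive_cst. Qed.

Lemma is_cderiveD x v f g df dg : is_cderive x v f df -> is_cderive x v g dg ->
  is_cderive x v (fun y => f y + g y) (df + dg).
Proof.
move=> [f1 f2] [g1 g2]; rewrite /is_cderive !raddfD/=.
by split; [under eq_fun do rewrite raddfD/=|under eq_fun do rewrite raddfD/=];
  exact: is_deriveD.
Qed.

Lemma is_cderiveN x v f df : is_cderive x v f df ->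
  is_cderive x v (fun y => - f y) (- df).
Proof.
move=> [f1 f2]; rewrite /is_cderive !raddfN/=.
by split; [under eq_fun do rewrite raddfN/=|under eq_fun do rewrite raddfN/=];
  exact: is_deriveN.
Qed.

Lemma is_cderiveB x v f g df dg : is_cderive x v f df -> is_cderive x v g dg ->
  is_cderive x v (fun y => f y - g y) (df - dg).
Proof. by move=> hf hg; apply: is_cderiveD => //; exact: is_cderiveN. Qed.

Lemma is_cderive_sum (n : nat) x v (f : 'I_n -> V -> R[i]) (df : 'I_n -> R[i]) :
  (forall i, is_cderive x v (f i) (df i)) ->
  is_cderive x v (fun y => \sum_i f i y) (\sum_i df i).
Proof.
elim: n f df => [|n IH] f df h.
  under eq_fun do rewrite big_ord0.
  by rewrite big_ord0; exact: is_cderive_cst.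
under eq_fun do rewrite big_ord_recl.
by rewrite big_ord_recl; apply: is_cderiveD => //; exact: IH.
Qed.

Lemma Re_mulc (a b : R[i]) : Re (a * b) = Re a * Re b - Im a * Im b.
Proof. by case: a; case: b. Qed.

Lemma Im_mulc (a b : R[i]) : Im (a * b) = Re a * Im b + Im a * Re b.
Proof. by case: a; case: b. Qed.

Lemma is_cderiveM x v f g df dg : is_cderive x v f df -> is_cderive x v g dg ->
  is_cderive x v (fun y => f y * g y) (df * g x + f x * dg).
Proof.
move=> [f1 f2] [g1 g2]; rewrite /is_cderive !raddfD/= !Re_mulc !Im_mulc; split.
  under eq_fun do rewrite Re_mulc.
  by apply: is_derive_eq; rewrite /GRing.scale/=; ring.
under eq_fun do rewrite Im_mulc.
by apply: is_derive_eq; rewrite /GRing.scale/=; ring.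
Qed.

Lemma is_cderiveX x v f df n : is_cderive x v f df ->
  is_cderive x v (fun y => f y ^+ n.+1) (n.+1%:R * f x ^+ n * df).
Proof.
move=> hf; elim: n => [|n IH].
  under eq_fun do rewrite expr1.
  by rewrite expr0 !mul1r.
under eq_fun do rewrite exprS.
apply: (is_cderive_eq (is_cderiveM hf IH)).
by rewrite -[n.+2%:R]natr1 exprS; ring.
Qed.

Lemma is_cderiveV x v f df : f x != 0 -> is_cderive x v f df ->
  is_cderive x v (fun y => (f y)^-1) (- (df / f x ^+ 2)).
Proof.
have ReV (z : R[i]) : Re z^-1 = Re z / (Re z ^+ 2 + Im z ^+ 2) by case: z.
have ImV (z : R[i]) : Im z^-1 = - (Im z / (Re z ^+ 2 + Im z ^+ 2)).
  by case: z.
move=> fx0 [f1 f2].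
have n0 : Re (f x) ^+ 2 + Im (f x) ^+ 2 != 0.
  move: fx0; apply: contra_neq => /eqP; rewrite paddr_eq0 ?sqr_ge0// !sqrf_eq0.
  by case: (f x) => a b /= /andP[/eqP -> /eqP ->].
have dn : is_derive x v (fun y => Re (f y) ^+ 2 + Im (f y) ^+ 2)
    (2 * (Re (f x) * Re df + Im (f x) * Im df)).
  by apply: is_derive_eq; rewrite /GRing.scale/=; ring.
have : is_derive x v (fun y => (Re (f y) ^+ 2 + Im (f y) ^+ 2)^-1)
    (- (2 * (Re (f x) * Re df + Im (f x) * Im df) / (Re (f x) ^+ 2 + Im (f x) ^+ 2) ^+ 2)).
  case: dn => dn1 dn2; apply: DeriveDef; first exact: derivableV.
  by rewrite deriveV// dn2 /GRing.scale/= mulNr mulrC.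
move=> dI; rewrite /is_cderive expr2 !raddfN/= !Re_mulc !Im_mulc !ReV !ImV !Re_mulc !Im_mulc; split.
  under eq_fun do rewrite ReV.
  apply: is_derive_eq; rewrite /GRing.scale/=.
  move: n0; move: (Re (f x)) (Im (f x)) (Re df) (Im df) => a b c d n0.
  field; rewrite n0 andbT (_ : _ ^+ 2 + _ ^+ 2 = (a ^+ 2 + b ^+ 2) ^+ 2); last by ring.
  by rewrite expf_neq0.
under eq_fun do rewrite ImV.
apply: is_derive_eq; rewrite /GRing.scale/=.
move: n0; move: (Re (f x)) (Im (f x)) (Re df) (Im df) => a b c d n0.
field; rewrite n0 andbT (_ : _ ^+ 2 + _ ^+ 2 = (a ^+ 2 + b ^+ 2) ^+ 2); last by ring.
  by rewrite expf_neq0.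
Qed.

End ComplexDerivatives.

(** * The graph of a closed 2-form is closed under the Courant bracket *)

Section CourantOnGraphs.
Variables (R : realType) (n : nat).
Local Notation V := 'rV[R]_n.
Implicit Types (U : set V) (u : V -> 'rV[R[i]]_(n + n)).

Lemma partialE i (f : V -> R[i]) x : partial i f x = cderive (delta_mx 0 i) f x.
Proof. by []. Qed.

Lemma smooth_complex_cderive p U (u : V -> 'rV[R[i]]_p) x v j :
  smooth_complex_on U u -> U x ->
  is_cderive x v (fun y => u y 0 j) (cderive v (fun y => u y 0 j) x).
Proof.
move=> [/(_ 1)[_ /(_ v)[du1 _]] /(_ 1)[_ /(_ v)[du2 _]]] Ux.
split; apply: derivableP.
- rewrite (_ : (fun y => _) = fun y => map_mx (@complex.Re R) (u y) 0 j).
    exact: (derivable_mxP _ _ _).1 (du1 _ Ux) 0 j.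
  by apply/funext => y; rewrite mxE.
- rewrite (_ : (fun y => _) = fun y => map_mx (@complex.Im R) (u y) 0 j).
    exact: (derivable_mxP _ _ _).1 (du2 _ Ux) 0 j.
  by apply/funext => y; rewrite mxE.
Qed.

(** Exchanging the indices does not change a double sum, so only the symmetrized summands matter. *)
Lemma eq_double_sum (F G : 'I_n -> 'I_n -> R[i]) :
  (forall i k, F i k + F k i = G i k + G k i) ->
  \sum_i \sum_k F i k = \sum_i \sum_k G i k.
Proof.
move=> FG; apply: (@mulfI _ 2); first by rewrite pnatr_eq0.
rewrite !mulr_natl !mulr2n.
have dbl (H : 'I_n -> 'I_n -> R[i]) : \sum_i \sum_k H i k + \sum_i \sum_k H i k =
    \sum_i \sum_k (H i k + H k i).
  by rewrite {2}exchange_big/= -big_split/=; apply: eq_bigr => i _; rewrite big_split.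
by rewrite !dbl; apply: eq_bigr => i _; apply: eq_bigr => k _.
Qed.

(** The graph equation eliminates the covectors, leaving an identity in X, Y, beta and first
    derivatives, which skewness and d beta = 0 establish. The derivatives and the closedness of beta
    are only required at x, so the lemma also serves a form with poles elsewhere. *)
Lemma courant_graph U (beta : V -> 'M[R[i]]_n) u v x : open U -> U x ->
  (forall y, U y -> (beta y)^T = - beta y) ->
  (forall i j k, is_cderive x (delta_mx 0 i) (fun y => beta y j k)
                   (partial i (fun y => beta y j k) x)) ->
  (forall i j k, partial i (fun y => beta y j k) x
     + partial j (fun y => beta y k i) x + partial k (fun y => beta y i j) x = 0) ->
  smooth_complex_on U u -> smooth_complex_on U v ->
  (forall y, U y -> rsubmx (u y) = - (lsubmx (u y) *m beta y)) ->
  (forall y, U y -> rsubmx (v y) = - (lsubmx (v y) *m beta y)) ->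
  rsubmx (courant u v x) = - (lsubmx (courant u v x) *m beta x).
Proof.
move=> oU Ux skew dbeta closed su sv uG vG.
have nU : \near x, U x by exact: open_nbhs_nbhs.
rewrite /courant /= row_mxKr row_mxKl; apply/rowP => j.
pose X i := lsubmx (u x) 0 i; pose Y i := lsubmx (v x) 0 i.
pose pX i k := partial i (fun y => lsubmx (u y) 0 k) x.
pose pY i k := partial i (fun y => lsubmx (v y) 0 k) x.
pose b i k := beta x i k.
pose pb i j k := partial i (fun y => beta y j k) x.
have dX i k : is_cderive x (delta_mx 0 i) (fun y => lsubmx (u y) 0 k) (pX i k).
  have := smooth_complex_cderive (delta_mx 0 i) (lshift n k) su Ux.
  by rewrite /pX partialE; under [fun y => lsubmx _ _ _]eq_fun do rewrite mxE.
have dY i k : is_cderive x (delta_mx 0 i) (fun y => lsubmx (v y) 0 k) (pY i k).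
  have := smooth_complex_cderive (delta_mx 0 i) (lshift n k) sv Ux.
  by rewrite /pY partialE; under [fun y => lsubmx _ _ _]eq_fun do rewrite mxE.
(* The graph equation holds throughout U, hence near x, and may be differentiated there as a
   product. *)
have dform (w : V -> 'rV[R[i]]_(n + n)) (Z : 'I_n -> R[i]) (pZ : 'I_n -> 'I_n -> R[i]) :
    (forall k, Z k = lsubmx (w x) 0 k) ->
    (forall i k, is_cderive x (delta_mx 0 i) (fun y => lsubmx (w y) 0 k) (pZ i k)) ->
    (forall y, U y -> rsubmx (w y) = - (lsubmx (w y) *m beta y)) ->
    forall i k, is_cderive x (delta_mx 0 i) (fun y => rsubmx (w y) 0 k)
      (- \sum_l (pZ i l * b l k + Z l * pb i l k)).
  move=> ZE dZ wG i k; apply: (@is_cderive_near _ _ _ _ (fun y =>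
      - \sum_l lsubmx (w y) 0 l * beta y l k)).
    by apply: filterS nU => y /wG ->; rewrite !mxE.
  apply: is_cderiveN; apply: is_cderive_sum => l; rewrite ZE.
  by apply: is_cderiveM; [exact: dZ|exact: dbeta].
pose xi i := - \sum_l X l * b l i; pose eta i := - \sum_l Y l * b l i.
have xiE i : rsubmx (u x) 0 i = xi i by rewrite uG// !mxE.
have etaE i : rsubmx (v x) 0 i = eta i by rewrite vG// !mxE.
pose pxi i k := - \sum_l (pX i l * b l k + X l * pb i l k).
pose peta i k := - \sum_l (pY i l * b l k + Y l * pb i l k).
have dxi i k := dform u X pX (fun k => erefl) dX uG i k.
have deta i k := dform v Y pY (fun k => erefl) dY vG i k.
have pxiE i k : partial i (fun y => rsubmx (u y) 0 k) x = pxi i k.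
  by rewrite partialE (cderive_val (dxi i k)).
have petaE i k : partial i (fun y => rsubmx (v y) 0 k) x = peta i k.
  by rewrite partialE (cderive_val (deta i k)).
have pbs i k l : pb i k l = - pb i l k.
  rewrite /pb !partialE; apply: cderive_val.
  apply: (@is_cderive_near _ _ _ _ (fun y => - beta y l k)).
    by apply: filterS nU => y /skew/matrixP/(_ l k); rewrite !mxE => ->.
  by apply: is_cderiveN; exact: dbeta.
have bs i k : b i k = - b k i.
  by have /matrixP/(_ k i) := skew _ Ux; rewrite !mxE.
rewrite !mxE.
have -> : partial j (fun y => contraction (lsubmx (u y)) (rsubmx (v y))
      - contraction (lsubmx (v y)) (rsubmx (u y))) x =
    \sum_i (pX j i * eta i + X i * peta j i) - \sum_i (pY j i * xi i + Y i * pxi j i).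
  rewrite partialE; apply: cderive_val; apply: is_cderiveB; apply: is_cderive_sum => i.
    by rewrite -etaE; apply: is_cderiveM.
  by rewrite -xiE; apply: is_cderiveM.
under eq_bigr do rewrite petaE etaE.
under [X in _ - X - _]eq_bigr do rewrite pxiE xiE.
(* [F] and [G] are the summands of the two sides. They agree only after symmetrization in i and k,
   and after one of the three cyclic derivatives of beta is eliminated by closedness. *)
pose F i k := X i * - (pY i k * b k j + Y k * pb i k j) + - (Y k * b k i) * pX j i
  - (Y i * - (pX i k * b k j + X k * pb i k j) + - (X k * b k i) * pY j i)
  - 2^-1 * (pX j i * - (Y k * b k i) + X i * - (pY j k * b k i + Y k * pb j k i)
     - (pY j i * - (X k * b k i) + Y i * - (pX j k * b k i + X k * pb j k i))).
pose G i k := - ((X i * pY i k - Y i * pX i k) * b k j).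
transitivity (\sum_i \sum_k F i k).
  rewrite -!sumrB mulr_sumr -sumrB; apply: eq_bigr => i _.
  rewrite /peta /pxi /eta /xi !(mulrN, mulNr, mulr_sumr, mulr_suml, opprK, mulrDr, opprD).
  rewrite -!sumrN -!big_split/=; apply: eq_bigr => k _; rewrite /F -/(pX j i) -/(pY j i) -/(X i) -/(Y i).
  move: (X) (Y) (pX) (pY) (b) (pb) => *; ring.
transitivity (\sum_i \sum_k G i k); last first.
  rewrite exchange_big -sumrN; apply: eq_bigr => k _; rewrite !mxE mulr_suml -sumrN.
  by apply: eq_bigr => i _.
apply: eq_double_sum => i k.
have := closed i k j; rewrite -!/(pb _ _ _) => cl.
rewrite /F /G (bs i k) (pbs j k i) (pbs k i j).
have -> : pb j i k = - pb i k j - pb k j i by apply/eqP; rewrite -subr_eq0 -cl; apply/eqP; ring.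
move: (X) (Y) (pX) (pY) (b) (pb) => X' Y' pX' pY' b' pb'.
by field.
Qed.

End CourantOnGraphs.

(** * Complex matrices as real matrices *)

Section RealForms.
Variables (R : realType) (m : nat).
Implicit Types (M N : 'M[R[i]]_m).
Local Notation Re := (@complex.Re R).
Local Notation Im := (@complex.Im R).

(** The matrix of z |-> z M in real coordinates, acting on row vectors. *)
Definition realify M : 'M[R]_(m + m) :=
  block_mx (map_mx Re M) (map_mx Im M) (- map_mx Im M) (map_mx Re M).

Lemma map_Re_mul p q r (M : 'M[R[i]]_(p, q)) (N : 'M[R[i]]_(q, r)) :
  map_mx Re (M *m N) = map_mx Re M *m map_mx Re N - map_mx Im M *m map_mx Im N.
Proof.
apply/matrixP => i j; rewrite !mxE raddf_sum -sumrB; apply: eq_bigr => k _.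
by rewrite !mxE /= Re_mulc.
Qed.

Lemma map_Im_mul p q r (M : 'M[R[i]]_(p, q)) (N : 'M[R[i]]_(q, r)) :
  map_mx Im (M *m N) = map_mx Re M *m map_mx Im N + map_mx Im M *m map_mx Re N.
Proof.
apply/matrixP => i j; rewrite !mxE raddf_sum -big_split/=; apply: eq_bigr => k _.
by rewrite !mxE /= Im_mulc.
Qed.

Lemma realifyM M N : realify (M *m N) = realify M *m realify N.
Proof.
rewrite /realify mulmx_block !map_Re_mul !map_Im_mul !(mulNmx, mulmxN) opprD.
by congr block_mx; rewrite addrC.
Qed.

Lemma realify1 : realify 1%:M = 1%:M.
Proof.
have Re1 : map_mx Re (1%:M : 'M[R[i]]_m) = 1%:M.
  by apply/matrixP => i j; rewrite !mxE; case: eqP.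
have Im1 : map_mx Im (1%:M : 'M[R[i]]_m) = 0.
  by apply/matrixP => i j; rewrite !mxE; case: eqP.
by rewrite /realify Re1 Im1 oppr0 -scalar_mx_block.
Qed.

Lemma realify_stdI M : realify M *m stdI R m = stdI R m *m realify M.
Proof.
rewrite /realify /stdI !mulmx_block.
by rewrite !(mul1mx, mulmx1, mul0mx, mulmx0, addr0, add0r, mulNmx, mulmxN, opprK).
Qed.

Lemma stdI_sq : stdI R m *m stdI R m = - 1%:M.
Proof.
rewrite /stdI mulmx_block !(mul1mx, mulmx1, mul0mx, mulmx0, addr0, add0r, mulNmx, mulmxN).
by rewrite scalar_mx_block opp_block_mx oppr0.
Qed.

Lemma trmx_stdI : (stdI R m)^T = - stdI R m.
Proof.
rewrite /stdI tr_block_mx opp_block_mx !trmx0 trmx1 oppr0 opprK.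
by congr block_mx; rewrite linearN/= trmx1.
Qed.

Lemma ofCK (z : 'rV[R[i]]_m) : toC (ofC z) = z.
Proof. by apply/rowP => j; rewrite mxE /ofC row_mxKl row_mxKr !mxE; case: (z 0 j). Qed.

Lemma toCK (x : 'rV[R]_(m + m)) : ofC (toC x) = x.
Proof.
rewrite -[RHS]hsubmxK /ofC; congr row_mx; apply/rowP => j; by rewrite !mxE.
Qed.

Lemma mul_realify (x : 'rV[R]_(m + m)) M : x *m realify M = ofC (toC x *m M).
Proof.
rewrite -{1}[x]hsubmxK /realify mul_row_block /ofC map_Re_mul map_Im_mul.
have -> : map_mx Re (toC x) = lsubmx x by apply/rowP => j; rewrite !mxE.
have -> : map_mx Im (toC x) = rsubmx x by apply/rowP => j; rewrite !mxE.
by rewrite mulmxN addrC [X in row_mx _ X]addrC addrC.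
Qed.

Lemma complexifyM p q r (A : 'M[R]_(p, q)) (B : 'M[R]_(q, r)) :
  complexify (A *m B) = complexify A *m complexify B.
Proof. exact: map_mxM. Qed.

Lemma dz_realify M j :
  dz R j *m (complexify (realify M))^T = \sum_i M i j *: dz R i.
Proof.
rewrite /realify /complexify map_block_mx tr_block_mx /dz mul_row_block.
under eq_bigr do rewrite scale_row_mx.
have -> : \sum_i row_mx (M i j *: delta_mx 0 i) (M i j *: ('i%C *: delta_mx 0 i)) =
    row_mx (\sum_i M i j *: delta_mx 0 i) (\sum_i M i j *: ('i%C *: delta_mx 0 i)) :> 'rV[R[i]]_(m + m).
  by elim/big_rec3: _ => [|i y1 y2 y3 _ ->]; rewrite ?row_mx0 ?add_row_mx.
have sumE (c : R[i]) k : (\sum_i (M i j *: (c *: delta_mx 0 i : 'rV[R[i]]_m))) 0 k = c * M k j.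
  rewrite summxE (bigD1 k)//= big1 ?addr0 => [|i ik]; rewrite !mxE eqxx ?eqxx/= ?mulr1 1?mulrC//.
  by rewrite eq_sym (negbTE ik) mulr0 mul0r.
have dE (A : 'M[R]_m) k : (delta_mx 0 j *m (map_mx (real_complex R) A)^T : 'rV[R[i]]_m) 0 k = (A k j)%:C.
  by rewrite -rowE !mxE.
have decomp (z : R[i]) : z = (Re z)%:C + 'i%C * (Im z)%:C by case: z => a b; simpc.
congr row_mx; apply/rowP => k.
  have := sumE 1 k; under eq_bigr do rewrite scale1r.
  move=> ->; rewrite mul1r mxE -scalemxAl dE mx_scaleE dE [in RHS](decomp (M k j)) !mxE.
  by [].
rewrite sumE mxE -scalemxAl mx_scaleE !dE !mxE [in RHS](decomp (M k j)) mulrDr mulrA.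
have -> : 'i%C * 'i%C = -1 :> R[i] by simpc.
by rewrite rmorphN/= mulN1r addrC.
Qed.

Lemma wedge_push n (a b : 'rV[R[i]]_n) (D : 'M[R[i]]_n) :
  wedge (a *m D^T) (b *m D^T) = D *m wedge a b *m D^T.
Proof. by rewrite /wedge !trmx_mul trmxK mulmxBr mulmxBl !mulmxA. Qed.

End RealForms.

(** * Differentiability of complex-valued functions *)

Section ComplexDifferentiability.
Variables (R : realType) (V : normedModType R).
Implicit Types (f g : V -> R[i]) (x v : V).
Local Notation Re := (@complex.Re R).
Local Notation Im := (@complex.Im R).

Definition cdifferentiable f x :=
  differentiable (fun y => Re (f y)) x /\ differentiable (fun y => Im (f y)) x.

Lemma cdifferentiable_cst c x : cdifferentiable (fun _ => c) x.
Proof. by split; exact: differentiable_cst. Qed.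

Lemma cdifferentiableD f g x : cdifferentiable f x -> cdifferentiable g x ->
  cdifferentiable (fun y => f y + g y) x.
Proof.
move=> [f1 f2] [g1 g2]; split.
  by under eq_fun do rewrite raddfD/=; exact: differentiableD.
by under eq_fun do rewrite raddfD/=; exact: differentiableD.
Qed.

Lemma cdifferentiableN f x : cdifferentiable f x -> cdifferentiable (fun y => - f y) x.
Proof.
move=> [f1 f2]; split.
  by under eq_fun do rewrite raddfN/=; exact: differentiableN.
by under eq_fun do rewrite raddfN/=; exact: differentiableN.
Qed.

Lemma cdifferentiableM f g x : cdifferentiable f x -> cdifferentiable g x ->
  cdifferentiable (fun y => f y * g y) x.
Proof.
move=> [f1 f2] [g1 g2]; split.
  by under eq_fun do rewrite Re_mulc; apply: differentiableB; exact: differentiableM.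
by under eq_fun do rewrite Im_mulc; apply: differentiableD; exact: differentiableM.
Qed.

Lemma cdifferentiableV f x : f x != 0 -> cdifferentiable f x ->
  cdifferentiable (fun y => (f y)^-1) x.
Proof.
move=> fx0 [f1 f2].
have n0 : Re (f x) ^+ 2 + Im (f x) ^+ 2 != 0.
  move: fx0; apply: contra_neq => /eqP; rewrite paddr_eq0 ?sqr_ge0// !sqrf_eq0.
  by case: (f x) => a b /= /andP[/eqP -> /eqP ->].
have dn : differentiable (fun y => (Re (f y) ^+ 2 + Im (f y) ^+ 2)^-1) x.
  have sq (g : V -> R) : differentiable g x -> differentiable (fun y => g y ^+ 2) x.
    move=> dg; rewrite (_ : (fun y => _) = fun y => g y * g y); first exact: differentiableM.
    by apply/funext => y; rewrite expr2.
  by apply: differentiableV => //; apply: differentiableD; exact: sq.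
split.
  rewrite (_ : (fun _ => _) = fun y => Re (f y) * (Re (f y) ^+ 2 + Im (f y) ^+ 2)^-1).
    exact: differentiableM.
  by apply/funext => y; case: (f y).
rewrite (_ : (fun _ => _) = fun y => - (Im (f y) * (Re (f y) ^+ 2 + Im (f y) ^+ 2)^-1)).
  by apply: differentiableN; exact: differentiableM.
by apply/funext => y; case: (f y).
Qed.

End ComplexDifferentiability.

(** * Transition maps of CP^m and their Jacobians *)

Section Transitions.
Variables (R : realType) (m : nat).
Implicit Types (k l : 'I_m.+1) (x v : 'rV[R]_(m + m)).
Local Notation Re := (@complex.Re R).
Local Notation Im := (@complex.Im R).
Local Notation Z k x l := (homog k (toC x) 0 l).

Lemma homogE k (z : 'rV[R[i]]_m) l :
  homog k z 0 l = if unlift k l is Some j then z 0 j else 1.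
Proof. by rewrite mxE. Qed.

Lemma homog_diag k (z : 'rV[R[i]]_m) : homog k z 0 k = 1.
Proof. by rewrite homogE unlift_none. Qed.

Lemma homog_lift k (z : 'rV[R[i]]_m) j : homog k z 0 (lift k j) = z 0 j.
Proof. by rewrite homogE liftK. Qed.

Lemma differentiable_rV (W : normedModType R) n (f : W -> 'rV[R]_n) (x : W) :
  (forall j, differentiable (fun y => f y 0 j) x) -> differentiable f x.
Proof.
move=> df; rewrite (_ : f = \sum_j (fun y => f y 0 j *: delta_mx 0 j)).
  by apply: differentiable_sum => j; exact: differentiableZl.
by apply/funext => y; rewrite {1}(row_sum_delta (f y)) fct_sumE.
Qed.

Lemma toC_re j x : Re (toC x 0 j) = x 0 (lshift m j).
Proof. by rewrite !mxE. Qed.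

Lemma toC_im j x : Im (toC x 0 j) = x 0 (rshift m j).
Proof. by rewrite !mxE. Qed.

Lemma is_derive_coord n (x v : 'rV[R]_n) j :
  is_derive x v (fun y : 'rV[R]_n => y 0 j) (v 0 j).
Proof.
have dc : differentiable (fun y : 'rV[R]_n => y 0 j) x by exact: differentiable_coord.
apply: DeriveDef; first exact: diff_derivable.
have := derive_mx (@derivable_id R 'rV[R]_n x v); rewrite derive_id => /matrixP/(_ 0 j).
by rewrite mxE.
Qed.

Lemma is_cderive_toC j x v : is_cderive x v (fun y => toC y 0 j) (toC v 0 j).
Proof.
split; [under eq_fun do rewrite toC_re|under eq_fun do rewrite toC_im].
  by rewrite toC_re; exact: is_derive_coord.
by rewrite toC_im; exact: is_derive_coord.
Qed.

Lemma cdifferentiable_toC j x : cdifferentiable (fun y => toC y 0 j) x.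
Proof.
split; [under eq_fun do rewrite toC_re|under eq_fun do rewrite toC_im];
  exact: differentiable_coord.
Qed.

Lemma cdifferentiable_homog k l x : cdifferentiable (fun y => Z k y l) x.
Proof.
under eq_fun do rewrite homogE.
by case: (unlift k l) => [j|]; [exact: cdifferentiable_toC|exact: cdifferentiable_cst].
Qed.

Lemma is_cderive_homog k l x v :
  is_cderive x v (fun y => Z k y l) (\sum_i toC v 0 i * (lift k i == l)%:R).
Proof.
under eq_fun do rewrite homogE.
case: unliftP => [j ->|->].
  rewrite (bigD1 j)//= eqxx mulr1 big1 ?addr0; first exact: is_cderive_toC.
  by move=> i ij; rewrite (inj_eq (@lift_inj _ _)) (negbTE ij) mulr0.
rewrite big1; first exact: is_cderive_cst.
by move=> i _; rewrite eq_sym (negbTE (neq_lift _ _)) mulr0.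
Qed.

(** The holomorphic Jacobian, by the quotient rule; the Kronecker symbols are the derivatives of the
    homogeneous coordinates. *)
Definition transition_mx k l x : 'M[R[i]]_m :=
  \matrix_(i, j) ((lift k i == lift l j)%:R / Z k x l
    - (lift k i == l)%:R * Z k x (lift l j) / Z k x l ^+ 2).

Lemma toC_transition k l x j :
  toC (transition k l x) 0 j = Z k x (lift l j) / Z k x l.
Proof. by rewrite ofCK mxE. Qed.

Lemma cdifferentiable_transition k l x j : overlap k l x ->
  cdifferentiable (fun y => toC (transition k l y) 0 j) x.
Proof.
move=> kl; under eq_fun do rewrite toC_transition.
apply: cdifferentiableM; first exact: cdifferentiable_homog.
by apply: cdifferentiableV => //; exact: cdifferentiable_homog.
Qed.

(** [jacobian] is built from the differential, so derivatives along vectors alone would not do. *)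
Lemma differentiable_transition k l x : overlap k l x ->
  differentiable (transition k l) x.
Proof.
move=> kl; apply: differentiable_rV => j; rewrite -(splitK j).
case: (fintype.split j) => j' /=; have [h1 h2] := cdifferentiable_transition j' kl.
  by under eq_fun do rewrite -toC_re.
by under eq_fun do rewrite -toC_im.
Qed.

Lemma is_cderive_transition k l x v j : overlap k l x ->
  is_cderive x v (fun y => toC (transition k l y) 0 j)
    ((toC v *m transition_mx k l x) 0 j).
Proof.
move=> kl; under eq_fun do rewrite toC_transition.
apply: is_cderive_eq.
  apply: is_cderiveM; first exact: is_cderive_homog.
  by apply: is_cderiveV => //; exact: is_cderive_homog.
rewrite mxE !mulr_suml mulrN mulr_sumr -sumrB; apply: eq_bigr => i _.
by rewrite !mxE; ring.
Qed.

Lemma diff_transition k l x v : overlap k l x ->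
  'd (transition k l) x v = v *m realify (transition_mx k l x).
Proof.
move=> kl; have dT := differentiable_transition kl.
rewrite -deriveE// derive_mx; last exact: diff_derivable.
rewrite mul_realify; apply/rowP => j; rewrite mxE -(splitK j).
case: (fintype.split j) => j' /=; have [h1 h2] := is_cderive_transition v j' kl.
  under eq_fun do rewrite -toC_re.
  by rewrite (derive_val (is_derive := h1)) -toC_re ofCK.
under eq_fun do rewrite -toC_im.
by rewrite (derive_val (is_derive := h2)) -toC_im ofCK.
Qed.

Lemma jacobian_transition k l x : overlap k l x ->
  jacobian (transition k l) x = realify (transition_mx k l x).
Proof.
move=> kl; apply/row_matrixP => i; rewrite !rowE /jacobian mul_rV_lin1.
exact: diff_transition.
Qed.

Lemma homog_transition k l x p : overlap k l x ->
  Z l (transition k l x) p = Z k x p / Z k x l.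
Proof.
move=> kl; have [j ->|->] := unliftP l p; first by rewrite homog_lift toC_transition.
by rewrite homog_diag divff.
Qed.

Lemma transition_comp k l p x : overlap k l x -> overlap k p x ->
  transition l p (transition k l x) = transition k p x.
Proof.
move=> kl kp; apply: (can_inj (@toCK R m)); apply/rowP => j.
by rewrite !toC_transition !homog_transition// invfM invrK mulrACA mulVf// mulr1.
Qed.

Lemma overlap_transition k l p x : overlap k l x -> overlap k p x ->
  overlap l p (transition k l x).
Proof. by move=> kl kp; rewrite /overlap homog_transition// mulf_neq0// invr_neq0. Qed.

Lemma open_overlap k l : open (overlap k l : set 'rV[R]_(m + m)).
Proof.
pose N x := Re (Z k x l) * Re (Z k x l) + Im (Z k x l) * Im (Z k x l).
have cN : continuous N.
  move=> x; have [h1 h2] := cdifferentiable_homog k l x.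
  exact: (differentiable_continuous (differentiableD (differentiableM h1 h1) (differentiableM h2 h2))).
rewrite (_ : overlap k l = N @^-1` [set r | r != 0]).
  by apply: open_comp => [x _|]; [exact: cN|exact: open_neq].
apply/seteqP; split=> x; rewrite /overlap /N /=; case: (Z k x l) => a b; apply: contra_neq.
  by rewrite /= => /eqP; rewrite -!expr2 paddr_eq0 ?sqr_ge0// !sqrf_eq0 => /andP[/eqP -> /eqP ->].
by move=> [-> ->] /=; rewrite mul0r addr0.
Qed.

Lemma jacobian_comp k l p x : overlap k l x -> overlap k p x ->
  jacobian (transition k p) x =
  jacobian (transition k l) x *m jacobian (transition l p) (transition k l x).
Proof.
move=> kl kp; have lp := overlap_transition kl kp.
apply/row_matrixP => i; rewrite !rowE mulmxA !jacobian_transition// -!diff_transition//.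
have dkl := differentiable_transition kl; have dlp := differentiable_transition lp.
have E := congr1 (fun F : 'rV[R]_(m + m) -> 'rV[R]_(m + m) => F (delta_mx 0 i)) (diff_comp dkl dlp).
apply: (etrans _ E).
apply: (etrans (esym (deriveE _ (differentiable_transition kp)))).
apply: (etrans _ (deriveE _ (differentiable_comp dkl dlp))).
apply: near_eq_derive; near=> y; rewrite /= transition_comp//.
  by near: y; apply: open_nbhs_nbhs; split => //; exact: open_overlap.
by near: y; apply: open_nbhs_nbhs; split => //; exact: open_overlap.
Unshelve. all: by end_near. Qed.

End Transitions.

(** * Smooth matrix-valued functions *)

Section SmoothMatrices.
Variables (R : realType) (V : normedModType R).

Lemma smooth_mxP p q (A : V -> 'M[R]_(p, q)) :
  smooth_on setT A <-> forall i j, smooth_on setT (fun x => A x i j).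
Proof.
split=> [sA i j|sA].
  pose L : 'M[R]_(p, q) -> R := fun M => M i j.
  have lL : linear L by move=> a M N; rewrite /L !mxE.
  pose LL := GRing.isLinear.Build _ _ _ _ L lL.
  pose L' : {linear 'M[R]_(p, q) -> R} := HB.pack L LL.
  apply: (@smooth_onT_linear_comp _ _ _ _ L') => //.
  exact: coord_continuous.
rewrite (_ : A = fun x => \sum_i \sum_j A x i j *: delta_mx i j); last first.
  by apply/funext => x; exact: matrix_sum_delta.
apply: smooth_onT_sum => i _; apply: smooth_onT_sum => j _.
pose L : R -> 'M[R]_(p, q) := fun a => a *: delta_mx i j.
have lL : linear L by move=> a M N; rewrite /L scalerDl scalerA.
pose LL := GRing.isLinear.Build _ _ _ _ L lL.
pose L' : {linear R -> 'M[R]_(p, q)} := HB.pack L LL.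
apply: (@smooth_onT_linear_comp _ _ _ _ L') => //.
exact: scalel_continuous.
Qed.

Lemma smooth_mx_mul p q r (A : V -> 'M[R]_(p, q)) (B : V -> 'M[R]_(q, r)) :
  smooth_on setT A -> smooth_on setT B -> smooth_on setT (fun x => A x *m B x).
Proof.
move=> /smooth_mxP sA /smooth_mxP sB; apply/smooth_mxP => i j.
under eq_fun do rewrite mxE.
by apply: smooth_onT_sum => k _; exact: smooth_onTM.
Qed.

Lemma smooth_mxN p q (A : V -> 'M[R]_(p, q)) :
  smooth_on setT A -> smooth_on setT (fun x => - A x).
Proof.
move=> /smooth_mxP sA; apply/smooth_mxP => i j; under eq_fun do rewrite mxE.
exact: smooth_onTN.
Qed.

Lemma smooth_block_mx p1 p2 q1 q2 (A : V -> 'M[R]_(p1, q1)) (B : V -> 'M[R]_(p1, q2))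
    (C : V -> 'M[R]_(p2, q1)) (D : V -> 'M[R]_(p2, q2)) :
  smooth_on setT A -> smooth_on setT B -> smooth_on setT C -> smooth_on setT D ->
  smooth_on setT (fun x => block_mx (A x) (B x) (C x) (D x)).
Proof.
move=> /smooth_mxP sA /smooth_mxP sB /smooth_mxP sC /smooth_mxP sD.
apply/smooth_mxP => i j; rewrite -(splitK i) -(splitK j).
case: (fintype.split i) => i'; case: (fintype.split j) => j' /=.
- under eq_fun do rewrite block_mxEul; exact: sA.
- under eq_fun do rewrite block_mxEur; exact: sB.
- under eq_fun do rewrite block_mxEdl; exact: sC.
- under eq_fun do rewrite block_mxEdr; exact: sD.
Qed.

Lemma smooth_det n (A : V -> 'M[R]_n) :
  smooth_on setT A -> smooth_on setT (fun x => \det (A x)).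
Proof.
move=> /smooth_mxP sA; apply: smooth_onT_sum => s _.
apply: smooth_onTM; first exact: smooth_onT_cst.
exact: smooth_onT_prod.
Qed.

(** By Cramer's rule the inverse is rational in the entries. *)
Lemma smooth_invmx n (A : V -> 'M[R]_n) : (forall x, A x \in unitmx) ->
  smooth_on setT A -> smooth_on setT (fun x => invmx (A x)).
Proof.
move=> uA sA; apply/smooth_mxP => i j.
rewrite (_ : (fun x => _) = fun x => (\det (A x))^-1 * cofactor (A x) j i); last first.
  by apply/funext => x; rewrite /invmx uA !mxE.
apply: smooth_onTM.
  apply: smooth_onTV; last exact: smooth_det.
  by move=> x; have := uA x; rewrite unitmxE unitfE.
apply: smooth_onTM; first exact: smooth_onT_cst.
apply: smooth_det; apply/smooth_mxP => i' j'.
under eq_fun do rewrite !mxE.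
by move/smooth_mxP: sA; exact.
Qed.

Lemma smooth_coord n (j : 'I_n) : smooth_on setT (fun x : 'rV[R]_n => x 0 j).
Proof.
move=> [|k]; first by split=> // x _; exact: coord_continuous.
apply/Ck_onS; split=> [x|v]; first exact: coord_continuous.
split=> [x|]; first by have := is_derive_coord x v j.
rewrite (_ : 'D_v _ = cst (v 0 j)); first exact: Ck_on_cst.
by apply/funext => x; have /@derive_val -> := is_derive_coord x v j.
Qed.

Lemma smooth_Jsym n (B F : V -> 'M[R]_n) : (forall x, F x \in unitmx) ->
  smooth_on setT B -> smooth_on setT F -> smooth_on setT (fun x => Jsym (B x) (F x)).
Proof.
move=> uF sB sF; rewrite /Jsym /Bshift.
apply: smooth_mx_mul; first apply: smooth_mx_mul; apply: smooth_block_mx;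
  do ?[exact: smooth_onT_cst|exact: smooth_mxN|exact: smooth_invmx]; exact: sB.
Qed.

Definition csmooth (f : V -> R[i]) : Prop :=
  smooth_on setT (fun x => complex.Re (f x)) /\ smooth_on setT (fun x => complex.Im (f x)).

Lemma csmooth_cst c : csmooth (fun _ => c).
Proof. by split; exact: smooth_onT_cst. Qed.

Lemma csmooth_real (f : V -> R) : smooth_on setT f -> csmooth (fun x => (f x)%:C).
Proof. by split => //=; exact: smooth_onT_cst. Qed.

Lemma csmoothD f g : csmooth f -> csmooth g -> csmooth (fun x => f x + g x).
Proof.
move=> [f1 f2] [g1 g2]; split; under eq_fun do rewrite raddfD/=; exact: smooth_onTD.
Qed.

Lemma csmoothM f g : csmooth f -> csmooth g -> csmooth (fun x => f x * g x).
Proof.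
move=> [f1 f2] [g1 g2]; split.
  by under eq_fun do rewrite Re_mulc; apply: smooth_onTB; exact: smooth_onTM.
by under eq_fun do rewrite Im_mulc; apply: smooth_onTD; exact: smooth_onTM.
Qed.

Lemma csmoothN f : csmooth f -> csmooth (fun x => - f x).
Proof. by move=> [f1 f2]; split; under eq_fun do rewrite raddfN/=; exact: smooth_onTN. Qed.

Lemma csmoothX f n : csmooth f -> csmooth (fun x => f x ^+ n).
Proof.
move=> sf; elim: n => [|n IH].
  by under eq_fun do rewrite expr0; exact: csmooth_cst.
by under eq_fun do rewrite exprS; exact: csmoothM.
Qed.

Lemma csmooth_conj f : csmooth f -> csmooth (fun x => conjc (f x)).
Proof.
move=> [f1 f2]; split.
  by rewrite (_ : (fun x => _) = fun x => complex.Re (f x))//; apply/funext => x; case: (f x).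
rewrite (_ : (fun x => _) = fun x => - complex.Im (f x)); first exact: smooth_onTN.
by apply/funext => x; case: (f x).
Qed.

End SmoothMatrices.

Lemma csmooth_toC (R : realType) m (j : 'I_m) :
  csmooth (fun x : 'rV[R]_(m + m) => toC x 0 j).
Proof.
split.
  rewrite (_ : (fun x => _) = fun x : 'rV[R]_(m + m) => x 0 (lshift m j)).
    exact: smooth_coord.
  by apply/funext => x; rewrite toC_re.
rewrite (_ : (fun x => _) = fun x : 'rV[R]_(m + m) => x 0 (rshift m j)).
  exact: smooth_coord.
by apply/funext => x; rewrite toC_im.
Qed.

Lemma csmooth_homog (R : realType) m k l :
  csmooth (fun x : 'rV[R]_(m + m) => homog k (toC x) 0 l).
Proof.
under eq_fun do rewrite homogE.
by case: (unlift k l) => [j|]; [exact: csmooth_toC|exact: csmooth_cst].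
Qed.

(** * The +i eigenbundle of the symplectic structure *)

Section PlusEigenbundles.
Variables (R : realType) (n : nat).
Implicit Types (B F S J : 'M[R]_n) (A : 'rV[R[i]]_(n + n)).

Lemma complexify_block p1 p2 q1 q2 (a : 'M[R]_(p1, q1)) (b : 'M[R]_(p1, q2))
    (c : 'M[R]_(p2, q1)) (d : 'M[R]_(p2, q2)) :
  complexify (block_mx a b c d) =
  block_mx (complexify a) (complexify b) (complexify c) (complexify d).
Proof. exact: map_block_mx. Qed.

Lemma complexifyN p q (a : 'M[R]_(p, q)) : complexify (- a) = - complexify a.
Proof. exact: map_mxN. Qed.

Lemma complexify0 p q : complexify (0 : 'M[R]_(p, q)) = 0.
Proof. by rewrite /complexify map_mx0. Qed.

Lemma complexify1 : complexify (1%:M : 'M[R]_n) = 1%:M.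
Proof. by rewrite /complexify map_mx1. Qed.

Lemma sqr_im : 'i%C * 'i%C = -1 :> R[i].
Proof. by simpc. Qed.

Lemma Jsym_plus_i B F A : F \in unitmx ->
  in_plus_i (Jsym B F) A <->
  rsubmx A = - (lsubmx A *m (complexify B - 'i%C *: complexify F)).
Proof.
move=> uF; rewrite /in_plus_i /Jsym !complexifyM.
pose cB := complexify B; pose cF := complexify F; pose cG := complexify (invmx F).
have FG : cF *m cG = 1%:M by rewrite -complexifyM mulmxV// complexify1.
have GF : cG *m cF = 1%:M by rewrite -complexifyM mulVmx// complexify1.
have TE (C : 'M[R]_n) (X xi : 'rV[R[i]]_n) :
    row_mx X xi *m complexify (Bshift C) = row_mx X (X *m complexify C + xi).
  rewrite /Bshift complexify_block complexify1 complexify0 mul_row_block.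
  by rewrite !mulmx1 mulmx0 addr0.
rewrite (complexify_block 0 (- F)) !complexify0 complexifyN -/cF -/cG.
have JE (X xi : 'rV[R[i]]_n) : row_mx X xi *m block_mx 0 (- cF) cG 0 =
    row_mx (xi *m cG) (- (X *m cF)).
  by rewrite mul_row_block !mulmx0 add0r addr0 mulmxN.
rewrite -{1 2}[A]hsubmxK; set X := lsubmx A; set xi := rsubmx A.
rewrite !mulmxA TE JE TE complexifyN mulmxN -/cB scale_row_mx.
split=> [/eq_row_mx[h1 h2]|->].
  have e1 : X *m cB + xi = 'i%C *: (X *m cF).
    by rewrite -[LHS]mulmx1 -GF mulmxA h1 scalemxAl.
  by rewrite mulmxBr -scalemxAr -e1 opprB addrC addKr.
rewrite mulmxBr -scalemxAr -/cB opprB.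
have -> : X *m cB + ('i%C *: (X *m cF) - X *m cB) = 'i%C *: (X *m cF).
  by rewrite addrC subrK.
rewrite -scalemxAl -(mulmxA X) FG mulmx1; congr row_mx.
rewrite scalerBr scalerA sqr_im scaleN1r addrC; congr (_ + _).
by rewrite -scalemxAl.
Qed.

End PlusEigenbundles.

(** * Holomorphic bivectors in complex dimension 2 *)

Section Bivector.
Variable R : realType.
Implicit Types (p : R[i]) (M : 'M[R[i]]_2).
Local Notation Re := (@complex.Re R).
Local Notation Im := (@complex.Im R).

Definition skew2 : 'M[R]_2 := \matrix_(i, j) ((j : nat)%:R - (i : nat)%:R).

(* Up to sign, the imaginary part of the holomorphic bivector p d/dz1 /\ d/dz2. *)
Definition bivector p : 'M[R]_(2 + 2) :=
  block_mx (- Im p *: skew2) (Re p *: skew2) (Re p *: skew2) (Im p *: skew2).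

Lemma ord2P (P : 'I_2 -> Prop) : P 0 -> P 1 -> forall i, P i.
Proof.
move=> P0 P1 i; case: (unliftP ord0 i) => [j ->|->]; last exact: P0.
by rewrite (_ : lift _ _ = 1)//; apply/val_inj; rewrite /= ord1.
Qed.

Lemma sum2 (W : nmodType) (F : 'I_2 -> W) : \sum_i F i = F 0 + F 1.
Proof.
rewrite !big_ord_recl big_ord0 addr0; congr (_ + F _).
exact/val_inj.
Qed.

Lemma skew2_sq : skew2 *m skew2 = - 1%:M.
Proof.
(* The value of the literal 1 in 'I_2 is displayed as 1 %% 2. *)
have m12 : (1 %% 2 = 1)%N by [].
apply/matrixP; apply: ord2P; apply: ord2P; rewrite !mxE sum2 !mxE /= ?m12; ring.
Qed.

Lemma trmx_skew2 : skew2^T = - skew2.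
Proof. by apply/matrixP => i j; rewrite !mxE opprB. Qed.

Definition mixdet2 (A B : 'M[R]_2) : R :=
  A 0 0 * B 1 1 - A 0 1 * B 1 0.

(** The polarization of A^T E A = det A E, where E is [skew2]. *)
Lemma skew2_bilinear (A B : 'M[R]_2) :
  A^T *m skew2 *m B + B^T *m skew2 *m A = (mixdet2 A B + mixdet2 B A) *: skew2.
Proof.
apply/matrixP; apply: ord2P; apply: ord2P; rewrite /mixdet2 !mxE !sum2 !mxE !sum2 !mxE /=; ring.
Qed.

Lemma skew2_quadratic (A : 'M[R]_2) : A^T *m skew2 *m A = mixdet2 A A *: skew2.
Proof.
apply/matrixP; apply: ord2P; apply: ord2P; rewrite /mixdet2 !mxE !sum2 !mxE !sum2 !mxE /=; ring.
Qed.

Lemma trmx_bivector p : (bivector p)^T = - bivector p.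
Proof.
rewrite /bivector tr_block_mx opp_block_mx; congr block_mx;
  by rewrite linearZ/= trmx_skew2 scalerN.
Qed.

Lemma bivector_stdI p : bivector p *m stdI R 2 = - (stdI R 2 *m bivector p).
Proof.
rewrite /bivector /stdI !mulmx_block opp_block_mx.
rewrite !(mul1mx, mulmx1, mul0mx, mulmx0, addr0, add0r, mulNmx, mulmxN, opprK).
by rewrite !scaleNr.
Qed.

Lemma det2 M : \det M = M 0 0 * M 1 1 - M 0 1 * M 1 0.
Proof.
have l0 : lift 0 0 = 1 :> 'I_2 by exact/val_inj.
have l1 : lift 1 0 = 0 :> 'I_2 by exact/val_inj.
rewrite (expand_det_row _ 0) sum2 /cofactor !det_mx11 !mxE l0 l1 /=.
by rewrite addn0 add0n expr0 expr1; ring.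
Qed.

(** Holomorphic bivectors on C^2 form a complex line, on which M acts by its determinant. *)
Lemma bivector_push p M :
  (realify M)^T *m bivector p *m realify M = bivector (p * \det M).
Proof.
set P := map_mx Re M; set Q := map_mx Im M.
have ReE : Re (\det M) = mixdet2 P P - mixdet2 Q Q.
  by rewrite det2 raddfB/= !Re_mulc /mixdet2 !mxE; ring.
have ImE : Im (\det M) = mixdet2 P Q + mixdet2 Q P.
  by rewrite det2 raddfB/= !Im_mulc /mixdet2 !mxE; ring.
have mix := skew2_bilinear P Q; have PP := skew2_quadratic P.
have QQ := skew2_quadratic Q.
rewrite /bivector Re_mulc Im_mulc ReE ImE /realify -/P -/Q tr_block_mx !mulmx_block.
have QT : (- Q)^T = - Q^T by rewrite linearN.
rewrite QT !(mulmxDl, mulmxDr, mulNmx, mulmxN) -!scalemxAr -!scalemxAl.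
move: PP QQ mix; move: (P^T *m _ *m P) (Q^T *m _ *m Q) (P^T *m _ *m Q) (Q^T *m _ *m P).
move: (mixdet2 P P) (mixdet2 Q Q) (mixdet2 P Q) (mixdet2 Q P) => a b c d K1 K2 K3 K4.
move=> -> -> K34.
have -> : K3 = (c + d) *: skew2 - K4 by rewrite -K34 addrK.
by congr block_mx; mx_ring.
Qed.

Lemma bivector_sq p : bivector p *m bivector p = - (Re p ^+ 2 + Im p ^+ 2)%:M.
Proof.
rewrite /bivector mulmx_block -!scalemxAl -!scalemxAr skew2_sq.
rewrite scalar_mx_block opp_block_mx -[(_ + _)%:M]scalemx1; congr block_mx; mx_ring.
Qed.

Lemma bivector_unit p : p != 0 -> bivector p \in unitmx.
Proof.
move=> p0.
have n0 : Re p ^+ 2 + Im p ^+ 2 != 0.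
  move: p0; apply: contra_neq => /eqP; rewrite paddr_eq0 ?sqr_ge0// !sqrf_eq0.
  by case: p => a b /= /andP[/eqP -> /eqP ->].
have : bivector p *m (- (Re p ^+ 2 + Im p ^+ 2)^-1 *: bivector p) = 1%:M.
  rewrite -scalemxAr bivector_sq scalerN scaleNr opprK -scalemx1 scalerA mulVf//.
  by rewrite scale1r.
by case/mulmx1_unit.
Qed.

Lemma beta1E : beta1 R = block_mx (complexify skew2) ('i%C *: complexify skew2)
  ('i%C *: complexify skew2) (- complexify skew2).
Proof.
have E : (delta_mx 0 0 : 'rV[R[i]]_2)^T *m delta_mx 0 1 -
    (delta_mx 0 1 : 'rV[R[i]]_2)^T *m delta_mx 0 0 = complexify skew2.
  have m12 : (1 %% 2 = 1)%N by [].
  apply/matrixP; apply: ord2P; apply: ord2P;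
    rewrite !trmx_delta !mul_delta_mx !mxE /= ?m12 ?mulr1n;
    by apply/eqP; rewrite eq_complex /= ?subrr !eqxx.
rewrite /beta1 /wedge /dz !tr_row_mx !mul_col_row opp_block_mx add_block_mx.
have tZ (a : 'rV[R[i]]_2) : ('i%C *: a)^T = 'i%C *: a^T by rewrite linearZ.
rewrite !tZ -!scalemxAl -!scalemxAr -!scalerBr E scalerA sqr_im.
by rewrite scaleN1r.
Qed.

Lemma complexifyZ m n (c : R) (A : 'M[R]_(m, n)) :
  complexify (c *: A) = c%:C *: complexify A.
Proof. exact: map_mxZ. Qed.

Lemma complexE (z : R[i]) : z = (Re z)%:C + 'i%C * (Im z)%:C.
Proof. by case: z => a b; simpc. Qed.

(** As [bivector] is only the imaginary part of a holomorphic bivector, its product with beta_1 is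
    not scalar: i + I is 2i times the projection onto an eigenspace of I. *)
Lemma beta1_bivector p :
  beta1 R *m complexify (bivector p) = - p *: ('i%C%:M + complexify (stdI R 2)).
Proof.
case: p => a b; rewrite (complexE (a +i* b)).
rewrite beta1E /bivector /stdI -complexE /= !complexify_block !complexifyZ complexify0.
rewrite complexifyN complexify1 mulmx_block scalar_mx_block add_block_mx scale_block_mx.
rewrite (complexE (a +i* b)) -[('i%C)%:M]scalemx1.
have EE : complexify skew2 *m complexify skew2 = - 1%:M.
  by rewrite -complexifyM skew2_sq complexifyN complexify1.
rewrite !mulNmx -!scalemxAl -!scalemxAr EE rmorphN/=.
congr block_mx; apply/matrixP => ? ?; rewrite !(mx_addE, mx_oppE, mx_scaleE, mx_zeroE).
all: rewrite /=; ring: (@sqr_im R).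
Qed.

Lemma beta1_stdI : beta1 R *m complexify (stdI R 2) = - 'i%C *: beta1 R.
Proof.
rewrite beta1E /stdI complexify_block complexify0 complexifyN complexify1.
rewrite mulmx_block scale_block_mx !mulmx0 !mulmxN !mulmx1 addr0 !add0r.
congr block_mx; apply/matrixP => ? ?; rewrite !(mx_addE, mx_oppE, mx_scaleE, mx_zeroE).
all: ring: (@sqr_im R).
Qed.

Lemma trmx_beta1 : (beta1 R)^T = - beta1 R.
Proof.
rewrite /beta1; move: (dz R 0) (dz R 1) => a b.
by rewrite /wedge linearB/= !trmx_mul !trmxK opprB.
Qed.

(** For p nonzero the bivector is invertible as a real matrix, so the vector half of the eigenvalue
    equation determines the covector; the covector half then follows from [beta1_stdI]. *)
Lemma Jhol_plus_i p A : p != 0 ->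
  in_plus_i (Jhol (stdI R 2) (bivector p)) A <->
  rsubmx A = - (lsubmx A *m (p^-1 *: beta1 R)).
Proof.
move=> p0; rewrite /in_plus_i /Jhol complexify_block complexify0 complexifyN.
rewrite -{1 2}[A]hsubmxK; set X := lsubmx A; set xi := rsubmx A.
rewrite mul_row_block mulmx0 add0r scale_row_mx !mulmxN.
set cI := complexify (stdI R 2); set cS := complexify (bivector p).
have bS : (p^-1 *: beta1 R) *m cS = - ('i%C%:M + cI).
  by rewrite -scalemxAl beta1_bivector scaleNr scalerN scalerA mulVf// scale1r.
have uS : cS \in unitmx by rewrite map_unitmx bivector_unit.
split=> [/eq_row_mx[h1 h2]|->].
  apply/eqP; rewrite -subr_eq0 opprK; apply/eqP.
  apply: (can_inj (mulmxK uS)); rewrite mul0mx mulmxDl -mulmxA bS mulmxN mulmxDr.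
  by rewrite mul_mx_scalar -h1 addrAC addNr add0r subrr.
congr row_mx.
  by rewrite mulNmx -mulmxA bS mulmxN opprK mulmxDr addrC addrK mul_mx_scalar.
by rewrite mulNmx opprK -mulmxA -scalemxAl beta1_stdI scalerA mulrC -scalerA -!scalemxAr scaleNr scalerN.
Qed.

End Bivector.

(** * Closed conditions pass to a point along a punctured line through it *)

Section Density.
Variables (R : realType) (V : normedModType R).
Implicit Types (phi : V -> R) (x v : V).

Lemma cvg_line (W : topologicalType) (phi : V -> W) x v : {for x, continuous phi} ->
  phi (x + t *: v) @[t --> (0 : R)^'] --> phi x.
Proof.
move=> cphi; apply: continuous_cvg => //.
apply: cvg_within_filter.
have : x + t *: v @[t --> (0 : R)] --> x + 0 *: v.
  by apply: cvgD; [exact: cvg_cst|apply: cvgZ; [exact: cvg_id|exact: cvg_cst]].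
by rewrite scale0r addr0.
Qed.

Lemma near_line (U : set V) x v : open U -> U x ->
  \forall t \near (0 : R)^', U (x + t *: v).
Proof.
move=> oU Ux; apply: (@cvg_line _ id x v); first exact: cvg_id.
exact: open_nbhs_nbhs.
Qed.

Lemma ge0_line phi x v : {for x, continuous phi} ->
  (\forall t \near (0 : R)^', 0 <= phi (x + t *: v)) -> 0 <= phi x.
Proof.
move=> cphi nphi.
have := @closed_cvg _ _ _ _ (fun t : R => phi (x + t *: v)) _ (@closed_ge R 0) nphi (phi x).
by apply; exact: cvg_line.
Qed.

Lemma eq0_line phi x v : {for x, continuous phi} ->
  (\forall t \near (0 : R)^', phi (x + t *: v) = 0) -> phi x = 0.
Proof.
move=> cphi nphi; apply/eqP; rewrite eq_le; apply/andP; split; last first.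
  by apply: (@ge0_line _ _ v) => //; apply: filterS nphi => t ->.
rewrite -oppr_ge0; apply: (@ge0_line (fun y => - phi y) _ v).
  by move: cphi; rewrite /prop_for /continuous_at; exact: cvgN.
by apply: filterS nphi => t ->; rewrite oppr0.
Qed.

End Density.

(** * Continuity of complex-valued functions and of the Courant bracket *)

Section ComplexContinuity.
Variables (R : realType) (V : normedModType R).
Implicit Types (f g : V -> R[i]) (x v : V).
Local Notation Re := (@complex.Re R).
Local Notation Im := (@complex.Im R).

Definition ccontinuous_at x f :=
  {for x, continuous (fun y => Re (f y))} /\ {for x, continuous (fun y => Im (f y))}.

Lemma ccontinuous_cst x c : ccontinuous_at x (fun _ => c).
Proof. by split; exact: cst_continuous. Qed.

Lemma ccontinuousD x f g : ccontinuous_at x f -> ccontinuous_at x g ->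
  ccontinuous_at x (fun y => f y + g y).
Proof.
move=> [f1 f2] [g1 g2]; split; rewrite /prop_for /continuous_at raddfD/=.
  by under eq_fun do rewrite raddfD/=; exact: (cvgD f1 g1).
by under eq_fun do rewrite raddfD/=; exact: (cvgD f2 g2).
Qed.

Lemma ccontinuousN x f : ccontinuous_at x f -> ccontinuous_at x (fun y => - f y).
Proof.
move=> [f1 f2]; split; rewrite /prop_for /continuous_at raddfN/=.
  by under eq_fun do rewrite raddfN/=; exact: (cvgN f1).
by under eq_fun do rewrite raddfN/=; exact: (cvgN f2).
Qed.

Lemma ccontinuousM x f g : ccontinuous_at x f -> ccontinuous_at x g ->
  ccontinuous_at x (fun y => f y * g y).
Proof.
move=> [f1 f2] [g1 g2]; split; rewrite /prop_for /continuous_at ?Re_mulc ?Im_mulc.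
  by under eq_fun do rewrite Re_mulc; exact: (cvgB (cvgM f1 g1) (cvgM f2 g2)).
by under eq_fun do rewrite Im_mulc; exact: (cvgD (cvgM f1 g2) (cvgM f2 g1)).
Qed.

Lemma ccontinuous_sum n x (f : 'I_n -> V -> R[i]) :
  (forall i, ccontinuous_at x (f i)) -> ccontinuous_at x (fun y => \sum_i f i y).
Proof.
elim: n f => [|n IH] f h.
  by under eq_fun do rewrite big_ord0; exact: ccontinuous_cst.
under eq_fun do rewrite big_ord_recl.
by apply: ccontinuousD => //; exact: IH.
Qed.

Lemma ccontinuous_near x f g : (\near x, f x = g x) ->
  ccontinuous_at x f -> ccontinuous_at x g.
Proof.
move=> fg [f1 f2]; have fgx := nbhs_singleton fg.
split; rewrite /prop_for /continuous_at -fgx.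
  by apply: cvg_trans f1; apply: near_eq_cvg; apply: filterS fg => y ->.
by apply: cvg_trans f2; apply: near_eq_cvg; apply: filterS fg => y ->.
Qed.

Lemma csmooth_continuous f x : csmooth f -> ccontinuous_at x f.
Proof. by move=> [s1 s2]; split; exact: smooth_onT_continuous. Qed.

Lemma ceq0_line f x v : ccontinuous_at x f ->
  (\forall t \near (0 : R)^', f (x + t *: v) = 0) -> f x = 0.
Proof.
move=> [f1 f2] nf.
have h1 := @eq0_line _ _ _ _ v f1; have h2 := @eq0_line _ _ _ _ v f2.
apply/eqP; rewrite eq_complex/= h1 ?h2 ?eqxx//; by apply: filterS nf => t ->.
Qed.

End ComplexContinuity.

Section CourantContinuity.
Variables (R : realType) (n : nat).
Local Notation V := 'rV[R]_n.
Implicit Types (U : set V).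

Lemma mx_continuous_coord (W : topologicalType) p q (A : W -> 'M[R]_(p, q)) x i j :
  {for x, continuous A} -> {for x, continuous (fun y => A y i j)}.
Proof.
move=> cA; apply: (@continuous_comp _ _ _ A (fun M : 'M[R]_(p, q) => M i j)) => //.
exact: coord_continuous.
Qed.

Lemma smooth_complex_continuous p U (u : V -> 'rV[R[i]]_p) x j :
  smooth_complex_on U u -> U x -> ccontinuous_at x (fun y => u y 0 j).
Proof.
move=> [/(_ 0)[c1 _] /(_ 0)[c2 _]] Ux; split.
  rewrite (_ : (fun y => _) = fun y => map_mx (@complex.Re R) (u y) 0 j).
    exact: mx_continuous_coord (c1 _ Ux).
  by apply/funext => y; rewrite mxE.
rewrite (_ : (fun y => _) = fun y => map_mx (@complex.Im R) (u y) 0 j).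
  exact: mx_continuous_coord (c2 _ Ux).
by apply/funext => y; rewrite mxE.
Qed.

Lemma smooth_complex_cderive_continuous p U (u : V -> 'rV[R[i]]_p) x v j :
  open U -> smooth_complex_on U u -> U x ->
  ccontinuous_at x (cderive v (fun y => u y 0 j)).
Proof.
move=> oU [/(_ 1)[_ /(_ v)[d1 [c1 _]]] /(_ 1)[_ /(_ v)[d2 [c2 _]]]] Ux.
have nU : \near x, U x by exact: open_nbhs_nbhs.
apply: (@ccontinuous_near _ _ _ (fun y =>
    ('D_v (fun z => map_mx (@complex.Re R) (u z)) y 0 j) +i*
    ('D_v (fun z => map_mx (@complex.Im R) (u z)) y 0 j))); last first.
  by split; apply: mx_continuous_coord; [exact: c1|exact: c2].
apply: filterS nU => y Uy; rewrite /cderive !derive_mx ?mxE; [|exact: d2|exact: d1].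
by congr (_ +i* _); congr ('D_v _ y); apply/funext => z; rewrite mxE.
Qed.

(** This lets integrability pass to the zeros of the bivector. The term d (i_X eta - i_Y xi) is
    expanded by the product rule on a neighbourhood, which exhibits it as a combination of
    continuous functions. *)
Lemma courant_continuous U (u v : V -> 'rV[R[i]]_(n + n)) x j : open U -> U x ->
  smooth_complex_on U u -> smooth_complex_on U v ->
  ccontinuous_at x (fun y => courant u v y 0 j).
Proof.
move=> oU Ux su sv.
have nU : \near x, U x by exact: open_nbhs_nbhs.
have lE (w : V -> 'rV[R[i]]_(n + n)) k : (fun y => lsubmx (w y) 0 k) = fun y => w y 0 (lshift n k).
  by apply/funext => y; rewrite mxE.
have rE (w : V -> 'rV[R[i]]_(n + n)) k : (fun y => rsubmx (w y) 0 k) = fun y => w y 0 (rshift n k).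
  by apply/funext => y; rewrite mxE.
have c0 (w : V -> 'rV[R[i]]_(n + n)) k : smooth_complex_on U w -> ccontinuous_at x (fun y => w y 0 k).
  by move=> sw; exact: (smooth_complex_continuous k sw Ux).
have c1 (w : V -> 'rV[R[i]]_(n + n)) i k : smooth_complex_on U w -> ccontinuous_at x (partial i (fun y => w y 0 k)).
  by move=> sw; exact: (smooth_complex_cderive_continuous _ k oU sw Ux).
have dd (w : V -> 'rV[R[i]]_(n + n)) y i k : smooth_complex_on U w -> U y ->
    is_cderive y (delta_mx 0 i) (fun y => w y 0 k) (partial i (fun y => w y 0 k) y).
  by move=> sw Uy; exact: (smooth_complex_cderive _ _ sw Uy).
have dc (u' v' : V -> 'rV[R[i]]_(n + n)) y i : smooth_complex_on U u' -> smooth_complex_on U v' -> U y ->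
    is_cderive y (delta_mx 0 i) (fun y => contraction (lsubmx (u' y)) (rsubmx (v' y)))
    (\sum_k (partial i (fun y => lsubmx (u' y) 0 k) y * rsubmx (v' y) 0 k
       + lsubmx (u' y) 0 k * partial i (fun y => rsubmx (v' y) 0 k) y)).
  move=> su' sv' Uy; rewrite /contraction; apply: is_cderive_sum => k.
  by apply: is_cderiveM; rewrite ?lE ?rE; exact: dd.
rewrite /courant -(splitK j); case: (fintype.split j) => k /=.
  under eq_fun do rewrite row_mxEl mxE.
  apply: ccontinuous_sum => i; apply: ccontinuousD; last apply: ccontinuousN;
    apply: ccontinuousM; rewrite ?lE; solve [exact: c0|exact: c1].
under eq_fun do rewrite row_mxEr !mxE.
apply: ccontinuousD; last apply: ccontinuousN; last first.
  apply: ccontinuousM; first exact: ccontinuous_cst.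
  apply: (@ccontinuous_near _ _ _ (fun y =>
    \sum_i (partial k (fun y => lsubmx (u y) 0 i) y * rsubmx (v y) 0 i
       + lsubmx (u y) 0 i * partial k (fun y => rsubmx (v y) 0 i) y) -
    \sum_i (partial k (fun y => lsubmx (v y) 0 i) y * rsubmx (u y) 0 i
       + lsubmx (v y) 0 i * partial k (fun y => rsubmx (u y) 0 i) y))).
    apply: filterS nU => y Uy; rewrite partialE; apply/esym/cderive_val.
    by apply: is_cderiveB; exact: dc.
  by apply: ccontinuousD; last apply: ccontinuousN; apply: ccontinuous_sum => i;
    apply: ccontinuousD; apply: ccontinuousM; rewrite ?lE ?rE; solve [exact: c0|exact: c1].
by apply: ccontinuousD; last apply: ccontinuousN; apply: ccontinuous_sum => i;
  apply: ccontinuousD; apply: ccontinuousM; rewrite ?lE ?rE; solve [exact: c0|exact: c1].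
Qed.

End CourantContinuity.

(** * The bivector on CP^2 in the three charts *)

Section TransitionDeterminant.
Variable R : realType.
Implicit Types (k l : 'I_3) (x : 'rV[R]_(2 + 2)).

Lemma homog3E k (z : 'rV[R[i]]_2) l :
  homog k z 0 l = if l == k then 1 else if unbump k l == 0%N then z 0 0 else z 0 1.
Proof.
case: (unliftP k l) => [j ->|->]; last by rewrite homog_diag eqxx.
rewrite homog_lift eq_sym (negbTE (neq_lift _ _)) /= bumpK.
by move: j; apply: ord2P.
Qed.

Lemma transition_mxE k l x i j : transition_mx k l x i j =
  (lift k i == lift l j)%:R / homog k (toC x) 0 l
  - (lift k i == l)%:R * homog k (toC x) 0 (lift l j) / homog k (toC x) 0 l ^+ 2.
Proof. by rewrite [LHS]mxE. Qed.

(* The inverse of dz1 /\ dz2, which has a pole of order 3 on the line at infinity. *)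
Definition bivector_coef k x : R[i] := (-1) ^+ k * homog k (toC x) 0 ord0 ^+ 3.

(** The determinant of the transition is (-1)^(k + l) Z_l^-3 with Z_l the homogeneous coordinate l:
    the cube matches the homogeneity of Z_0^3, and the signs account for the position of the
    inserted 1. *)
Lemma bivector_coef_transition k l x : overlap k l x ->
  bivector_coef k x * \det (transition_mx k l x) =
  bivector_coef l (transition k l x).
Proof.
move=> kl; rewrite /bivector_coef homog_transition//; move: kl; rewrite /overlap.
rewrite det2 !transition_mxE !homog3E -!val_eqE /= /bump /unbump.
have m12 : (1 %% 2 = 1)%N by [].
move: (toC x 0 0) (toC x 0 1) => a b.
case: k => [[|[|[|//]]] Hk]; case: l => [[|[|[|//]]] Hl]; rewrite /= ?m12 /= => h0;
 rewrite ?(mulr0n, mulr1n, mul0r, mul1r, mulr0, mulr1, expr0, expr1, subr0, sub0r, divr1); by field; rewrite ?h0.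
Qed.

End TransitionDeterminant.

(** * Integrability of the two structures in a chart *)

Section GeneralizedComplexCharts.
Variable R : realType.

Lemma trmx_complexify p q (A : 'M[R]_(p, q)) : (complexify A)^T = complexify A^T.
Proof. by apply/matrixP => i j; rewrite !mxE. Qed.

Lemma complex_neq0 (z : R[i]) :
  (z != 0) = (complex.Re z ^+ 2 + complex.Im z ^+ 2 != 0).
Proof.
by rewrite paddr_eq0 ?sqr_ge0// !sqrf_eq0 eq_complex; case: z.
Qed.

Lemma Ck_on_sub (V W : normedModType R) (U U' : set V) k (f : V -> W) :
  U' `<=` U -> Ck_on k U f -> Ck_on k U' f.
Proof.
move=> sU; elim: k f => [|k IH] f [cf df].
  by split=> // x /sU; exact: cf.
split=> [x /sU|v]; first exact: cf.
by have [h1 h2] := df v; split=> [x /sU|]; [exact: h1|exact: IH].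
Qed.

Lemma smooth_complex_on_sub n p (U U' : set 'rV[R]_n) (u : 'rV[R]_n -> 'rV[R[i]]_p) :
  U' `<=` U -> smooth_complex_on U u -> smooth_complex_on U' u.
Proof. by move=> sU [s1 s2]; split=> k; [exact: Ck_on_sub (s1 k)|exact: Ck_on_sub (s2 k)]. Qed.

Lemma Jsym_gen_complex m (B F : 'rV[R]_(m + m) -> 'M[R]_(m + m)) :
  smooth_on setT B -> smooth_on setT F -> (forall x, F x \in unitmx) ->
  (forall x, (B x)^T = - B x) -> (forall x, (F x)^T = - F x) ->
  closed2_on setT B -> closed2_on setT F ->
  gen_complex_on setT (fun x => Jsym (B x) (F x)).
Proof.
move=> sB sF uF Bs Fs cB cF; split.
- exact: smooth_Jsym.
- by move=> x _; exact: Jsym_sq.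
- by move=> x _ A A'; apply: pairing_orthogonal; exact: Jsym_orthogonal.
move=> V oV _ u v su sv uJ vJ x Vx; apply/(Jsym_plus_i _ _ (uF x)).
have dbeta y i j k : is_cderive y (delta_mx 0 i)
    (fun y => (complexify (B y) - 'i%C *: complexify (F y)) j k)
    (('D_(delta_mx 0 i) (fun y => B y j k) y)%:C
     - 'i%C * ('D_(delta_mx 0 i) (fun y => F y j k) y)%:C).
  rewrite (_ : (fun y => _) = fun y => (B y j k)%:C - 'i%C * (F y j k)%:C); last first.
    by apply/funext => z; rewrite !mxE.
  apply: is_cderiveB.
    apply/is_cderive_real/derivableP; apply: smooth_onT_derivable.
    by move/smooth_mxP: sB; exact.
  apply: is_cderive_eq.
    apply: is_cderiveM; first exact: is_cderive_cst.
    apply/is_cderive_real/derivableP; apply: smooth_onT_derivable.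
    by move/smooth_mxP: sF; exact.
  by rewrite mul0r add0r.
have pE y i j k : partial i (fun y => (complexify (B y) - 'i%C *: complexify (F y)) j k) y =
    ('D_(delta_mx 0 i) (fun y => B y j k) y)%:C
     - 'i%C * ('D_(delta_mx 0 i) (fun y => F y j k) y)%:C.
  by rewrite partialE (cderive_val (dbeta y i j k)).
apply: (courant_graph (beta := fun y => complexify (B y) - 'i%C *: complexify (F y)) oV Vx) => //.
- move=> y _; rewrite linearB linearZ/= !trmx_complexify Bs Fs !complexifyN.
  by rewrite scalerN opprB opprK addrC.
- by move=> i j k; rewrite pE; exact: dbeta.
- move=> i j k; rewrite !pE.
  have /(congr1 (real_complex R)) := cB x I i j k; rewrite !rmorphD rmorph0 /= => cBx.
  have /(congr1 (real_complex R)) := cF x I i j k; rewrite !rmorphD rmorph0 /= => cFx.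
  transitivity (0 - 'i%C * 0 : R[i]); last by rewrite mulr0 subrr.
  by rewrite -{1}cBx -cFx; ring.
- by move=> y /uJ/(Jsym_plus_i _ _ (uF y)).
- by move=> y /vJ/(Jsym_plus_i _ _ (uF y)).
Qed.

Lemma smooth_bivector (V : normedModType R) (p : V -> R[i]) : csmooth p ->
  smooth_on setT (fun x => bivector (p x)).
Proof.
move=> [p1 p2].
have sZ (f : V -> R) : smooth_on setT f -> smooth_on setT (fun x => f x *: skew2 R).
  move=> sf; apply/smooth_mxP => i j; under eq_fun do rewrite mxE.
  by apply: smooth_onTM => //; exact: smooth_onT_cst.
by rewrite /bivector; apply: smooth_block_mx; apply: sZ => //; exact: smooth_onTN.
Qed.

Lemma dzE m (j : 'I_m) i : dz R j 0 i = toC (delta_mx 0 i) 0 j.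
Proof.
rewrite /dz -(splitK i); case: (fintype.split i) => i' /=.
  rewrite row_mxEl !mxE /= ?eq_lshift ?eq_rlshift ?eq_lrshift ?andbT.
  by rewrite eq_sym; case: (j == i').
rewrite row_mxEr !mxE /= ?eq_rshift ?eq_rlshift ?eq_lrshift ?andbT.
by rewrite eq_sym; case: (j == i'); simpc.
Qed.

(** Where p is nonzero the eigenbundle is the graph of - p^-1 beta_1. The second hypothesis says
    that dp is a multiple of dz_1, so that d (p^-1) /\ dz_1 /\ dz_2 vanishes and this form is
    closed. The third makes every point, zeros of p included, a limit along v0 of points where p is
    nonzero. *)
Lemma Jhol_gen_complex (p : 'rV[R]_(2 + 2) -> R[i]) (v0 : 'rV[R]_(2 + 2)) :
  csmooth p ->
  (forall x, exists c, forall v, is_cderive x v p (c * toC v 0 0)) ->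
  (forall x, \forall t \near (0 : R)^', p (x + t *: v0) != 0) ->
  gen_complex_on setT (fun x => Jhol (stdI R 2) (bivector (p x))).
Proof.
move=> sp dp p0.
have sS := smooth_bivector sp.
split.
- rewrite /Jhol; apply: smooth_block_mx => //; exact: smooth_onT_cst.
- by move=> x _; apply: Jhol_sq; [exact: stdI_sq|exact: bivector_stdI].
- move=> x _ A A'; apply: pairing_orthogonal; apply: Jhol_orthogonal.
  + exact: stdI_sq.
  + exact: trmx_stdI.
  + exact: bivector_stdI.
  + exact: trmx_bivector.
move=> V oV _ u v su sv uJ vJ.
have generic x : V x -> p x != 0 ->
    in_plus_i (Jhol (stdI R 2) (bivector (p x))) (courant u v x).
  move=> Vx px0; apply/(Jhol_plus_i _ px0).
  (* The part of V on which the sections lie in a graph; the form p^-1 beta_1 is only used there. *)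
  pose U := V `&` [set y | p y != 0].
  have oU : open U.
    apply: openI => //.
    pose N y := complex.Re (p y) ^+ 2 + complex.Im (p y) ^+ 2.
    rewrite (_ : [set _ | _] = N @^-1` [set r | r != 0]).
      apply: open_comp; last exact: open_neq.
      move=> y _; apply: smooth_onT_continuous; case: sp => p1 p2.
      by apply: smooth_onTD; exact: smooth_onTX.
    by apply/seteqP; split=> y /=; rewrite complex_neq0.
  have Ux : U x by [].
  have [c dpc] := dp x.
  have dbeta i j k : is_cderive x (delta_mx 0 i) (fun y => ((p y)^-1 *: beta1 R) j k)
      (- (c * toC (delta_mx 0 i) 0 0 / p x ^+ 2) * beta1 R j k).
    under eq_fun do rewrite mxE.
    apply: is_cderive_eq.
      by apply: is_cderiveM; [apply: is_cderiveV => //; exact: dpc|exact: is_cderive_cst].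
    by rewrite mulr0 addr0.
  have pE i j k : partial i (fun y => ((p y)^-1 *: beta1 R) j k) x =
      - (c * toC (delta_mx 0 i) 0 0 / p x ^+ 2) * beta1 R j k.
    by rewrite partialE (cderive_val (dbeta i j k)).
  apply: (courant_graph (beta := fun y => (p y)^-1 *: beta1 R) oU Ux) => //.
  - by move=> y _; rewrite linearZ/= trmx_beta1 scalerN.
  - by move=> i j k; rewrite pE; exact: dbeta.
  - move=> i j k; rewrite !pE -!dzE.
    have bE a b : beta1 R a b = dz R 0 0 a * dz R 1 0 b - dz R 1 0 a * dz R 0 0 b.
      rewrite /beta1 /wedge; generalize (@dz R 2 0) (@dz R 2 1) => s t.
      by rewrite mx_addE mx_oppE !mul_tr_row.
    rewrite !bE; move: (p x ^+ 2) => q; generalize (@dz R 2 0) (@dz R 2 1) => a b.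
    by ring.
  - by apply: smooth_complex_on_sub su => y [].
  - by apply: smooth_complex_on_sub sv => y [].
  - by move=> y [Vy py0]; apply/(Jhol_plus_i _ py0)/uJ.
  - by move=> y [Vy py0]; apply/(Jhol_plus_i _ py0)/vJ.
move=> x Vx; rewrite /in_plus_i; apply/rowP => j; apply/eqP; rewrite -subr_eq0; apply/eqP.
pose f y := (courant u v y *m complexify (Jhol (stdI R 2) (bivector (p y)))) 0 j
   - ('i%C *: courant u v y) 0 j.
have sJ : smooth_on setT (fun x => Jhol (stdI R 2) (bivector (p x))).
  by rewrite /Jhol; apply: smooth_block_mx => //; exact: smooth_onT_cst.
have cc k : ccontinuous_at x (fun y => courant u v y 0 k) by exact: (courant_continuous k oV Vx su sv).
have cf : ccontinuous_at x f.
  rewrite /f; apply: ccontinuousD; last apply: ccontinuousN.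
    under eq_fun do rewrite mxE.
    apply: ccontinuous_sum => k; apply: ccontinuousM; first exact: cc.
    under eq_fun do rewrite mxE.
    by apply/csmooth_continuous/csmooth_real; move/smooth_mxP: sJ; exact.
  under eq_fun do rewrite mxE.
  by apply: ccontinuousM => //; exact: ccontinuous_cst.
apply: (ceq0_line (v := v0) cf); near=> t.
rewrite /f generic ?subrr//; last by near: t.
by near: t; exact: near_line.
Unshelve. all: by end_near. Qed.

End GeneralizedComplexCharts.

(** * Continuity of matrix products and nondegeneracy of the metric *)

Section RealContinuity.
Variables (R : realType) (V : normedModType R).

Lemma continuous_at_sum n x (f : 'I_n -> V -> R) :
  (forall i, {for x, continuous (f i)}) ->
  {for x, continuous (fun y => \sum_i f i y)}.
Proof.
elim: n f => [|n IH] f h; rewrite /prop_for /continuous_at.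
  by under eq_fun do rewrite big_ord0; rewrite big_ord0; exact: cvg_cst.
under eq_fun do rewrite big_ord_recl; rewrite big_ord_recl.
exact: (cvgD (h ord0) (IH _ (fun i => h (lift ord0 i)))).
Qed.

Lemma continuous_at_mulmx p q r x (A : V -> 'M[R]_(p, q)) (B : V -> 'M[R]_(q, r)) :
  (forall i j, {for x, continuous (fun y => A y i j)}) ->
  (forall i j, {for x, continuous (fun y => B y i j)}) ->
  forall i j, {for x, continuous (fun y => (A y *m B y) i j)}.
Proof.
move=> cA cB i j; rewrite /prop_for /continuous_at mxE; under eq_fun do rewrite mxE.
apply: (@continuous_at_sum _ x (fun k y => A y i k * B y k j)) => k.
exact: (cvgM (cA i k) (cB k j)).
Qed.

End RealContinuity.

Section HermitianMetric.
Variables (R : realType) (m : nat) (g : 'rV[R]_(m + m) -> 'M[R]_(m + m)).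
Hypothesis gK : kahler_metric_on setT g.

Lemma metric_unit x : g x \in unitmx.
Proof.
rewrite -row_free_unit -kermx_eq0; apply/eqP/row_matrixP => i; rewrite row0.
have [_ _ g_gt0 _ _] := gK.
apply/eqP; apply: contraT => K0; have := g_gt0 x I _ K0.
have -> : row i (kermx (g x)) *m g x = 0 by rewrite -row_mul mulmx_ker row0.
by rewrite mul0mx mxE ltxx.
Qed.

Lemma fundamental_form_unit x : fundamental_form (g x) \in unitmx.
Proof.
rewrite /fundamental_form unitmx_mul metric_unit andbT.
have : stdI R m *m - stdI R m = 1%:M by rewrite mulmxN stdI_sq opprK.
by case/mulmx1_unit.
Qed.

End HermitianMetric.

(** * From a global B-field to a generalized Kaehler structure on CP^2 *)

Section Assembly.
Variable R : realType.
Local Notation V := 'rV[R]_(2 + 2).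
Local Notation I4 := (stdI R 2).
Implicit Types (k l : 'I_3) (x y : V).

(** In the charts other than 0, the line at infinity is the zero set of the first complex
    coordinate; moving along this direction leaves it, and in chart 0 it leaves the origin. *)
Let e0 : V := delta_mx 0 (lshift 2 0).

Lemma toC_line x (t : R) : toC (x + t *: e0) 0 0 = toC x 0 0 + t%:C.
Proof.
apply/eqP; rewrite eq_complex; apply/andP; split; apply/eqP.
  by rewrite raddfD/= !toC_re mx_addE mx_scaleE /e0 mxE !eqxx mulr1.
by rewrite raddfD/= !toC_im mx_addE mx_scaleE /e0 mxE eq_rlshift mulr0.
Qed.

Lemma near0_neq (a : R) : \forall t \near (0 : R)^', t != a.
Proof.
have [->|a0] := eqVneq a 0; first exact: nbhs_dnbhs_neq.
apply: nbhs_dnbhs; apply: open_nbhs_nbhs; split; first exact: open_neq.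
by rewrite /= eq_sym.
Qed.

Lemma toC_line_neq0 x : \forall t \near (0 : R)^', toC (x + t *: e0) 0 0 != 0.
Proof.
apply: filterS (near0_neq (- complex.Re (toC x 0 0))) => t; apply: contra_neq.
rewrite toC_line => /(congr1 (@complex.Re R)); rewrite raddfD/= => /eqP.
by rewrite addrC addr_eq0 => /eqP.
Qed.

Lemma transition_mx_diag m (k : 'I_m.+1) (x : 'rV[R]_(m + m)) : transition_mx k k x = 1%:M.
Proof.
apply/matrixP => i j; rewrite mxE homog_diag divr1 expr1n divr1.
rewrite (inj_eq (@lift_inj _ _)) (eq_sym _ k) (negbTE (neq_lift _ _)) mul0r subr0.
by rewrite mxE.
Qed.

Lemma jacobian_unit m (k l : 'I_m.+1) (x : 'rV[R]_(m + m)) : overlap k l x ->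
  jacobian (transition k l) x \in unitmx.
Proof.
move=> kl; have kk : overlap k k x by rewrite /overlap homog_diag oner_neq0.
have := jacobian_comp kl kk; rewrite jacobian_transition// transition_mx_diag realify1.
by move=> E; exact: (proj1 (mulmx1_unit (esym E))).
Qed.

Lemma jacobian_stdI m (k l : 'I_m.+1) (x : 'rV[R]_(m + m)) : overlap k l x ->
  jacobian (transition k l) x *m stdI R m = stdI R m *m jacobian (transition k l) x.
Proof. by move=> kl; rewrite jacobian_transition// realify_stdI. Qed.

Lemma overlap_line k x : \forall t \near (0 : R)^', overlap k ord0 (x + t *: e0).
Proof.
apply: filterS (toC_line_neq0 x) => t; rewrite /overlap homog3E.
by case: ifP => // _; rewrite oner_neq0.
Qed.

(** Points of the chart k have nonzero homogeneous coordinate k, whereas that of [1, 0, 0]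
    vanishes. *)
Lemma transition_neq0 k x : k != ord0 -> overlap k ord0 x -> transition k ord0 x != 0.
Proof.
move=> k0 kx; apply/eqP => T0.
have := homog_transition k kx; rewrite T0 homog_diag.
have [j kE|/eqP] := unliftP ord0 k; last by rewrite (negbTE k0).
have z0 : toC (0 : V) 0 j = 0 by rewrite !mxE.
rewrite {1}kE homog_lift z0 => /esym/eqP; rewrite mul1r invr_eq0.
by rewrite (negbTE kx).
Qed.

Lemma bivector_coef_line k x :
  \forall t \near (0 : R)^', bivector_coef k (x + t *: e0) != 0.
Proof.
apply: filterS (overlap_line k x) => t; rewrite /overlap /bivector_coef => ov.
by rewrite mulf_neq0 ?expf_neq0// oppr_eq0 oner_eq0.
Qed.

Lemma csmooth_bivector_coef k : csmooth (bivector_coef k : V -> R[i]).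
Proof.
by apply: csmoothM; [exact: csmooth_cst|apply/csmoothX/csmooth_homog].
Qed.

(** The coefficient is constant in chart 0, and elsewhere plus or minus the cube of the first
    coordinate: in all cases its differential is a multiple of dz_1. *)
Lemma is_cderive_bivector_coef k x :
  exists c, forall v, is_cderive x v (bivector_coef k) (c * toC v 0 0).
Proof.
have [c dc] : exists c, forall v,
    is_cderive x v (fun y => homog k (toC y) 0 ord0) (c * toC v 0 0).
  have [j0 j0E|k0] := unliftP ord0 k; last first.
    exists 0 => v; apply: (is_cderive_eq (is_cderive_homog k ord0 x v)).
    by rewrite mul0r big1// => i _; rewrite k0 eq_sym (negbTE (neq_lift _ _)) mulr0.
  exists 1 => v; apply: (is_cderive_eq (is_cderive_homog k ord0 x v)).
  have m12 : (1 %% 2 = 1)%N by [].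
  rewrite sum2 j0E -!val_eqE /= ?m12 /bump /= ?addn0 ?addn1 /=.
  by rewrite mulr1 mulr0 addr0 mul1r.
exists ((-1) ^+ k * (3 * homog k (toC x) 0 ord0 ^+ 2 * c)) => v.
apply: is_cderive_eq.
  apply: is_cderiveM; first exact: is_cderive_cst.
  by apply: is_cderiveX; exact: dc.
by rewrite mul0r add0r !mulrA.
Qed.

Lemma Jhol_chart k :
  gen_complex_on setT (fun x => Jhol I4 (bivector (bivector_coef k x))).
Proof.
apply: (@Jhol_gen_complex _ _ e0).
- exact: csmooth_bivector_coef.
- exact: is_cderive_bivector_coef.
- exact: bivector_coef_line.
Qed.

Variables (g B : 'I_3 -> V -> 'M[R]_(2 + 2)).
Hypothesis gK : kahler_metric_CP g.
Hypotheses (smoothB : forall k, smooth_on setT (B k))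
  (skewB : forall k x, (B k x)^T = - B k x)
  (closedB : forall k, closed2_on setT (B k))
  (B_chart0 : forall k x, overlap k ord0 x ->
     B k x = jacobian (transition k ord0) x *m B ord0 (transition k ord0 x)
       *m (jacobian (transition k ord0) x)^T).

Let F k x := fundamental_form (g k x).
Let S k x := bivector (bivector_coef k x).

(** These are assumed only where the explicit formulas live, in chart 0 off the origin; the versions
    in all charts are limits of them. *)
Hypotheses
  (commute1 : forall y, y != 0 ->
     B ord0 y *m I4 - I4 *m B ord0 y - B ord0 y *m bivector 1 *m B ord0 y =
     - (F ord0 y *m bivector 1 *m F ord0 y))
  (commute2 : forall y, y != 0 ->
     B ord0 y *m bivector 1 *m F ord0 y = - (F ord0 y *m bivector 1 *m B ord0 y))
  (trace_cond : forall y, y != 0 -> exists2 mu, 0 <= mu &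
     B ord0 y *m bivector 1 *m I4 + I4 *m B ord0 y *m bivector 1 = - (mu *+ 2)%:M).

Let kahler_chart k : kahler_metric_on setT (g k).
Proof. by case: gK. Qed.

Let gT k x : (g k x)^T = g k x.
Proof. by have [_ h _ _ _] := kahler_chart k; exact: h. Qed.

Let gI k x : I4 *m g k x = g k x *m I4.
Proof.
have [_ _ _ h _] := kahler_chart k; have := h x I.
move=> E; rewrite -[in RHS]E // trmx_stdI !(mulmxN, mulNmx) -!mulmxA stdI_sq.
by rewrite !mulmxN mulmx1 opprK.
Qed.

Let g_gt0 k x (X : V) : X != 0 -> 0 < (X *m g k x *m X^T) 0 0.
Proof. by have [_ _ h _ _] := kahler_chart k; exact: h. Qed.

Let uF k x : F k x \in unitmx.
Proof. exact: fundamental_form_unit (kahler_chart k) x. Qed.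

Let FT k x : (F k x)^T = - F k x.
Proof. by rewrite /F /fundamental_form trmx_mul gT trmx_stdI mulmxN -gI. Qed.

Let FI k x : F k x *m I4 = I4 *m F k x.
Proof. by rewrite /F /fundamental_form -mulmxA -gI. Qed.

Let smoothF k : smooth_on setT (F k).
Proof.
by apply: smooth_mx_mul; [exact: smooth_onT_cst|have [] := kahler_chart k].
Qed.

Let F_transition k l x : overlap k l x ->
  F k x = jacobian (transition k l) x *m F l (transition k l x)
    *m (jacobian (transition k l) x)^T.
Proof.
move=> kl; rewrite /F /fundamental_form; case: gK => /(_ _ _ _ kl)/= -> _.
by rewrite !mulmxA jacobian_stdI.
Qed.

Let S_transition k l x : overlap k l x ->
  (jacobian (transition k l) x)^T *m S k x *m jacobian (transition k l) x =
  S l (transition k l x).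
Proof.
by move=> kl; rewrite jacobian_transition// bivector_push bivector_coef_transition.
Qed.

(** On points covered by chart 0 as well, the law follows by composing transitions. On the line at
    infinity it holds by continuity of both sides. *)
Let B_transition k l x : overlap k l x ->
  B k x = jacobian (transition k l) x *m B l (transition k l x)
    *m (jacobian (transition k l) x)^T.
Proof.
move=> kl; have key y : overlap k l y -> overlap k ord0 y ->
    B k y = jacobian (transition k l) y *m B l (transition k l y)
      *m (jacobian (transition k l) y)^T.
  move=> kly ky; rewrite (B_chart0 ky) (B_chart0 (overlap_transition kly ky)).
  rewrite (transition_comp kly ky) (jacobian_comp kly ky).
  move: (jacobian (transition k l) y) (jacobian (transition l ord0) _) (B ord0 _) => D1 D2 b.
  by rewrite trmx_mul !mulmxA.
rewrite jacobian_transition//; apply/matrixP => i j.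
pose M y := realify (transition_mx k l y).
have cM a b : {for x, continuous (fun y => M y a b)}.
  have ct c d : cdifferentiable (fun y => transition_mx k l y c d) x.
    under eq_fun do rewrite mxE.
    have ov : homog k (toC x) 0 l ^+ 2 != 0 by rewrite expf_neq0.
    apply: cdifferentiableD; last apply: cdifferentiableN; apply: cdifferentiableM.
    - exact: cdifferentiable_cst.
    - by apply: cdifferentiableV => //; exact: cdifferentiable_homog.
    - by apply: cdifferentiableM; [exact: cdifferentiable_cst|exact: cdifferentiable_homog].
    apply: cdifferentiableV => //; under eq_fun do rewrite expr2.
    by apply: cdifferentiableM; exact: cdifferentiable_homog.
  apply: differentiable_continuous; rewrite /M /realify.
  rewrite -(splitK a) -(splitK b).
  case: (fintype.split a) => a'; case: (fintype.split b) => b' /=; have [t1 t2] := ct a' b'.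
  - by under eq_fun do rewrite block_mxEul mxE.
  - by under eq_fun do rewrite block_mxEur mxE.
  - by under eq_fun do rewrite block_mxEdl mx_oppE mxE; exact: differentiableN.
  - by under eq_fun do rewrite block_mxEdr mxE.
have cB a b : {for x, continuous (fun y => B l (transition k l y) a b)}.
  apply: (@continuous_comp _ _ _ (transition k l) (fun z => B l z a b)).
    exact: (differentiable_continuous (differentiable_transition kl)).
  by apply: smooth_onT_continuous; have /smooth_mxP := smoothB l; exact.
apply/eqP; rewrite -subr_eq0; apply/eqP.
apply: (@eq0_line _ _ (fun y => B k y i j -
    (M y *m B l (transition k l y) *m (M y)^T) i j) x e0).
  have c1 : {for x, continuous (fun y => B k y i j)}.
    by apply: smooth_onT_continuous; have /smooth_mxP := smoothB k; exact.
  apply: (cvgB c1).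
  apply: (@continuous_at_mulmx _ _ _ _ _ x (fun y => M y *m B l (transition k l y)) (fun y => (M y)^T)).
    exact: (continuous_at_mulmx cM cB).
  move=> a b; rewrite (_ : (fun y => _) = fun y => M y b a); first exact: cM.
  by apply/funext => y; rewrite [LHS]mxE.
have nkl : \forall t \near (0 : R)^', overlap k l (x + t *: e0).
  by apply: near_line; [exact: open_overlap|].
near=> t.
have kt : overlap k l (x + t *: e0) by near: t; exact: nkl.
rewrite (key _ kt) ?jacobian_transition ?subrr//.
by near: t; exact: overlap_line.
Unshelve. all: by end_near. Qed.

Let good k x := overlap k ord0 x /\ transition k ord0 x != 0.

Let good_line k x : \forall t \near (0 : R)^', good k (x + t *: e0).
Proof.
near=> t; have ov : overlap k ord0 (x + t *: e0) by near: t; exact: overlap_line.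
split=> //; have [k0|] := eqVneq k ord0; last by move=> k0; exact: transition_neq0.
have : toC (x + t *: e0) 0 0 != 0 by near: t; exact: toC_line_neq0.
apply: contra_neq => T0; have := toC_transition k ord0 (x + t *: e0) 0.
rewrite T0 k0 homog_diag divr1 homog_lift => <-.
by rewrite !mxE.
Unshelve. all: by end_near. Qed.

Let S0 y : S ord0 y = bivector 1.
Proof. by rewrite /S /bivector_coef homog_diag expr1n expr0 mulr1. Qed.

Let push_conj k x (D := jacobian (transition k ord0) x) : overlap k ord0 x ->
  [/\ B k x = D *m B ord0 (transition k ord0 x) *m D^T,
      F k x = D *m F ord0 (transition k ord0 x) *m D^T,
      D^T *m S k x *m D = bivector 1,
      D *m I4 = I4 *m D & D^T *m I4 = I4 *m D^T].
Proof.
move=> kx; split; [exact: B_transition|exact: F_transition| | | ].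
- by rewrite S_transition// S0.
- exact: jacobian_stdI.
apply: trmx_inj; rewrite !trmx_mul trmxK trmx_stdI mulNmx mulmxN.
by rewrite jacobian_stdI.
Qed.

Let entries_line n1 n2 (M : V -> 'M[R]_(n1, n2)) k x : smooth_on setT M ->
  (forall y, good k y -> M y = 0) -> M x = 0.
Proof.
move=> /smooth_mxP sM M0; apply/matrixP => i j; rewrite mxE.
apply: (@eq0_line _ _ (fun y => M y i j) x e0).
  exact: (smooth_onT_continuous (sM i j)).
by apply: filterS (good_line k x) => t /M0 ->; rewrite mxE.
Qed.

Let smoothS k : smooth_on setT (S k).
Proof. exact/smooth_bivector/csmooth_bivector_coef. Qed.

Let commute1_chart k x :
  B k x *m I4 - I4 *m B k x - B k x *m S k x *m B k x = - (F k x *m S k x *m F k x).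
Proof.
apply/eqP; rewrite -subr_eq0 opprK; apply/eqP.
apply: (@entries_line _ _ (fun x => B k x *m I4 - I4 *m B k x
  - B k x *m S k x *m B k x + F k x *m S k x *m F k x) k).
  apply: smooth_onTD; last by apply: smooth_mx_mul => //; exact: smooth_mx_mul.
  apply: smooth_onTD; last by apply: smooth_mxN; apply: smooth_mx_mul => //; exact: smooth_mx_mul.
  apply: smooth_onTD; last apply: smooth_mxN; apply: smooth_mx_mul => //; exact: smooth_onT_cst.
move=> y [ky ty]; have [] := push_conj ky.
set D := jacobian _ _; set b := B ord0 _; set f := F ord0 _ => -> -> DS DI DTI.
transitivity (D *m (b *m I4 - I4 *m b - b *m (D^T *m S k y *m D) *m b
    + f *m (D^T *m S k y *m D) *m f) *m D^T).
  rewrite !(mulmxDr, mulmxDl, mulmxN, mulNmx); congr (_ - _ - _ + _); rewrite ?mulmxA//.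
    by rewrite -!mulmxA DTI.
  by rewrite DI.
by rewrite DS commute1// addNr mulmx0 mul0mx.
Qed.

Let commute2_chart k x : B k x *m S k x *m F k x = - (F k x *m S k x *m B k x).
Proof.
apply/eqP; rewrite -subr_eq0 opprK; apply/eqP.
apply: (@entries_line _ _ (fun x => B k x *m S k x *m F k x + F k x *m S k x *m B k x) k).
  by apply: smooth_onTD; apply: smooth_mx_mul => //; exact: smooth_mx_mul.
move=> y [ky ty]; have [] := push_conj ky.
set D := jacobian _ _; set b := B ord0 _; set f := F ord0 _ => -> -> DS DI DTI.
transitivity (D *m (b *m (D^T *m S k y *m D) *m f
    + f *m (D^T *m S k y *m D) *m b) *m D^T).
  by rewrite !(mulmxDr, mulmxDl) !mulmxA.
by rewrite DS commute2// addNr mulmx0 mul0mx.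
Qed.

Let trace_chart k x : exists2 mu, 0 <= mu &
  B k x *m S k x *m I4 + I4 *m B k x *m S k x = - (mu *+ 2)%:M.
Proof.
pose T y := B k y *m S k y *m I4 + I4 *m B k y *m S k y.
have sT : smooth_on setT T.
  apply: smooth_onTD; apply: smooth_mx_mul; do ?[exact: smooth_onT_cst|done];
    apply: smooth_mx_mul => //; exact: smooth_onT_cst.
have goodT y : good k y -> exists2 mu, 0 <= mu & T y = - (mu *+ 2)%:M.
  move=> [ky ty]; have [] := push_conj ky; have := jacobian_unit ky.
  have [mu mu0 muE] := trace_cond ty.
  rewrite /T; set D := jacobian _ _; set b := B ord0 _; set f := F ord0 _.
  move=> uD -> _ DS DI DTI; exists mu => //.
  have DTS : D^T *m S k y = bivector 1 *m invmx D by rewrite -DS mulmxK.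
  have -> : D *m b *m D^T *m S k y *m I4 + I4 *m (D *m b *m D^T) *m S k y =
      D *m (b *m bivector 1 *m I4 + I4 *m b *m bivector 1) *m invmx D.
    have DIV : invmx D *m I4 = I4 *m invmx D.
      by apply: (can_inj (mulKmx uD)); rewrite !mulmxA mulmxV// mul1mx DI mulmxK.
    rewrite mulmxDr mulmxDl; congr (_ + _).
      by rewrite -[D *m b *m _ *m _]mulmxA DTS -!mulmxA DIV.
    by rewrite !mulmxA -DI -!mulmxA DTS.
  by rewrite muE mulmxN mulNmx mul_mx_scalar -scalemxAl mulmxV// scalemx1.
(* Reading mu off a fixed entry of T makes it a continuous function, so that both the equation and
   mu >= 0 pass to the limit. *)
pose nu y := - 2^-1 * T y 0 0.
have TE y : T y = - (nu y *+ 2)%:M.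
  have TE' : smooth_on setT (fun y => T y + (nu y *+ 2)%:M).
    apply: smooth_onTD => //; apply/smooth_mxP => i j; under eq_fun do rewrite mxE.
    rewrite (_ : (fun y => _) = fun y => nu y * ((2 : R) *+ (i == j))).
      apply: smooth_onTM; last exact: smooth_onT_cst.
      apply: smooth_onTM; first exact: smooth_onT_cst.
      by move/smooth_mxP: sT; exact.
    by apply/funext => z; case: (i == j); rewrite ?mulr1n ?mulr0n; ring.
  apply/eqP; rewrite -subr_eq0 opprK; apply/eqP; apply: (entries_line _ TE') => z /goodT[mu mu0 E].
  have -> : nu z = mu by rewrite /nu E !mxE eqxx mulr1n; lra.
  by rewrite E addNr.
exists (nu x); last exact: TE.
apply: (@ge0_line _ _ nu x e0).
  apply: smooth_onT_continuous; apply: smooth_onTM; first exact: smooth_onT_cst.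
  by move/smooth_mxP: sT; exact.
apply: filterS (good_line k x) => t /goodT[mu mu0 E].
by rewrite /nu E !mxE eqxx mulr1n; lra.
Qed.

Lemma gen_kahler_CP_of_B_field :
  gen_kahler_CP (fun k x => Jhol I4 (S k x)) (fun k x => Jsym (B k x) (F k x)).
Proof.
have I2 := stdI_sq R 2; have IT := trmx_stdI R 2.
split.
- move=> k l x kl /=; apply: Jhol_push => //; first exact: jacobian_unit.
    exact: jacobian_stdI.
  exact: S_transition.
- move=> k l x kl /=; apply: Jsym_push => //; first exact: jacobian_unit.
    exact: B_transition.
  exact: F_transition.
move=> k; split.
- exact: Jhol_chart.
- apply: Jsym_gen_complex => //; by have [] := kahler_chart k.
- move=> x _; exact: (Jhol_Jsym_comm (uF k x) (FI k x) (commute1_chart k x) (commute2_chart k x)).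
move=> x _; have [mu mu0 muE] := trace_chart k x.
(* In aI + Ia with a = I + BS, the square I^2 = - 1 occurs twice, which adds 1 to mu. *)
have k_gt0 : 0 < 1 + mu by rewrite ltr_pwDl.
apply: (Jsym_Jhol_definite I2 IT (uF k x) (FI k x) (skewB k x) (trmx_bivector _)
  (bivector_stdI _) (commute1_chart k x) (commute2_chart k x) (gT k x) erefl (gI k x)
  (g_gt0 k x) _ k_gt0).
rewrite mulmxDl mulmxDr I2 mulmxA addrACA muE !mulr2n !raddfD/=.
by mx_ring.
Qed.

End Assembly.

(** * The conditions in a frame where the forms are standard *)

Section StandardForms.
Variable R : realType.
Local Notation I4 := (stdI R 2).
Local Notation E2 := (skew2 R).
Implicit Types (lam q : R).

Definition diag2 (a b : R) : 'M[R]_2 := \matrix_(i, j) ((if i == 0 then a else b) *+ (i == j)).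

Definition metric_std (h11 h22 : R) : 'M[R]_(2 + 2) :=
  block_mx (diag2 (2 * h11) (2 * h22)) 0 0 (diag2 (2 * h11) (2 * h22)).

(** The real part of beta_2 with v_1, v_2 replaced by dz_1, dz_2; in the same way [metric_std] is
    the metric. *)
Definition B_std (h12 lam : R) : 'M[R]_(2 + 2) :=
  block_mx ((2 * (h12 + lam)) *: E2) 0 0 ((2 * (h12 - lam)) *: E2).

Lemma diag2_skew2 a b : diag2 a b *m E2 *m diag2 a b = (a * b) *: E2.
Proof.
apply/matrixP; apply: ord2P; apply: ord2P; rewrite !mxE !sum2 !mxE !sum2 !mxE /=; ring.
Qed.

Lemma scale_skew2_mul a b : (a *: E2) *m (b *: E2) = (- (a * b))%:M.
Proof.
by rewrite -scalemxAl -scalemxAr scalerA skew2_sq scalerN scale_scalar_mx mulr1 -raddfN.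
Qed.

Lemma F_stdE (h11 h22 : R) : I4 *m metric_std h11 h22 =
  block_mx 0 (diag2 (2 * h11) (2 * h22)) (- diag2 (2 * h11) (2 * h22)) 0.
Proof.
rewrite /stdI /metric_std mulmx_block.
by rewrite !(mul1mx, mulmx1, mul0mx, mulmx0, addr0, add0r, mulNmx).
Qed.

Lemma bivector_real q : bivector q%:C = block_mx 0 (q *: E2) (q *: E2) 0.
Proof. by rewrite /bivector /= oppr0 !scale0r. Qed.

(** For q nonzero the hypothesis says that beta_2 - q^-1 dz_1 /\ dz_2, with dz_j in place of v_j,
    has square zero. *)
Lemma commute1_std (h11 h22 h12 lam q : R) (b := B_std h12 lam)
    (f := I4 *m metric_std h11 h22) (s := bivector q%:C) :
  lam + q * (h12 ^+ 2 - lam ^+ 2 + h11 * h22) = 0 ->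
  b *m I4 - I4 *m b - b *m s *m b = - (f *m s *m f).
Proof.
move=> ode; have ode' : q * h11 * h22 = - lam - q * h12 ^+ 2 + q * lam ^+ 2.
  by apply/eqP; rewrite -subr_eq0 -[X in _ == X]ode; apply/eqP; ring.
rewrite /b /f /s F_stdE bivector_real /B_std /stdI !mulmx_block.
rewrite !(mul1mx, mulmx1, mul0mx, mulmx0, addr0, add0r, mulNmx, mulmxN).
rewrite !opp_block_mx !add_block_mx !oppr0 !addr0.
rewrite !scale_skew2_mul -!scalemxAr -!scalemxAl diag2_skew2 !mul_scalar_mx !scalerA.
congr block_mx; apply/matrixP => i j;
  rewrite ?(mx_addE, mx_oppE, mx_scaleE); move: (E2 i j) => t; ring: ode'.
Qed.

Lemma commute2_std (h11 h22 h12 lam q : R) (b := B_std h12 lam)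
    (f := I4 *m metric_std h11 h22) (s := bivector q%:C) :
  b *m s *m f = - (f *m s *m b).
Proof.
rewrite /b /f /s F_stdE bivector_real /B_std !mulmx_block.
rewrite !(mul1mx, mulmx1, mul0mx, mulmx0, addr0, add0r, mulNmx, mulmxN) opp_block_mx.
rewrite !scale_skew2_mul -!mulmxA !scale_skew2_mul !mul_scalar_mx !mul_mx_scalar oppr0.
by congr block_mx; mx_ring.
Qed.

Lemma trace_std (h12 lam q : R) (b := B_std h12 lam) (s := bivector q%:C) :
  b *m s *m I4 + I4 *m b *m s = - ((- 2 * q * lam) *+ 2)%:M.
Proof.
rewrite /b /s bivector_real /B_std /stdI !mulmx_block.
rewrite !(mul1mx, mulmx1, mul0mx, mulmx0, addr0, add0r, mulNmx, mulmxN).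
rewrite !add_block_mx scalar_mx_block opp_block_mx.
rewrite !scale_skew2_mul.
congr block_mx; rewrite ?oppr0 ?addr0// -!raddfN -!raddfD /=; congr (_%:M); ring.
Qed.

End StandardForms.

(** * Transport of the conditions by a change of frame *)

Section PushForward.
Variables (R : realType) (n : nat) (I D B b F f S s : 'M[R]_n).
Hypotheses (DI : D *m I = I *m D) (DTI : D^T *m I = I *m D^T)
  (BE : B = D *m b *m D^T) (FE : F = D *m f *m D^T) (SE : D^T *m S *m D = s).

Lemma commute1_push : b *m I - I *m b - b *m s *m b = - (f *m s *m f) ->
  B *m I - I *m B - B *m S *m B = - (F *m S *m F).
Proof.
move=> H; apply/eqP; rewrite -subr_eq0 opprK; apply/eqP.
transitivity (D *m (b *m I - I *m b - b *m s *m b + f *m s *m f) *m D^T).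
  rewrite BE FE -SE !(mulmxDr, mulmxDl, mulmxN, mulNmx); congr (_ - _ - _ + _); rewrite ?mulmxA//.
    by rewrite -!mulmxA DTI.
  by rewrite DI.
by rewrite H addNr mulmx0 mul0mx.
Qed.

Lemma commute2_push : b *m s *m f = - (f *m s *m b) ->
  B *m S *m F = - (F *m S *m B).
Proof.
move=> H; apply/eqP; rewrite -subr_eq0 opprK; apply/eqP.
transitivity (D *m (b *m s *m f + f *m s *m b) *m D^T).
  by rewrite BE FE -SE !(mulmxDr, mulmxDl) !mulmxA.
by rewrite H addNr mulmx0 mul0mx.
Qed.

Lemma trace_push c : D \in unitmx -> b *m s *m I + I *m b *m s = c%:M ->
  B *m S *m I + I *m B *m S = c%:M.
Proof.
move=> uD H; have DTS : D^T *m S = s *m invmx D by rewrite -SE mulmxK.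
have DIV : invmx D *m I = I *m invmx D.
  by apply: (can_inj (mulKmx uD)); rewrite !mulmxA mulmxV// mul1mx DI mulmxK.
transitivity (D *m (b *m s *m I + I *m b *m s) *m invmx D).
  rewrite BE mulmxDr mulmxDl; congr (_ + _).
    by rewrite -[D *m b *m _ *m _]mulmxA DTS -!mulmxA DIV.
  by rewrite !mulmxA -DI -!mulmxA DTS.
by rewrite H mul_mx_scalar -scalemxAl mulmxV// scalemx1.
Qed.

End PushForward.

(** * Block matrices of the basic 2-forms *)

Section Blocks.
Variables (C : comNzRingType) (m : nat) (I h11 h22 h12 lam : C).
Variables d00 d01 d10 d11 : 'M[C]_m.
Hypothesis I2 : I * I = - 1.

(** For I = i and d, d' the matrix units at (j, k) and (k, j), this is the matrix of dz_j /\ conj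
    dz_k. Keeping I an abstract square root of - 1 leaves the identities to [ring]. *)
Let w (d d' : 'M[C]_m) := block_mx (d - d') (- I *: d - I *: d') (I *: d - - I *: d')
  ((I * - I) *: (d - d')).

Lemma hermitian_blocks : I *: (h11 *: w d00 d00 + h22 *: w d11 d11) =
  block_mx 0 ((2 * h11) *: d00 + (2 * h22) *: d11) (- ((2 * h11) *: d00 + (2 * h22) *: d11)) 0.
Proof.
rewrite /w !scale_block_mx add_block_mx scale_block_mx.
congr block_mx; apply/matrixP => i j; rewrite !(mx_addE, mx_oppE, mx_scaleE, mx_zeroE);
  ring: I2.
Qed.

Lemma beta2_blocks :
  h11 *: w d00 d00 + h12 *: w d01 d10 + - h12 *: w d10 d01 + h22 *: w d11 d11
  + lam *: (block_mx (d01 - d10) (I *: d01 - I *: d10) (I *: d01 - I *: d10)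
      ((I * I) *: (d01 - d10))
    + block_mx (d01 - d10) (- I *: d01 - - I *: d10) (- I *: d01 - - I *: d10)
      ((- I * - I) *: (d01 - d10))) =
  block_mx ((2 * (h12 + lam)) *: (d01 - d10)) 0 0 ((2 * (h12 - lam)) *: (d01 - d10))
  - I *: block_mx 0 ((2 * h11) *: d00 + (2 * h22) *: d11)
      (- ((2 * h11) *: d00 + (2 * h22) *: d11)) 0.
Proof.
rewrite /w add_block_mx !scale_block_mx opp_block_mx !add_block_mx.
congr block_mx; apply/matrixP => i j; rewrite !(mx_addE, mx_oppE, mx_scaleE, mx_zeroE);
  ring: I2.
Qed.

End Blocks.

(** * The frame v_1, v_2 *)

Section InvariantFrame.
Variable R : realType.
Implicit Types (y : 'rV[R]_(2 + 2)).
Local Notation I4 := (stdI R 2).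
Local Notation E2 := (skew2 R).

Definition normsq y : R := \sum_i y 0 i ^+ 2.

Lemma rnorm_sq y : rnorm y ^+ 2 = normsq y.
Proof. by rewrite /rnorm sqr_sqrtr// sumr_ge0// => i _; exact: sqr_ge0. Qed.

Lemma normsq_eq0 y : (normsq y == 0) = (y == 0).
Proof.
apply/eqP/eqP => [|->]; last by rewrite /normsq big1// => i _; rewrite mxE expr0n.
move=> /psumr_eq0P H; apply/rowP => i; rewrite mxE; apply/eqP.
by rewrite -sqrf_eq0 H// => j _; exact: sqr_ge0.
Qed.

Lemma rnorm_gt0 y : y != 0 -> 0 < rnorm y.
Proof.
rewrite -normsq_eq0 => y0; rewrite sqrtr_gt0 lt_neqAle eq_sym y0.
by rewrite sumr_ge0// => i _; exact: sqr_ge0.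
Qed.

Lemma normsqE y : (normsq y)%:C =
  toC y 0 0 * conjc (toC y 0 0) + toC y 0 1 * conjc (toC y 0 1).
Proof.
rewrite /normsq big_split_ord !sum2 !mxE /=.
by apply/eqP; rewrite eq_complex /=; apply/andP; split; apply/eqP; ring.
Qed.

(** The columns hold the coefficients of v_1 and v_2 in dz_1, dz_2. *)
Definition frame y : 'M[R[i]]_2 :=
  \matrix_(i, j) ((if j == 0 then conjc (toC y 0 i)
    else if i == 0 then - toC y 0 1 else toC y 0 0) / (normsq y)%:C).

Lemma v1_frame y : v1 y = dz R 0 *m (complexify (realify (frame y)))^T.
Proof.
rewrite dz_realify sum2 /v1 rnorm_sq scalerDr; generalize (@dz R 2 0) (@dz R 2 1) => a b.
rewrite !scalerA ![frame y _ _]mxE /=.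
by rewrite ![_^-1 * _]mulrC.
Qed.

Lemma v2_frame y : v2 y = dz R 1 *m (complexify (realify (frame y)))^T.
Proof.
rewrite dz_realify sum2 /v2 rnorm_sq scalerBr; generalize (@dz R 2 0) (@dz R 2 1) => a b.
rewrite !scalerA ![frame y _ _]mxE /=.
by rewrite ![_^-1 * _]mulrC mulNr scaleNr addrC.
Qed.

Lemma conj_form_real m (a : 'rV[R[i]]_(m + m)) (D : 'M[R]_(m + m)) :
  conj_form (a *m (complexify D)^T) = conj_form a *m (complexify D)^T.
Proof.
rewrite /conj_form map_mxM trmx_complexify; congr (_ *m _); apply/matrixP => i j.
by rewrite [LHS]mxE !mxE /= oppr0.
Qed.

Lemma det_frame y : y != 0 -> \det (frame y) = ((normsq y)^-1)%:C.
Proof.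
rewrite -normsq_eq0 => y0; have y0' : (normsq y)%:C != 0 :> R[i] by rewrite fmorph_eq0.
rewrite det2 ![frame y _ _]mxE /= fmorphV.
transitivity ((toC y 0 0 * conjc (toC y 0 0) + toC y 0 1 * conjc (toC y 0 1)) /
    (normsq y)%:C ^+ 2); first by field.
by rewrite -normsqE; field.
Qed.

Lemma conj_dz m (j : 'I_m) : conj_form (dz R j) = row_mx (delta_mx 0 j) (- 'i%C *: delta_mx 0 j).
Proof.
rewrite /conj_form /dz map_row_mx; congr row_mx; apply/rowP => k; rewrite !mxE.
  by case: (_ && _); rewrite ?rmorph1 ?rmorph0.
by case: (_ && _); rewrite ?mulr1 ?mulr0 ?rmorph0//; apply/eqP; rewrite eq_complex /= oppr0 !eqxx.
Qed.

Lemma wedge_row m (a b c d : 'rV[R[i]]_m) :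
  wedge (row_mx a b) (row_mx c d) =
  block_mx (wedge a c) (a^T *m d - c^T *m b) (b^T *m c - d^T *m a) (wedge b d).
Proof.
by rewrite /wedge !tr_row_mx !mul_col_row opp_block_mx add_block_mx.
Qed.

Lemma wedge_delta m (s t : R[i]) (j k : 'I_m) :
  wedge (row_mx (delta_mx 0 j) (s *: delta_mx 0 j))
        (row_mx (delta_mx 0 k) (t *: delta_mx 0 k)) =
  block_mx (delta_mx j k - delta_mx k j) (t *: delta_mx j k - s *: delta_mx k j)
    (s *: delta_mx j k - t *: delta_mx k j) ((s * t) *: (delta_mx j k - delta_mx k j)).
Proof.
have TE (p q : 'I_m) : (delta_mx 0 p : 'rV[R[i]]_m)^T *m delta_mx 0 q = delta_mx p q.
  by rewrite trmx_delta mul_delta_mx.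
have TZ c (p : 'I_m) : (c *: delta_mx 0 p : 'rV[R[i]]_m)^T = c *: (delta_mx 0 p)^T.
  exact: linearZ.
rewrite wedge_row /wedge !TZ; congr block_mx; first by rewrite !TE.
- by rewrite -!scalemxAr !TE.
- by rewrite -!scalemxAl !TE.
- by rewrite -!scalemxAl -!scalemxAr !TE !scalerA (mulrC t s) scalerBr.
Qed.

Lemma complexify_diag2 (a b : R) : complexify (diag2 (2 * a) (2 * b)) =
  (2 * a%:C) *: delta_mx 0 0 + (2 * b%:C) *: delta_mx 1 1.
Proof.
apply/matrixP; apply: ord2P; apply: ord2P; rewrite !mxE /= ?mulr1n ?mulr0n ?mulr1 ?mulr0 ?addr0 ?add0r.
all: by rewrite ?rmorph0 ?rmorphM ?rmorph_nat.
Qed.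

Lemma complexify_skew2 : complexify E2 = delta_mx 0 1 - delta_mx 1 0.
Proof.
have m12 : (1 %% 2 = 1)%N by [].
apply/matrixP; apply: ord2P; apply: ord2P; rewrite !mxE /= ?m12 ?subr0 ?subrr ?sub0r ?oppr0 ?rmorph0//.
by rewrite rmorphN1.
Qed.

Lemma conj_dz_wedge m (j k : 'I_m) : wedge (dz R j) (conj_form (dz R k)) =
  block_mx (delta_mx j k - delta_mx k j) (- 'i%C *: delta_mx j k - 'i%C *: delta_mx k j)
    ('i%C *: delta_mx j k - - 'i%C *: delta_mx k j)
    (('i%C * - 'i%C) *: (delta_mx j k - delta_mx k j)).
Proof. by rewrite conj_dz wedge_delta. Qed.

Lemma conj_dz_wedge_conj m (j k : 'I_m) : wedge (conj_form (dz R j)) (conj_form (dz R k)) =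
  block_mx (delta_mx j k - delta_mx k j) (- 'i%C *: delta_mx j k - - 'i%C *: delta_mx k j)
    (- 'i%C *: delta_mx j k - - 'i%C *: delta_mx k j)
    ((- 'i%C * - 'i%C) *: (delta_mx j k - delta_mx k j)).
Proof. by rewrite !conj_dz wedge_delta. Qed.

Lemma hermitian_std (h11 h22 : R) :
  'i%C *: (h11%:C *: wedge (dz R 0) (conj_form (dz R 0))
         + h22%:C *: wedge (dz R 1) (conj_form (dz R 1))) =
  complexify (I4 *m metric_std h11 h22).
Proof.
rewrite F_stdE complexify_block complexifyN complexify0 complexify_diag2.
rewrite !conj_dz_wedge; have := sqr_im R; move: 'i%C => I I2; exact: hermitian_blocks.
Qed.

Lemma beta2_std (h11 h22 h12 lam : R) :
  h11%:C *: wedge (dz R 0) (conj_form (dz R 0))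
  + h12%:C *: wedge (dz R 0) (conj_form (dz R 1))
  + (- h12)%:C *: wedge (dz R 1) (conj_form (dz R 0))
  + h22%:C *: wedge (dz R 1) (conj_form (dz R 1))
  + lam%:C *: (wedge (dz R 0) (dz R 1) + wedge (conj_form (dz R 0)) (conj_form (dz R 1))) =
  complexify (B_std h12 lam) - 'i%C *: complexify (I4 *m metric_std h11 h22).
Proof.
have -> : complexify (B_std h12 lam) =
    block_mx ((2 * (h12%:C + lam%:C)) *: (delta_mx 0 1 - delta_mx 1 0)) 0 0
      ((2 * (h12%:C - lam%:C)) *: (delta_mx 0 1 - delta_mx 1 0)).
  rewrite /B_std complexify_block !complexifyZ complexify_skew2 complexify0.
  by rewrite -!rmorphN/= -!rmorphD/= !rmorphM/= !rmorph_nat.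
rewrite F_stdE complexify_block complexifyN complexify0 complexify_diag2 rmorphN/=.
have := @conj_dz_wedge 2 0 0; have := @conj_dz_wedge 2 0 1.
have := @conj_dz_wedge 2 1 0; have := @conj_dz_wedge 2 1 1.
have := @conj_dz_wedge_conj 2 0 1.
have := wedge_delta 'i%C 'i%C (0 : 'I_2) 1 : wedge (dz R 0) (dz R 1) = _.
generalize (wedge (@dz R 2 0) (@dz R 2 1)) (wedge (@dz R 2 0) (conj_form (@dz R 2 0)))
  (wedge (@dz R 2 0) (conj_form (@dz R 2 1))) (wedge (@dz R 2 1) (conj_form (@dz R 2 0)))
  (wedge (@dz R 2 1) (conj_form (@dz R 2 1))) (wedge (conj_form (@dz R 2 0)) (conj_form (@dz R 2 1))).
move=> w1 w2 w3 w4 w5 w6 -> -> -> -> -> ->.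
by have := sqr_im R; move: 'i%C => I I2; exact: beta2_blocks.
Qed.

Lemma scale_conjmx m (c : R[i]) (P M Q : 'M[R[i]]_m) :
  c *: (P *m M *m Q) = P *m (c *: M) *m Q.
Proof. by rewrite -scalemxAr -scalemxAl. Qed.

Lemma wedge_sum_push m (a b a' b' : 'rV[R[i]]_m) (E : 'M[R[i]]_m) (p q r s t : R[i]) :
  let u c := c *m E^T in
  p *: wedge (u a) (u a') + q *: wedge (u a) (u b') + r *: wedge (u b) (u a')
  + s *: wedge (u b) (u b') + t *: (wedge (u a) (u b) + wedge (u a') (u b')) =
  E *m (p *: wedge a a' + q *: wedge a b' + r *: wedge b a'
        + s *: wedge b b' + t *: (wedge a b + wedge a' b')) *m E^T.
Proof.
rewrite /= !wedge_push; move: (wedge _ _) (wedge _ _) (wedge _ _) (wedge _ _) (wedge _ _) (wedge _ _).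
move=> w1 w2 w3 w4 w5 w6.
by rewrite -mulmxDl -mulmxDr !scale_conjmx -!mulmxDl -!mulmxDr.
Qed.

Lemma hermitian_frame H22 y :
  hermitian_form H22 y = complexify (realify (frame y)) *m
    complexify (I4 *m metric_std (H11 H22 (rnorm y)) (H22 (rnorm y))) *m
    (complexify (realify (frame y)))^T.
Proof.
rewrite -hermitian_std /hermitian_form.
have := v1_frame y; have := v2_frame y; move: (v1 y) (v2 y) => a' b' -> ->.
have := @conj_form_real 2 (dz R 0) (realify (frame y)).
have := @conj_form_real 2 (dz R 1) (realify (frame y)).
generalize (@dz R 2 0) (@dz R 2 1) (complexify (realify (frame y))) => a b E -> ->.
by rewrite !wedge_push !scale_conjmx -mulmxDl -mulmxDr scale_conjmx.
Qed.

Lemma beta2_frame H22 y :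
  beta2 H22 y = complexify (realify (frame y)) *m
    (complexify (B_std (H12 H22 (rnorm y)) (lambda H22 (rnorm y)))
     - 'i%C *: complexify (I4 *m metric_std (H11 H22 (rnorm y)) (H22 (rnorm y)))) *m
    (complexify (realify (frame y)))^T.
Proof.
rewrite -beta2_std /beta2 /H21.
have := v1_frame y; have := v2_frame y; move: (v1 y) (v2 y) => a' b' -> ->.
have := @conj_form_real 2 (dz R 0) (realify (frame y)).
have := @conj_form_real 2 (dz R 1) (realify (frame y)).
generalize (@dz R 2 0) (@dz R 2 1) (complexify (realify (frame y))) => a b E -> ->.
exact: wedge_sum_push.
Qed.

End InvariantFrame.

(** * The radial functions L, lambda and H12 *)

Section RadialPotential.
Variable R : realType.
Implicit Types (H : R -> R) (r h dh : R).

Definition root_factor r h : R := Num.sqrt (1 + 4 * h ^+ 2 / r ^+ 4).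

(** The derivative of L at r, when H22 and its derivative take the values h and dh there. *)
Definition dL_of r h dh : R := r ^+ 3 / 2 * (1 - root_factor r h)
  - (h * dh - 2 * h ^+ 2 / r) / (2 * root_factor r h).

Lemma root_factor_arg_gt0 r h : 0 < 1 + 4 * h ^+ 2 / r ^+ 4.
Proof.
by rewrite ltr_pwDl// divr_ge0 ?exprn_even_ge0// mulr_ge0// sqr_ge0.
Qed.

Lemma root_factor_gt0 r h : 0 < root_factor r h.
Proof. by rewrite sqrtr_gt0 root_factor_arg_gt0. Qed.

Lemma root_factor_sq r h : root_factor r h ^+ 2 = 1 + 4 * h ^+ 2 / r ^+ 4.
Proof. exact/sqr_sqrtr/ltW/root_factor_arg_gt0. Qed.

Lemma is_derive_L_of H r dh : 0 < r -> is_derive r 1 H dh ->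
  is_derive r 1 (L_of H) (dL_of r (H r) dh).
Proof.
move=> r0 dH; have rn0 : r != 0 by rewrite gt_eqF.
have dI : is_derive r 1 (fun x : R => (x ^+ 4)^-1) (- (4 * r ^+ 3 / r ^+ 8)).
  have d4 : is_derive r 1 (fun x : R => x ^+ 4) (4 * r ^+ 3).
    by apply: is_derive_eq; rewrite /GRing.scale/= mulr1; ring.
  have [d1 d2] := d4; apply: DeriveDef; first by apply: derivableV; rewrite ?expf_neq0.
  rewrite deriveV ?expf_neq0// d2 /GRing.scale/=.
  by field.
have dS : is_derive r 1 (fun x : R => root_factor x (H x))
    ((8 * H r * dh / r ^+ 4 - 16 * H r ^+ 2 / r ^+ 5) / (2 * root_factor r (H r))).
  apply: is_derive_sqrt; first exact: root_factor_arg_gt0.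
  apply: is_derive_eq; rewrite /GRing.scale/=; field.
  by [].
have kn0 : root_factor r (H r) != 0 by rewrite gt_eqF// root_factor_gt0.
apply: is_derive_eq; rewrite /GRing.scale/= /dL_of.
rewrite -[Num.sqrt _]/(root_factor r (H r)); move: (root_factor _ _) kn0 => k kn0.
by field; rewrite rn0 kn0.
Qed.

Lemma L_of_quartic H r : 0 < r ->
  L_of H r / r ^+ 4 = (1 - Num.sqrt (1 + 4 * (H r / r ^+ 2) ^+ 2)) / 8.
Proof.
move=> r0; rewrite /L_of; have rn0 : r != 0 by rewrite gt_eqF.
rewrite (_ : 4 * (H r / r ^+ 2) ^+ 2 = 4 * H r ^+ 2 / r ^+ 4); last by field.
by move: (Num.sqrt _) => s; field.
Qed.

Section Identities.
Variables (r h dh : R).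
Hypotheses (r_gt0 : 0 < r) (h_gt0 : 0 < h).
Let k := root_factor r h.
Let L : R := r ^+ 4 / 8 * (1 - k).
Let h11 : R := 2^-1 * r * dh.
Let lam : R := dL_of r h dh / r.
Let h12 : R := (r * dL_of r h dh - 4 * L) / r ^+ 2.

Let r0 : r != 0. Proof. by rewrite gt_eqF. Qed.

Let k0 : k != 0. Proof. by rewrite gt_eqF// root_factor_gt0. Qed.

Let h2 : h ^+ 2 = r ^+ 4 / 4 * (k ^+ 2 - 1).
Proof. by rewrite root_factor_sq; field. Qed.

Let h12E : h12 = (h ^+ 2 - h * h11) / (k * r ^+ 2).
Proof. by rewrite /h12 /dL_of -/k /L /h11; field; rewrite r0 k0. Qed.

Let lamE : lam = r ^+ 2 / 2 * (1 - k) + h12.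
Proof. by rewrite h12E /lam /dL_of -/k /h11; field; rewrite r0 k0. Qed.

(** This is (beta_1 - beta_2)^2 = 0 written in the frame. Substituting lambda = c + H12 cancels
    H12^2, and h^2 is then eliminated in favour of the root k. *)
Lemma lambda_ode :
  lam + (r ^+ 2)^-1 * (h12 ^+ 2 - lam ^+ 2 + h11 * h) = 0.
Proof.
rewrite lamE; set c := r ^+ 2 / 2 * (1 - k).
have -> : c + h12 + (r ^+ 2)^-1 * (h12 ^+ 2 - (c + h12) ^+ 2 + h11 * h) =
    (c * (r ^+ 2 - c) + h12 * (r ^+ 2 * k) + h11 * h) / r ^+ 2.
  by rewrite /c; field.
have -> : h12 * (r ^+ 2 * k) = h ^+ 2 - h * h11 by rewrite h12E; field; rewrite r0 k0.
by rewrite h2 /c; field.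
Qed.

Lemma lambda_le0 : 0 <= h11 -> lam <= 0.
Proof.
move=> h11_ge0; have k1 : 1 <= k.
  rewrite -[1]sqrtr1 ler_wsqrtr// lerDl divr_ge0 ?exprn_even_ge0//.
  by rewrite mulr_ge0// sqr_ge0.
(* Once h^2 is expressed through k, the terms without h11 form a perfect square. *)
have -> : lam = - (r ^+ 2 * (k - 1) ^+ 2 / (4 * k) + h * h11 / (k * r ^+ 2)).
  by rewrite lamE h12E h2; field; rewrite r0 k0.
have k_ge0 : 0 <= k by exact: le_trans k1.
rewrite oppr_le0; apply: addr_ge0; apply: divr_ge0; apply: mulr_ge0 => //; try exact: sqr_ge0.
exact: ltW.
Qed.

(** Both equations say lambda = H12 + 4 L / r^2. Their right-hand sides are the coefficients that
    the exterior derivative of the potential produces. *)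
Lemma lambda_L : 2 * (h12 + lam) = 4 * h12 + 8 * (L / r ^+ 2) /\
  2 * (h12 - lam) = - (8 * (L / r ^+ 2)).
Proof. by split; rewrite lamE /L; field. Qed.

End Identities.

Lemma is_derive_quartic H r dh : 0 < r -> is_derive r 1 H dh ->
  is_derive r 1 (fun x => L_of H x / x ^+ 4)
    ((r * dL_of r (H r) dh - 4 * L_of H r) / r ^+ 5).
Proof.
move=> r0 dH; have rn0 : r != 0 by rewrite gt_eqF.
have dL := is_derive_L_of r0 dH.
have dI : is_derive r 1 (fun x : R => (x ^+ 4)^-1) (- (4 * r ^+ 3 / r ^+ 8)).
  have d4 : is_derive r 1 (fun x : R => x ^+ 4) (4 * r ^+ 3).
    by apply: is_derive_eq; rewrite /GRing.scale/= mulr1; ring.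
  have [d1 d2] := d4; apply: DeriveDef; first by apply: derivableV; rewrite ?expf_neq0.
  by rewrite deriveV ?expf_neq0// d2 /GRing.scale/=; field.
by apply: is_derive_eq; rewrite /GRing.scale/=; field.
Qed.

End RadialPotential.

(** * Exterior derivatives of real 1-forms *)

Section ExteriorDerivative.
Variables (R : realType) (n : nat).
Local Notation V := ('rV[R]_n).
Local Notation e := (fun i => delta_mx 0 i : V).
Implicit Types (A : V -> V) (x : V).

Definition dform A x : 'M[R]_n :=
  \matrix_(i, j) ('D_(delta_mx 0 i) (fun y => A y 0 j) x
                  - 'D_(delta_mx 0 j) (fun y => A y 0 i) x).

Lemma smooth_dform A : (forall j, smooth_on setT (fun y => A y 0 j)) ->
  smooth_on setT (dform A).
Proof.
move=> sA; apply/smooth_mxP => i j.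
rewrite (_ : (fun x => dform A x i j) = fun x => 'D_(delta_mx 0 i) (fun y => A y 0 j) x
    - 'D_(delta_mx 0 j) (fun y => A y 0 i) x); last by apply/funext => x; rewrite mxE.
by apply: smooth_onTB; exact: smooth_onT_derive.
Qed.

Lemma trmx_dform A x : (dform A x)^T = - dform A x.
Proof. by apply/matrixP => i j; rewrite !mxE opprB. Qed.

Lemma dform_near A A' x : (\near x, A x = A' x) -> dform A x = dform A' x.
Proof.
move=> AA; apply/matrixP => i j; rewrite !mxE; congr (_ - _);
  by apply: near_eq_derive; apply: filterS AA => y ->.
Qed.

(** The Leibniz rule for d (c Re t): g is dc, and T holds the derivatives of t, so that T - T^T is
    dt. *)
Lemma dform_real_part A x (c : V -> R) (g : V) (t : V -> 'rV[R[i]]_n) (T : 'M[R[i]]_n) :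
  (\near x, A x = c x *: map_mx (@complex.Re R) (t x)) ->
  (forall i, is_derive x (delta_mx 0 i : V) c (g 0 i)) ->
  (forall i j, is_cderive x (delta_mx 0 i : V) (fun y => t y 0 j) (T i j)) ->
  let a := map_mx (@complex.Re R) (t x) in
  dform A x = g^T *m a - a^T *m g + c x *: map_mx (@complex.Re R) (T - T^T).
Proof.
move=> AE dc dt a; rewrite (dform_near AE); apply/matrixP => i j.
have D p q : 'D_(delta_mx 0 p) (fun y => (c y *: map_mx (@complex.Re R) (t y)) 0 q) x =
    g 0 p * complex.Re (t x 0 q) + c x * complex.Re (T p q).
  rewrite (_ : (fun y => _) = fun y => c y * complex.Re (t y 0 q)); last first.
    by apply/funext => y; rewrite !mxE.
  have [d1 _] := dt p q; have d2 := dc p.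
  have : is_derive x (delta_mx 0 p : V) (fun y => c y * complex.Re (t y 0 q))
     (g 0 p * complex.Re (t x 0 q) + c x * complex.Re (T p q)).
    by apply: is_derive_eq; rewrite /GRing.scale/=; ring.
  by move=> d; exact: derive_val.
rewrite mxE !D !mxE !big_ord1 !mxE raddfB/=; ring.
Qed.

End ExteriorDerivative.

Lemma dform_closed (R : realType) m (A : 'rV[R]_(m + m) -> 'rV[R]_(m + m)) :
  (forall j, smooth_on setT (fun y => A y 0 j)) -> closed2_on setT (dform A).
Proof.
move=> sA x _ i j k.
have D p q s : 'D_(delta_mx 0 p) (fun y => dform A y q s) x =
    'D_(delta_mx 0 p) ('D_(delta_mx 0 q) (fun z => A z 0 s)) x -
    'D_(delta_mx 0 p) ('D_(delta_mx 0 s) (fun z => A z 0 q)) x.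
  rewrite (_ : (fun y => _) = 'D_(delta_mx 0 q) (fun z => A z 0 s)
    - 'D_(delta_mx 0 s) (fun z => A z 0 q)); last first.
    by apply/funext => y; rewrite mxE.
  by apply: deriveB; apply: smooth_onT_derivable; exact: smooth_onT_derive.
rewrite !D (derive_swap _ (delta_mx 0 j) (delta_mx 0 i) (sA k)).
rewrite (derive_swap _ (delta_mx 0 k) (delta_mx 0 i) (sA j)).
rewrite (derive_swap _ (delta_mx 0 k) (delta_mx 0 j) (sA i)).
move: ('D_(delta_mx 0 i) ('D_(delta_mx 0 j) _) x) => a.
move: ('D_(delta_mx 0 i) ('D_(delta_mx 0 k) _) x) => b.
move: ('D_(delta_mx 0 j) ('D_(delta_mx 0 k) _) x) => c.
by suff H : forall a b c : R, a - b + (c - a) + (b - c) = 0 by []; move=> *; ring.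
Qed.

Lemma wedge_combination (C : comNzRingType) m (a b : 'rV[C]_m) p q r s :
  (p *: a + r *: b)^T *m (q *: a + s *: b) - (q *: a + s *: b)^T *m (p *: a + r *: b) =
  (p * s - q * r) *: (a^T *m b - b^T *m a).
Proof.
have TD (u v : C) : (u *: a + v *: b)^T = u *: a^T + v *: b^T by rewrite linearD/= !linearZ.
rewrite !TD !mulmxDl !mulmxDr -!scalemxAl -!scalemxAr.
move: (a^T *m a) (a^T *m b) (b^T *m a) (b^T *m b) => ? ? ? ?.
by mx_ring.
Qed.

Section ComplexAreaForm.
Variable R : realType.
Local Notation Re := (@complex.Re R).

Lemma beta1_push (M : 'M[R[i]]_2) :
  complexify (realify M) *m beta1 R *m (complexify (realify M))^T = \det M *: beta1 R.
Proof.
rewrite /beta1 -wedge_push !dz_realify !sum2 det2 /wedge.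
rewrite wedge_combination; congr (_ *: _); ring.
Qed.

Lemma map_Re_complexify p q r s (P : 'M[R]_(p, q)) (M : 'M[R[i]]_(q, r)) (Q : 'M[R]_(s, r)) :
  map_mx Re (complexify P *m M *m (complexify Q)^T) = P *m map_mx Re M *m Q^T.
Proof.
rewrite trmx_complexify !map_Re_mul.
have ReK u v (N : 'M[R]_(u, v)) : map_mx Re (complexify N) = N.
  by apply/matrixP => i j; rewrite !mxE.
have ImK u v (N : 'M[R]_(u, v)) : map_mx (@complex.Im R) (complexify N) = 0.
  by apply/matrixP => i j; rewrite !mxE.
by rewrite !ReK !ImK mul0mx mulmx0 !subr0.
Qed.

Lemma map_ReZ p q (c : R) (M : 'M[R[i]]_(p, q)) : map_mx Re (c%:C *: M) = c *: map_mx Re M.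
Proof. by apply/matrixP => i j; rewrite !mxE Re_mulc /= mul0r subr0. Qed.

Lemma map_Re_beta1 : map_mx Re (beta1 R) = block_mx (skew2 R) 0 0 (- skew2 R).
Proof.
rewrite beta1E map_block_mx; congr block_mx; apply/matrixP => i j; rewrite !mxE /=.
- by [].
- by rewrite !mul0r mulr0 subr0.
- by rewrite !mul0r mulr0 subr0.
- by [].
Qed.

End ComplexAreaForm.

(** * The potential of B in chart 0 *)

Section RadialDerivative.
Variables (R : realType) (H22 : R -> R).
Local Notation V := ('rV[R]_(2 + 2)).

Definition ell (y : V) : R := L_of H22 (rnorm y) / rnorm y ^+ 4.

Hypothesis H22_derivable : forall r : R, 0 < r -> derivable H22 r 1.

Lemma is_derive_H22 (r : R) : 0 < r -> is_derive r 1 H22 (derive1 H22 r).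
Proof. by move=> r0; rewrite derive1E; exact/derivableP/H22_derivable. Qed.

Lemma derive1_L_of (r : R) : 0 < r ->
  derive1 (L_of H22) r = dL_of r (H22 r) (derive1 H22 r).
Proof.
move=> r0; rewrite derive1E.
exact: (derive_val (is_derive := is_derive_L_of r0 (is_derive_H22 r0))).
Qed.

Lemma H12_lambda_L (r : R) : 0 < r ->
  2 * (H12 H22 r + lambda H22 r) = 4 * H12 H22 r + 8 * (L_of H22 r / r ^+ 2) /\
  2 * (H12 H22 r - lambda H22 r) = - (8 * (L_of H22 r / r ^+ 2)).
Proof. by move=> r0; rewrite /H12 /lambda derive1_L_of//; exact: lambda_L. Qed.

Lemma H_ode (r : R) : 0 < r -> lambda H22 r + (r ^+ 2)^-1 *
  (H12 H22 r ^+ 2 - lambda H22 r ^+ 2 + H11 H22 r * H22 r) = 0.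
Proof. by move=> r0; rewrite /H12 /lambda derive1_L_of//; exact: lambda_ode. Qed.

Lemma H_lambda_le0 (r : R) : 0 < r -> 0 < H22 r -> 0 <= H11 H22 r -> lambda H22 r <= 0.
Proof. by move=> r0 h0 h1; rewrite /lambda derive1_L_of//; exact: lambda_le0. Qed.

Lemma is_derive_rnorm (W : normedModType R) (phi : W -> V) x v (w : V) :
  (forall i, is_derive x v (fun y => phi y 0 i) (w 0 i)) -> phi x != 0 ->
  is_derive x v (fun y => rnorm (phi y)) ((w *m (phi x)^T) 0 0 / rnorm (phi x)).
Proof.
move=> dphi phi0.
have pos : 0 < \sum_i phi x 0 i ^+ 2.
  have := rnorm_gt0 phi0; rewrite -(pmulr_rgt0 _ (rnorm_gt0 phi0)).
  by rewrite -expr2 rnorm_sq.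
have dsum : is_derive x v (fun y => \sum_i phi y 0 i ^+ 2) (2 * (w *m (phi x)^T) 0 0).
  have -> : (fun y => \sum_i phi y 0 i ^+ 2) = \sum_(i < 2 + 2) (fun y => phi y 0 i ^+ 2).
    by apply/funext => y; rewrite fct_sumE.
  rewrite mxE mulr_sumr.
  apply: is_derive_sum => i.
  by apply: is_derive_eq; rewrite /GRing.scale/= !mxE; ring.
apply: is_derive_eq; first exact: (is_derive_sqrt pos dsum).
rewrite -/(rnorm (phi x)); have := rnorm_gt0 phi0; move: (rnorm _) => r r0.
by field; rewrite gt_eqF.
Qed.

(** The inner map phi is the identity in chart 0 and the transition to chart 0 in the charts at
    infinity. *)
Lemma is_derive_ell (W : normedModType R) (phi : W -> V) x v (w : V) :
  (forall i, is_derive x v (fun y => phi y 0 i) (w 0 i)) -> phi x != 0 ->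
  let r := rnorm (phi x) in
  is_derive x v (fun y => ell (phi y)) (H12 H22 r / r ^+ 4 * (w *m (phi x)^T) 0 0).
Proof.
move=> dphi phi0 r; have r0 : 0 < r by exact: rnorm_gt0.
have dr := is_derive_rnorm dphi phi0.
have dq := is_derive_quartic r0 (is_derive_H22 r0).
have := @is_derive_comp1 R W (fun x => L_of H22 x / x ^+ 4) (fun y => rnorm (phi y)) x v _ _ dq dr.
rewrite -derive1_L_of// => d.
suff -> : H12 H22 r / r ^+ 4 * (w *m (phi x)^T) 0 0 =
    (w *m (phi x)^T) 0 0 / r * ((r * derive1 (L_of H22) r - 4 * L_of H22 r) / r ^+ 5).
  exact: d.
by rewrite /H12; field; rewrite gt_eqF.
Qed.

End RadialDerivative.

Section OriginChart.
Variables (R : realType) (H22 : R -> R).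
Local Notation V := ('rV[R]_(2 + 2)).
Local Notation Re := (@complex.Re R).
Hypothesis H22_derivable : forall r : R, 0 < r -> derivable H22 r 1.

(** This is r^2 v_2, and its exterior derivative is 2 beta_1. *)
Definition theta0 (y : V) : 'rV[R[i]]_(2 + 2) := toC y 0 0 *: dz R 1 - toC y 0 1 *: dz R 0.

Lemma theta0E y j : theta0 y 0 j = toC y 0 0 * dz R 1 0 j - toC y 0 1 * dz R 0 0 j.
Proof.
by rewrite /theta0; generalize (@dz R 2 0) (@dz R 2 1) => a b; rewrite mx_addE mx_oppE !mx_scaleE.
Qed.

Lemma is_cderive_theta0 y v j : is_cderive y v (fun x => theta0 x 0 j)
  (toC v 0 0 * dz R 1 0 j - toC v 0 1 * dz R 0 0 j).
Proof.
rewrite (_ : (fun x => _) = fun x => toC x 0 0 * dz R 1 0 j - toC x 0 1 * dz R 0 0 j); last first.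
  by apply/funext => x; rewrite theta0E.
apply: is_cderiveB; apply: is_cderive_eq.
- by apply: is_cderiveM; [exact: is_cderive_toC|exact: is_cderive_cst].
- by rewrite mulr0 addr0.
- by apply: is_cderiveM; [exact: is_cderive_toC|exact: is_cderive_cst].
- by rewrite mulr0 addr0.
Qed.

Definition rowRe (j : 'I_2) : V := row_mx (delta_mx 0 j) 0.

Lemma map_Re_dz (j : 'I_2) : map_mx Re (dz R j) = rowRe j.
Proof.
rewrite /dz map_row_mx; congr row_mx; apply/rowP => k; rewrite !mxE.
  by case: (_ && _).
by case: (_ && _); rewrite ?mulr1 ?mulr0.
Qed.

Lemma map_Re_row (a : 'rV[R[i]]_(2 + 2)) (Q : 'M[R]_(2 + 2)) :
  map_mx Re (a *m (complexify Q)^T) = map_mx Re a *m Q^T.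
Proof.
have := map_Re_complexify 1%:M a Q.
by rewrite /complexify map_mx1 !mul1mx.
Qed.

Lemma theta0_frame (y : V) : y != 0 ->
  map_mx Re (theta0 y) = normsq y *: (rowRe 1 *m (realify (frame y))^T).
Proof.
rewrite -normsq_eq0 => y0; rewrite -map_Re_dz -map_Re_row -v2_frame.
have -> : theta0 y = (normsq y)%:C *: v2 y.
  by rewrite /v2 rnorm_sq scalerA divff ?scale1r// fmorph_eq0.
exact: map_ReZ.
Qed.

(** r^2 Re v_1 = r dr, whose components are the coordinates of y. *)
Lemma radial_frame (y : V) : y != 0 -> y = normsq y *: (rowRe 0 *m (realify (frame y))^T).
Proof.
rewrite -normsq_eq0 => y0; rewrite -map_Re_dz -map_Re_row -v1_frame.
have := map_ReZ (normsq y) (v1 y); rewrite {1}/v1 rnorm_sq scalerA divff ?scale1r ?fmorph_eq0//.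
move=> <-; have E (a b : 'rV[R[i]]_(2 + 2)) c d l : (c *: a + d *: b) 0 l = c * a 0 l + d * b 0 l.
  by rewrite mx_addE !mx_scaleE.
apply/rowP => j; rewrite [RHS]mxE E -(splitK j).
case: (fintype.split j) => {}j /=.
  rewrite /dz !row_mxEl !mxE /=.
  by move: j; apply: ord2P; rewrite /=; ring.
rewrite /dz !row_mxEr !mxE /=.
by move: j; apply: ord2P; rewrite /=; ring.
Qed.

Lemma rowRe_wedge :
  (rowRe 0)^T *m rowRe 1 - (rowRe 1)^T *m rowRe 0 = block_mx (skew2 R) 0 0 0 :> 'M[R]_(2 + 2).
Proof.
rewrite /rowRe !tr_row_mx !mul_col_row !trmx0 !mul0mx !mulmx0 opp_block_mx add_block_mx.
rewrite !trmx_delta !mul_delta_mx !subr0; congr block_mx.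
have m12 : (1 %% 2 = 1)%N by [].
apply/matrixP; apply: ord2P; apply: ord2P; rewrite !mxE /= ?m12; ring.
Qed.

Lemma wedge_scale_push n (p q : 'rV[R]_n) (E : 'M[R]_n) c d :
  (c *: (p *m E^T))^T *m (d *: (q *m E^T)) - (d *: (q *m E^T))^T *m (c *: (p *m E^T)) =
  (c * d) *: (E *m (p^T *m q - q^T *m p) *m E^T).
Proof.
have TZ k (u : 'rV[R]_n) : (k *: (u *m E^T))^T = k *: (E *m u^T).
  by rewrite linearZ/= trmx_mul trmxK.
rewrite !TZ -!scalemxAl -!scalemxAr !scalerA (mulrC d) -scalerBr.
by rewrite mulmxBr mulmxBl !mulmxA.
Qed.

Definition grad_ell y : V := (H12 H22 (rnorm y) / rnorm y ^+ 4) *: y.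

(** The expansion of d (4 ell Re theta0), off the origin, with [grad_ell] for d ell and 2 beta_1 for
    d theta0. *)
Definition B_field y : 'M[R]_(2 + 2) :=
  let a := map_mx Re (theta0 y) in
  4 *: ((grad_ell y)^T *m a - a^T *m grad_ell y) + (8 * ell H22 y) *: map_mx Re (beta1 R).

Lemma B_field_frame (y : V) : y != 0 -> B_field y = realify (frame y) *m
  B_std (H12 H22 (rnorm y)) (lambda H22 (rnorm y)) *m (realify (frame y))^T.
Proof.
move=> y0; have r0 := rnorm_gt0 y0; set r := rnorm y in r0 *.
have rr : normsq y = r ^+ 2 by rewrite /r rnorm_sq.
have rn0 : r != 0 by rewrite gt_eqF.
have [e1 e2] := H12_lambda_L H22_derivable r0.
set E := realify (frame y).
have bE : map_mx Re (beta1 R) = r ^+ 2 *: (E *m map_mx Re (beta1 R) *m E^T).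
  rewrite -map_Re_complexify beta1_push det_frame// rr.
  by rewrite map_ReZ scalerA divff ?scale1r// expf_neq0.
have gE : grad_ell y = (H12 H22 r / r ^+ 2) *: (rowRe 0 *m E^T).
  rewrite /grad_ell -/r {1}(radial_frame y0) rr -/E scalerA; congr (_ *: _); field.
  by [].
rewrite /B_field gE (theta0_frame y0) rr -/E /ell -/r bE wedge_scale_push rowRe_wedge.
rewrite map_Re_beta1 !scalerA /B_std e1 e2.
transitivity (E *m ((4 * H12 H22 r) *: block_mx (skew2 R) 0 0 0 +
   (8 * (L_of H22 r / r ^+ 2)) *: block_mx (skew2 R) 0 0 (- skew2 R)) *m E^T).
  rewrite mulmxDr mulmxDl -!scalemxAr -!scalemxAl; congr (_ *: _ + _ *: _); field.
    by [].
  by [].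
congr (_ *m _ *m _); rewrite !scale_block_mx add_block_mx !scaler0 !addr0 -scalerDl.
by rewrite add0r scalerN scaleNr.
Qed.

Lemma dform_origin (A : V -> V) (y : V) : y != 0 ->
  (\near y, A y = (4 * ell H22 y) *: map_mx Re (theta0 y)) -> dform A y = B_field y.
Proof.
move=> y0 AE.
have dl i : is_derive y (delta_mx 0 i : V) (fun x => 4 * ell H22 x) ((4 *: grad_ell y) 0 i).
  have d := is_derive_ell H22_derivable (is_derive_coord y (delta_mx 0 i)) y0.
  apply: is_derive_eq.
  by rewrite /grad_ell !mx_scaleE -rowE 2![in LHS]mxE.
rewrite (dform_real_part (T := (dz R 0)^T *m dz R 1 - (dz R 1)^T *m dz R 0) AE dl); last first.
  move=> i j; apply: is_cderive_eq; first exact: is_cderive_theta0.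
  by rewrite -!dzE; generalize (@dz R 2 0) (@dz R 2 1) => a b; rewrite mx_addE mx_oppE !mul_tr_row.
rewrite -/(wedge _ _) -/(beta1 R) trmx_beta1 opprK /B_field.
move: (map_mx Re (theta0 y)) (grad_ell y) => a g; rewrite map_mxD linearZ/=.
rewrite -scalemxAl -scalemxAr -scalerBr; congr (_ + _).
by move: (map_mx Re (beta1 R)) => b; mx_ring.
Qed.

End OriginChart.

(** * Squared moduli and diagonal entries of a Hermitian metric *)

Section SquaredModulus.
Variable R : realType.
Implicit Types z w : R[i].

Definition sqmod z : R := complex.Re z ^+ 2 + complex.Im z ^+ 2.

Lemma sqmodE z : (sqmod z)%:C = z * conjc z.
Proof. by case: z => a b; apply/eqP; rewrite eq_complex /sqmod /=; apply/andP; split; apply/eqP; ring. Qed.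

Lemma sqmodM z w : sqmod (z * w) = sqmod z * sqmod w.
Proof. by case: z w => a b [c d]; rewrite /sqmod /=; ring. Qed.

Lemma sqmodN z : sqmod (- z) = sqmod z.
Proof. by case: z => a b; rewrite /sqmod /=; ring. Qed.

Lemma sqmod_conj z : sqmod (conjc z) = sqmod z.
Proof. by case: z => a b; rewrite /sqmod /=; ring. Qed.

Lemma sqmod_real (a : R) : sqmod a%:C = a ^+ 2.
Proof. by rewrite /sqmod /= expr0n addr0. Qed.

Lemma sqmod0 : sqmod 0 = 0.
Proof. by rewrite /sqmod /= !expr0n addr0. Qed.

Lemma sqmod_ge0 z : 0 <= sqmod z.
Proof. by rewrite addr_ge0// sqr_ge0. Qed.

Lemma sqmod_gt0 z : z != 0 -> 0 < sqmod z.
Proof. by rewrite complex_neq0 => z0; rewrite lt_neqAle eq_sym z0 sqmod_ge0. Qed.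

Lemma sqmodV z : sqmod z^-1 = (sqmod z)^-1.
Proof.
have [->|z0] := eqVneq z 0; first by rewrite invr0 sqmod0 invr0.
have s0 : sqmod z != 0 by rewrite gt_eqF// sqmod_gt0.
by apply: (mulfI s0); rewrite -sqmodM !mulfV// -(rmorph1 (real_complex R)) sqmod_real expr1n.
Qed.

Lemma sqmod_sign n : sqmod ((-1) ^+ n) = 1.
Proof.
have s1 : sqmod 1 = 1 by rewrite -(rmorph1 (real_complex R)) sqmod_real expr1n.
by elim: n => [|n IH]; rewrite ?expr0// exprS sqmodM sqmodN IH s1 mulr1.
Qed.

Lemma normsq_sqmod (y : 'rV[R]_(2 + 2)) : normsq y = sqmod (toC y 0 0) + sqmod (toC y 0 1).
Proof.
have := normsqE y; rewrite -!sqmodE -rmorphD => /eqP.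
by rewrite eq_complex /= => /andP[/eqP].
Qed.

Lemma metric_diag (M : 'M[R[i]]_2) (h11 h22 : R) (i : 'I_2) :
  let g := realify M *m metric_std h11 h22 *m (realify M)^T in
  let c := 2 * h11 * sqmod (M i 0) + 2 * h22 * sqmod (M i 1) in
  g (lshift 2 i) (lshift 2 i) = c /\ g (rshift 2 i) (rshift 2 i) = c.
Proof.
rewrite /= /realify /metric_std tr_block_mx !mulmx_block !mulmx0 !addr0 !add0r.
rewrite block_mxEul block_mxEdr !mx_addE /sqmod.
split; rewrite !mxE !sum2 !mxE !sum2 !mxE /=; ring.
Qed.

End SquaredModulus.

(** * The potential of B in the charts at infinity *)

Section AffineCharts.
Variables (R : realType) (H22 : R -> R).
Local Notation V := ('rV[R]_(2 + 2)).
Local Notation Re := (@complex.Re R).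
Hypothesis H22_derivable : forall r : R, 0 < r -> derivable H22 r 1.
Variable k : 'I_3.
Hypothesis k0 : k != ord0.
Implicit Type x : V.
Local Notation tau := (@transition R 2 k ord0).

Lemma homog_chart x : homog k (toC x) 0 ord0 = toC x 0 0.
Proof. by rewrite homog3E; case: k k0 => [[|[|[|]]]]. Qed.

Lemma overlap_chart x : overlap k ord0 x = (toC x 0 0 != 0).
Proof. by rewrite /overlap homog_chart. Qed.

Lemma det_transition x : overlap k ord0 x ->
  \det (transition_mx k ord0 x) = (-1) ^+ k / toC x 0 0 ^+ 3.
Proof.
move=> ox; have := bivector_coef_transition ox; rewrite /bivector_coef homog_chart homog_diag.
rewrite expr1n mulr1 expr0 => e; move: ox; rewrite overlap_chart => w0.
have s2 : (-1) ^+ k * (-1) ^+ k = 1 :> R[i] by rewrite -exprD addnn -mul2n exprM sqrrN expr1n expr1n.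
have w3 : toC x 0 0 ^+ 3 != 0 by rewrite expf_neq0.
apply: (mulfI w3); rewrite mulrCA mulfV// mulr1 -[LHS]mul1r -{1}s2.
by rewrite -[LHS]mulrA [X in _ * X]mulrA e mulr1.
Qed.

(** The charts 1 and 2 differ by an exchange of columns and a sign; recording both here lets the
    later computations treat them alike. *)
Lemma transition_cases x (w1 := toC x 0 0) (w2 := toC x 0 1)
    (M := transition_mx k ord0 x) (h := homog k (toC x)) :
  w1 != 0 ->
  [/\ - (-1) ^+ k = 1 :> R[i], h 0 (lift ord0 0) = 1, h 0 (lift ord0 1) = w2 &
    [/\ M 0 0 = - (w1 ^+ 2)^-1, M 0 1 = - (w2 / w1 ^+ 2), M 1 0 = 0 & M 1 1 = w1^-1]] \/
  [/\ - (-1) ^+ k = - 1 :> R[i], h 0 (lift ord0 0) = w2, h 0 (lift ord0 1) = 1 &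
    [/\ M 0 0 = - (w2 / w1 ^+ 2), M 0 1 = - (w1 ^+ 2)^-1, M 1 0 = w1^-1 & M 1 1 = 0]].
Proof.
move=> w0; rewrite /M !transition_mxE homog_chart -/w1 -/h /h !homog3E -/w1 -/w2 -!val_eqE.
have m12 : (1 %% 2 = 1)%N by [].
case: (k) k0 => [[|[|[|//]]] Hk] // _; [left|right]; split;
  rewrite /= /bump /unbump /= ?m12 //= ?expr1 ?opprK//; try split; rewrite ?m12 /=; try ring.
Qed.

(** N expresses v_1, v_2 in the coordinates w_1, w_2 of the chart. The zero entry says that v_2 has
    no dw_1 component, which is what separates H22 from H11. *)
Lemma transition_frame x : overlap k ord0 x ->
  let y := tau x in let w1 := toC x 0 0 in let w2 := toC x 0 1 in
  let N := transition_mx k ord0 x *m frame y in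
  normsq y = (1 + sqmod w2) / sqmod w1 /\
  [/\ N 0 0 = - w1^-1, N 0 1 = 0, N 1 0 = conjc w2 / (1 + sqmod w2)%:C &
      N 1 1 = - (-1) ^+ k * conjc w1 / (w1 * (1 + sqmod w2)%:C)].
Proof.
rewrite overlap_chart => w0 y w1 w2 N.
have w10 : w1 != 0 by [].
have c0 : conjc w1 != 0 by rewrite fmorph_eq0.
have s1 : sqmod 1 = 1 :> R by rewrite -(rmorph1 (real_complex R)) sqmod_real expr1n.
have D0 : (1 + sqmod w2)%:C != 0 by rewrite fmorph_eq0 gt_eqF// ltr_pwDl// sqmod_ge0.
have tj (j : 'I_2) : toC y 0 j = homog k (toC x) 0 (lift ord0 j) / w1.
  by rewrite toC_transition homog_chart.
have nE : normsq y = (1 + sqmod w2) / sqmod w1.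
  rewrite normsq_sqmod !tj !sqmodM !sqmodV -mulrDl; congr (_ / _).
  by have [[_ -> -> _]|[_ -> -> _]] := transition_cases w0; rewrite s1// addrC.
split=> //; rewrite /N !mxE !sum2 ![frame y _ _]mxE /= nE fmorph_div/= !tj sqmodE rmorphD/= sqmodE.
move: D0; rewrite rmorphD/= rmorph1 sqmodE.
have cV z : conjc (z / w1) = conjc z / conjc w1 by rewrite fmorph_div.
have [[-> -> -> [-> -> -> ->]]|[-> -> -> [-> -> -> ->]]] := transition_cases w0;
  rewrite -/w1 -/w2 !cV ?conjc1; move: w10 c0;
  move: (conjc w1) (conjc w2) (w1) (w2) => a b c d c0 a0 D0; split; field; rewrite ?c0 ?a0 ?D0//.
Qed.

Lemma theta0_transition x : overlap k ord0 x ->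
  theta0 (tau x) *m (complexify (realify (transition_mx k ord0 x)))^T =
  (- (-1) ^+ k / toC x 0 0 ^+ 2) *: dz R 1.
Proof.
move=> ox; have := ox; rewrite overlap_chart => w0.
rewrite /theta0 mulmxBl -!scalemxAl !dz_realify !sum2; generalize (@dz R 2 0) (@dz R 2 1) => a b.
rewrite !toC_transition homog_chart.
apply/rowP => j; rewrite !(mx_addE, mx_oppE, mx_scaleE).
by have [[-> -> -> [-> -> -> ->]]|[-> -> -> [-> -> -> ->]]] := transition_cases w0; field.
Qed.

Lemma is_derive_transition x v i : overlap k ord0 x ->
  is_derive x v (fun y : V => tau y 0 i) ((v *m jacobian tau x) 0 i).
Proof.
move=> ox; rewrite jacobian_transition// mul_realify -(splitK i).
case: (fintype.split i) => j /=; have [h1 h2] := is_cderive_transition v j ox.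
  by rewrite -toC_re ofCK; under eq_fun do rewrite -toC_re.
by rewrite -toC_im ofCK; under eq_fun do rewrite -toC_im.
Qed.

(** Exterior differentiation commutes with pullback. The pulled-back form being explicit, the two
    terms of [B_field] are matched separately: the first by the chain rule for ell, the second by
    the holomorphic determinant acting on beta_1. *)
Lemma dform_chart (A : V -> V) x : overlap k ord0 x ->
  (\near x, A x = (4 * ell H22 (tau x)) *:
     map_mx Re ((- (-1) ^+ k / toC x 0 0 ^+ 2) *: dz R 1)) ->
  dform A x = jacobian tau x *m B_field H22 (tau x) *m (jacobian tau x)^T.
Proof.
move=> ox AE; have tx0 := transition_neq0 k0 ox.
set D := jacobian tau x; pose g : V := 4 *: (grad_ell H22 (tau x) *m D^T).
have dl i : is_derive x (delta_mx 0 i : V) (fun y => 4 * ell H22 (tau y)) (g 0 i).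
  have d := is_derive_ell H22_derivable (fun j => is_derive_transition (delta_mx 0 i) j ox) tx0.
  apply: is_derive_eq.
  rewrite /g /grad_ell -scalemxAl !mx_scaleE; congr (_ * (_ * _)).
  have -> : tau x *m D^T = (D *m (tau x)^T)^T by rewrite trmx_mul trmxK.
  by rewrite -mulmxA -rowE [LHS]mxE [RHS]mxE.
(* The derivative of - (-1)^k w_1^-2 dw_2, whose coefficient depends on w_1 only. *)
pose T : 'M[R[i]]_(2 + 2) := (2 * (-1) ^+ k / toC x 0 0 ^+ 3) *: ((dz R 0)^T *m dz R 1).
have w0 : toC x 0 0 != 0 by rewrite -overlap_chart.
rewrite (dform_real_part (T := T) AE dl); last first.
  move=> i j; rewrite (_ : (fun y => _) = fun y : V =>
    - (-1) ^+ k * dz R 1 0 j * (toC y 0 0 ^+ 2)^-1); last first.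
    by apply/funext => y; rewrite mx_scaleE mulrAC.
  apply: is_cderive_eq.
    apply: is_cderiveM; first exact: is_cderive_cst.
    apply: is_cderiveV; last exact: is_cderiveX (is_cderive_toC _ _ _).
    by rewrite expf_neq0.
  rewrite /T mx_scaleE mul_tr_row -dzE.
  move: (toC x 0 0) w0 (dz R 0 0 i) (dz R 1 0 j) ((-1) ^+ k) => w w0 a b s.
  by field.
have TE : T - T^T = (2 * \det (transition_mx k ord0 x)) *: beta1 R.
  rewrite /T det_transition// /beta1 /wedge linearZ/= trmx_mul trmxK -scalerBr.
  by rewrite mulrA.
have aE : map_mx Re ((- (-1) ^+ k / toC x 0 0 ^+ 2) *: dz R 1) =
    map_mx Re (theta0 (tau x)) *m D^T.
  by rewrite -map_Re_row -theta0_transition// /D jacobian_transition.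
have bE : map_mx Re ((2 * \det (transition_mx k ord0 x)) *: beta1 R) =
    2 *: (D *m map_mx Re (beta1 R) *m D^T).
  rewrite -scalerA -beta1_push -map_Re_complexify -jacobian_transition// -map_ReZ.
  by rewrite rmorph_nat.
rewrite TE aE bE /g /B_field.
move: (map_mx Re (theta0 (tau x))) (grad_ell _ _) (map_mx Re (beta1 R)) (ell _ _) => a g' b l.
have := wedge_scale_push g' a D 4 1; rewrite scale1r => ->.
move: (g'^T *m a - a^T *m g') => c.
rewrite mulr1 mulmxDr mulmxDl -!scalemxAr -!scalemxAl scalerA; congr (_ + _ *: _).
by ring.
Qed.

Section ChartForm.
Variable g : V -> 'M[R]_(2 + 2).

Definition chart_den x : R := 1 + sqmod (toC x 0 1).

(* The value of H22 at the point x, read off the metric of the chart. *)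
Definition chart_H x : R :=
  (chart_den x ^+ 2 * g x (lshift 2 1) (lshift 2 1)
   - sqmod (toC x 0 1) * sqmod (toC x 0 0) * g x (lshift 2 0) (lshift 2 0)) / 2.

Definition chart_root x : R :=
  Num.sqrt (1 + 4 * (chart_H x * sqmod (toC x 0 0) / chart_den x) ^+ 2).

(* L = (r^4 / 8) (1 - k) = - H22^2 / (2 (1 + k)) with k the square root: unlike
   r, this is regular on the line at infinity, where |w_1|^2 / chart_den = 1 / r^2
   vanishes. *)
Definition chart_L x : R := - chart_H x ^+ 2 / (2 * (1 + chart_root x)).

(** z_1 dz_2 - z_2 dz_1 pulls back to - (-1)^k w_1^-2 dw_2, with a double pole. The factor r^-4 =
    |w_1|^4 / [chart_den]^2 absorbs it and leaves conj(w_1)^2. *)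
Definition chart_form x : V := 4 *: map_mx Re
  (((chart_L x / chart_den x ^+ 2)%:C * (- (-1) ^+ k * conjc (toC x 0 0) ^+ 2)) *: dz R 1).

Lemma chart_den_gt0 x : 0 < chart_den x.
Proof. by rewrite ltr_pwDl// sqmod_ge0. Qed.

Lemma chart_root_arg_gt0 x : 0 < 1 + 4 * (chart_H x * sqmod (toC x 0 0) / chart_den x) ^+ 2.
Proof. by rewrite ltr_pwDl// mulr_ge0// sqr_ge0. Qed.

(** As v_2 has no dw_1 component, the first diagonal entry of g is 2 h11 / |w_1|^2. The second is 2
    (h11 |w_2|^2 + h22) / [chart_den]^2, and [chart_H] eliminates h11. *)
Lemma chart_HE x (h11 h22 : R) : overlap k ord0 x ->
  g x = realify (transition_mx k ord0 x) *m
    (realify (frame (tau x)) *m metric_std h11 h22 *m (realify (frame (tau x)))^T) *m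
    (realify (transition_mx k ord0 x))^T ->
  chart_H x = h22.
Proof.
move=> ox gE; have [nE [N00 N01 N10 N11]] := transition_frame ox.
have w0 : toC x 0 0 != 0 by rewrite -overlap_chart.
set N := transition_mx k ord0 x *m frame (tau x) in N00 N01 N10 N11.
have gE' : g x = realify N *m metric_std h11 h22 *m (realify N)^T.
  by rewrite gE realifyM trmx_mul !mulmxA.
have [d0 _] := metric_diag N h11 h22 0; have [d1 _] := metric_diag N h11 h22 1.
have D0 : chart_den x != 0 by rewrite gt_eqF// chart_den_gt0.
have s0 : sqmod (toC x 0 0) != 0 by rewrite gt_eqF// sqmod_gt0.
rewrite /chart_H gE' d0 d1 N00 N01 N10 N11.
rewrite !(sqmodM, sqmodN, sqmodV, sqmod_conj, sqmod_real, sqmod0, sqmod_sign) -/(chart_den x).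
by field; rewrite s0 D0.
Qed.

Lemma chart_formE x : overlap k ord0 x -> chart_H x = H22 (rnorm (tau x)) ->
  chart_form x = (4 * ell H22 (tau x)) *:
    map_mx Re ((- (-1) ^+ k / toC x 0 0 ^+ 2) *: dz R 1).
Proof.
move=> ox hE; have [nE _] := transition_frame ox.
have w0 : toC x 0 0 != 0 by rewrite -overlap_chart.
have r0 := rnorm_gt0 (transition_neq0 k0 ox).
have D0 : chart_den x != 0 by rewrite gt_eqF// chart_den_gt0.
have s0 : sqmod (toC x 0 0) != 0 by rewrite gt_eqF// sqmod_gt0.
have lE : ell H22 (tau x) = chart_L x * sqmod (toC x 0 0) ^+ 2 / chart_den x ^+ 2.
  rewrite /ell L_of_quartic// rnorm_sq nE -/(chart_den x) -hE invf_div (mulrA (chart_H x)).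
  have kE : chart_root x ^+ 2 = _ := sqr_sqrtr (ltW (chart_root_arg_gt0 x)).
  have k1 : 1 + chart_root x != 0 by rewrite gt_eqF// ltr_pwDl// sqrtr_ge0.
  rewrite /chart_L -/(chart_root x).
  (* Rationalizing 1 - k exposes the factor |w_1|^4 in k^2 - 1. *)
  have -> : 1 - chart_root x = - (chart_root x ^+ 2 - 1) / (1 + chart_root x) by field.
  by rewrite kE; field; rewrite k1 D0.
rewrite -scalerA -map_ReZ scalerA lE /chart_form; congr (_ *: map_mx _ (_ *: _)).
rewrite (mulrAC (chart_L x)) [in RHS]rmorphM/= -[RHS]mulrA; congr (_ * _).
rewrite (_ : (sqmod (toC x 0 0) ^+ 2)%:C = (toC x 0 0 * conjc (toC x 0 0)) ^+ 2).
  by field.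
by rewrite -sqmodE -rmorphXn.
Qed.

Lemma csmooth_sqmod j : smooth_on setT (fun x : V => sqmod (toC x 0 j)).
Proof.
have [h1 h2] := @csmooth_toC R 2 j.
by apply: smooth_onTD; exact: smooth_onTX.
Qed.

Lemma smooth_chart_form j : smooth_on setT g -> smooth_on setT (fun x => chart_form x 0 j).
Proof.
move=> /smooth_mxP sg.
have sD : smooth_on setT chart_den.
  by apply: smooth_onTD; [exact: smooth_onT_cst|exact: csmooth_sqmod].
have sDV : smooth_on setT (fun x => (chart_den x)^-1).
  by apply: smooth_onTV => // x; rewrite gt_eqF// chart_den_gt0.
have sH : smooth_on setT chart_H.
  apply: smooth_onTM; last exact: smooth_onT_cst.
  apply: smooth_onTB; apply: smooth_onTM; [exact: smooth_onTX|exact: sg| |exact: sg].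
  by apply: smooth_onTM; exact: csmooth_sqmod.
have sK : smooth_on setT chart_root.
  apply: smooth_onT_sqrt; first exact: chart_root_arg_gt0.
  apply: smooth_onTD; first exact: smooth_onT_cst.
  apply: smooth_onTM; first exact: smooth_onT_cst.
  apply: smooth_onTX; apply: smooth_onTM => //.
  by apply: smooth_onTM => //; exact: csmooth_sqmod.
have sL : smooth_on setT chart_L.
  apply: smooth_onTM; first by apply: smooth_onTN; exact: smooth_onTX.
  apply: smooth_onTV => [x|].
    by rewrite gt_eqF// mulr_gt0// ltr_pwDl// sqrtr_ge0.
  apply: smooth_onTM; first exact: smooth_onT_cst.
  by apply: smooth_onTD => //; exact: smooth_onT_cst.
have [+ _] : csmooth (fun x => (chart_L x / chart_den x ^+ 2)%:C *
    (- (-1) ^+ k * conjc (toC x 0 0) ^+ 2) * dz R 1 0 j).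
  apply: csmoothM; last exact: csmooth_cst.
  apply: csmoothM.
    apply: csmooth_real; apply: smooth_onTM => //.
    rewrite (_ : (fun x => _) = fun x => (chart_den x)^-1 ^+ 2).
      exact: smooth_onTX.
    by apply/funext => x; rewrite exprVn.
  apply: csmoothM; first exact: csmooth_cst.
  by apply: csmoothX; apply: csmooth_conj; exact: csmooth_toC.
move=> s; rewrite (_ : (fun x => _) = fun x => 4 * Re ((chart_L x / chart_den x ^+ 2)%:C *
    (- (-1) ^+ k * conjc (toC x 0 0) ^+ 2) * dz R 1 0 j)).
  by apply: smooth_onTM => //; exact: smooth_onT_cst.
by apply/funext => x; rewrite /chart_form mx_scaleE; congr (4 * _); rewrite [LHS]mxE mx_scaleE.
Qed.

End ChartForm.

End AffineCharts.

(** * H22 / r^2 as a radial mean *)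

Section RadialMeanPotential.
Variables (R : realType) (H : R -> R).
Local Notation V := ('rV[R]_(2 + 2)).
Hypotheses (H_derivable : forall r : R, 0 < r -> derivable H r 1)
  (H_gt0 : forall r : R, 0 < r -> 0 < H r) (H11_gt0 : forall r : R, 0 < r -> 0 < H11 H r).
Variable T : V -> R.
Hypotheses (cT : continuous T)
  (TE : forall z, z != 0 -> T z = (H11 H (rnorm z) + H (rnorm z)) / rnorm z ^+ 2).

Lemma rnormZ (p : R) (y : V) : 0 <= p -> rnorm (p *: y) = p * rnorm y.
Proof.
move=> p0; rewrite /rnorm -[in RHS](ger0_norm p0) -sqrtr_sqr -sqrtrM ?sqr_ge0//.
by rewrite mulr_sumr; congr Num.sqrt; apply: eq_bigr => i _; rewrite mxE exprMn.
Qed.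

(** The function [F] in the proof is a primitive of p^3 T (p y) on p > 0: the definition of H11
    turns the derivative of H into H11. Its value at 1 is half the right-hand side. *)
Lemma radial_mean_potential (y : V) : y != 0 ->
  2 * radial_mean 3 T y = H (rnorm y) / rnorm y ^+ 2.
Proof.
move=> y0; set r := rnorm y; have r0 : 0 < r by exact: rnorm_gt0.
have rn0 : r != 0 by rewrite gt_eqF.
pose F (p : R) : R := p ^+ 2 * H (p * r) / (2 * r ^+ 2).
have TpE (p : R) : 0 < p -> T (p *: y) = (H11 H (p * r) + H (p * r)) / (p * r) ^+ 2.
  by move=> p0; rewrite TE ?rnormZ ?ltW// scaler_eq0 negb_or y0 gt_eqF.
have dF (p : R) : 0 < p -> is_derive p 1 F (p ^+ 3 * T (p *: y)).
  move=> p0; have pr0 : 0 < p * r by rewrite mulr_gt0.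
  have dl : is_derive p (1 : R) (fun q : R => q * r) r.
    by apply: is_derive_eq; rewrite /GRing.scale/= ?mulr0 ?mulr1 ?add0r ?addr0.
  have dH : is_derive p 1 (fun q : R => H (q * r)) (r * derive1 H (p * r)).
    apply: (@is_derive_comp1 R R H (fun q : R => q * r) p 1 (derive1 H (p * r)) r _ dl).
    exact: is_derive_H22.
  apply: is_derive_eq; rewrite /GRing.scale/= TpE// /H11; field.
  by rewrite rn0 gt_eqF.
(* The limit does not come from H, whose behaviour at 0 is unknown, but from T: positivity of H and
   H11 gives 0 <= F p <= p^4 T (p y), and T is continuous at 0. *)
have cF0 : F p @[p --> 0^'+] --> F 0.
  have F0 : F 0 = 0 by rewrite /F expr0n !mul0r.
  rewrite F0; apply: (@squeeze_cvgr _ _ _ _ (fun _ => 0) (fun p : R => p ^+ 4 * T (p *: y))).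
  - near=> p.
    have p0 : 0 < p by near: p; exact: nbhs_right_gt.
    have pr0 : 0 < p * r by rewrite mulr_gt0.
    have hH : 0 <= H (p * r) by exact/ltW/H_gt0.
    have h11 : 0 <= H11 H (p * r) by exact/ltW/H11_gt0.
    have r2 : 0 <= 2 * r ^+ 2 by rewrite mulr_ge0// sqr_ge0.
    have p2 : 0 <= p ^+ 2 by exact: sqr_ge0.
    apply/andP; split; first by apply: divr_ge0 => //; exact: mulr_ge0.
    rewrite TpE// /F.
    rewrite (_ : _ * (_ / _) = p ^+ 2 * H (p * r) / (2 * r ^+ 2) +
       p ^+ 2 * (2 * H11 H (p * r) + H (p * r)) / (2 * r ^+ 2)); last first.
      by field; rewrite rn0 gt_eqF.
    rewrite lerDl; apply: divr_ge0 => //; apply: mulr_ge0 => //; apply: addr_ge0 => //.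
    exact: mulr_ge0.
  - exact: cvg_cst.
  - apply: cvg_at_right_filter.
    have c4 : (p ^+ 4 * T (p *: y)) @[p --> (0 : R)] --> (0 : R) ^+ 4 * T ((0 : R) *: y).
      exact: continuous_radial.
    by move: c4; rewrite expr0n mul0r.
have cFp (p : R) : 0 < p -> {for p, continuous F}.
  by move=> p0; apply: differentiable_continuous; apply/derivable1_diffP; have [] := dF p p0.
have dooF : derivable_oo_LRcontinuous F 0 1.
  split => //; first by move=> p; rewrite in_itv/= => /andP[p0 _]; have [] := dF p p0.
  by apply: cvg_at_left_filter; exact: cFp.
have cG : {within `[0, 1], continuous (fun p : R => p ^+ 3 * T (p *: y))}.
  by apply: continuous_subspaceT; exact: continuous_radial.
have F'G : {in `]0, 1[, derive1 F =1 (fun p : R => p ^+ 3 * T (p *: y))}.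
  move=> p; rewrite in_itv/= => /andP[p0 _]; rewrite derive1E.
  by have /@derive_val := dF p p0.
have I := continuous_FTC2 ltr01 cG dooF F'G.
rewrite /radial_mean /Rintegral I/= /F expr0n !mul0r subr0 expr1n !mul1r -/r.
by field.
Unshelve. all: by end_near. Qed.

End RadialMeanPotential.

(** * The global B-field and the extended structure *)

Section Extension.
Variables (R : realType) (H22 : R -> R).
Local Notation V := ('rV[R]_(2 + 2)).
Local Notation I4 := (stdI R 2).
Local Notation Re := (@complex.Re R).
Hypotheses (H22_derivable : forall r : R, 0 < r -> derivable H22 r 1)
  (H22_gt0 : forall r : R, 0 < r -> 0 < H22 r)
  (H11_gt0 : forall r : R, 0 < r -> 0 < H11 H22 r).
Variable g : 'I_3 -> V -> 'M[R]_(2 + 2).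
Hypotheses (gK : kahler_metric_CP g)
  (gE : forall x : V, x != 0 ->
    complexify (fundamental_form (g ord0 x)) = hermitian_form H22 x).

Lemma fundamental_frame (y : V) : y != 0 -> fundamental_form (g ord0 y) =
  realify (frame y) *m (I4 *m metric_std (H11 H22 (rnorm y)) (H22 (rnorm y))) *m
  (realify (frame y))^T.
Proof.
move=> y0; have := gE y0; rewrite hermitian_frame trmx_complexify -!complexifyM => /matrixP e.
apply/matrixP => i j; have := e i j; rewrite [LHS]mxE [RHS]mxE.
by move=> /eqP; rewrite eq_complex => /andP[/eqP].
Qed.

Lemma metric_frame (y : V) : y != 0 -> g ord0 y =
  realify (frame y) *m metric_std (H11 H22 (rnorm y)) (H22 (rnorm y)) *m
  (realify (frame y))^T.
Proof.
move=> /fundamental_frame; rewrite /fundamental_form mulmxA realify_stdI => e.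
have IK (M : 'M[R]_(2 + 2)) : - (I4 *m (I4 *m M)) = M.
  by rewrite mulmxA stdI_sq mulNmx mul1mx opprK.
by rewrite -[LHS]IK e -!mulmxA IK.
Qed.

(** Each of H11 and H22 enters the trace with the factor 4 / r^2, hence the division. *)
Definition mean_metric (y : V) : R := (\sum_i g ord0 y i i) / 4.

Lemma smooth_mean_metric : smooth_on setT mean_metric.
Proof.
apply: smooth_onTM; last exact: smooth_onT_cst.
have [_ /(_ ord0)[/smooth_mxP s _ _ _ _]] := gK.
by apply: smooth_onT_sum => i _; exact: s.
Qed.

Lemma mean_metricE (z : V) : z != 0 ->
  mean_metric z = (H11 H22 (rnorm z) + H22 (rnorm z)) / rnorm z ^+ 2.
Proof.
move=> z0; rewrite /mean_metric metric_frame// big_split_ord !sum2.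
have D i := metric_diag (frame z) (H11 H22 (rnorm z)) (H22 (rnorm z)) i.
have [-> ->] := D 0; have [-> ->] := D 1.
rewrite ![frame z _ _]mxE /= !sqmodM !sqmodV sqmod_real !sqmod_conj sqmodN rnorm_sq.
have n0 : normsq z != 0 by rewrite normsq_eq0.
have sE : sqmod (toC z 0 1) = normsq z - sqmod (toC z 0 0).
  by rewrite normsq_sqmod addrC addKr.
by rewrite sE; field.
Qed.

(* L / r^4 as a function of H22 / r^2, which near the origin is smooth because
   it is twice the integral of p^3 T(p y) for p in [0, 1], T = mean_metric. *)
Definition origin_potential (y : V) : R :=
  (1 - Num.sqrt (1 + 4 * (2 * radial_mean 3 mean_metric y) ^+ 2)) / 8.

Definition origin_form (y : V) : V := (4 * origin_potential y) *: map_mx Re (theta0 y).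

Lemma origin_formE (y : V) : y != 0 ->
  origin_form y = (4 * ell H22 y) *: map_mx Re (theta0 y).
Proof.
move=> y0; rewrite /origin_form /origin_potential.
rewrite (radial_mean_potential H22_derivable H22_gt0 H11_gt0 _ mean_metricE)//.
  by rewrite /ell L_of_quartic// rnorm_gt0.
exact: smooth_onT_continuous smooth_mean_metric.
Qed.

Lemma smooth_origin_form j : smooth_on setT (fun y => origin_form y 0 j).
Proof.
have sf : smooth_on setT (fun y => 2 * radial_mean 3 mean_metric y).
  apply: smooth_onTM; first exact: smooth_onT_cst.
  exact/smooth_radial_mean/smooth_mean_metric.
have sp : smooth_on setT origin_potential.
  apply: smooth_onTM; last exact: smooth_onT_cst.
  apply: smooth_onTB; first exact: smooth_onT_cst.
  apply: smooth_onT_sqrt => [x|]; first by rewrite ltr_pwDl// mulr_ge0// sqr_ge0.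
  apply: smooth_onTD; first exact: smooth_onT_cst.
  by apply: smooth_onTM; [exact: smooth_onT_cst|exact: smooth_onTX].
have [+ _] : csmooth (fun x : V => toC x 0 0 * dz R 1 0 j - toC x 0 1 * dz R 0 0 j).
  apply: csmoothD; last apply: csmoothN; apply: csmoothM;
    by [exact: csmooth_toC|exact: csmooth_cst].
move=> s; rewrite (_ : (fun y => _) = fun y => 4 * origin_potential y *
    Re (toC y 0 0 * dz R 1 0 j - toC y 0 1 * dz R 0 0 j)).
  apply: smooth_onTM => //; apply: smooth_onTM => //; exact: smooth_onT_cst.
apply/funext => y; rewrite /origin_form mx_scaleE; congr (_ * _).
by rewrite [LHS]mxE theta0E.
Qed.

Definition potential (k : 'I_3) : V -> V :=
  if k == ord0 then origin_form else chart_form k (g k).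

Lemma smooth_potential k j : smooth_on setT (fun y => potential k y 0 j).
Proof.
rewrite /potential; case: ifP => _; first exact: smooth_origin_form.
by apply: smooth_chart_form; have [_ /(_ k)[]] := gK.
Qed.

Lemma dform_origin_potential (y : V) : y != 0 -> dform (potential ord0) y = B_field H22 y.
Proof.
move=> y0; apply: dform_origin => //; rewrite /potential eqxx.
have : \near y, (~` [set 0]) y.
  apply: open_nbhs_nbhs; split; last exact/eqP.
  exact/closed_openC/accessible_closed_set1/hausdorff_accessible/norm_hausdorff.
by apply: filterS => z /eqP; exact: origin_formE.
Qed.

Lemma dform_potential k x : overlap k ord0 x -> dform (potential k) x =
  jacobian (transition k ord0) x *m dform (potential ord0) (transition k ord0 x) *m
  (jacobian (transition k ord0) x)^T.
Proof.
have [->{k} ox|k0 ox] := eqVneq k ord0.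
  rewrite jacobian_transition// transition_mx_diag realify1 mul1mx trmx1 mulmx1.
  congr dform; apply: (can_inj (@toCK R 2)); apply/rowP => j.
  by rewrite toC_transition homog_diag homog_lift divr1.
rewrite dform_origin_potential ?transition_neq0//.
apply: dform_chart => //; rewrite /potential (negbTE k0).
(* The two expressions of the potential are to be differentiated, so they must agree on a
   neighbourhood and not only at x. *)
have : \near x, overlap k ord0 x by apply: open_nbhs_nbhs; split => //; exact: open_overlap.
apply: filterS => z oz; apply: chart_formE => //.
apply: (chart_HE k0 (h11 := H11 H22 (rnorm (transition k ord0 z))) oz).
rewrite -metric_frame ?transition_neq0// -jacobian_transition//.
by have [/(_ k ord0 z oz)] := gK.
Qed.

Lemma dform_frame (y : V) : y != 0 -> dform (potential ord0) y = realify (frame y) *m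
  B_std (H12 H22 (rnorm y)) (lambda H22 (rnorm y)) *m (realify (frame y))^T.
Proof. by move=> y0; rewrite dform_origin_potential// B_field_frame. Qed.

Lemma bivector_frame (y : V) : y != 0 ->
  (realify (frame y))^T *m bivector 1 *m realify (frame y) =
  bivector ((rnorm y ^+ 2)^-1)%:C :> 'M[R]_(2 + 2).
Proof. by move=> y0; rewrite bivector_push mul1r det_frame// rnorm_sq. Qed.

Lemma frame_unit (y : V) : y != 0 -> realify (frame y) \in unitmx.
Proof.
move=> y0; have : (realify (frame y))^T *m bivector 1 *m realify (frame y) \in unitmx.
  rewrite bivector_frame// bivector_unit// fmorph_eq0 invr_eq0 expf_neq0//.
  by rewrite gt_eqF// rnorm_gt0.
by rewrite !unitmx_mul => /andP[].
Qed.

Lemma extension_gen_kahler :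
  gen_kahler_CP (fun k x => Jhol I4 (bivector (bivector_coef k x)))
    (fun k x => Jsym (dform (potential k) x) (fundamental_form (g k x))).
Proof.
have EI y : realify (frame y) *m I4 = I4 *m realify (frame y) := realify_stdI _.
have ETI y : (realify (frame y))^T *m I4 = I4 *m (realify (frame y))^T.
  by apply: trmx_inj; rewrite !trmx_mul trmxK trmx_stdI mulNmx mulmxN EI.
apply: (gen_kahler_CP_of_B_field gK).
- by move=> k; apply: smooth_dform => j; exact: smooth_potential.
- by move=> k x; exact: trmx_dform.
- by move=> k; apply: dform_closed => j; exact: smooth_potential.
- by move=> k x; exact: dform_potential.
- move=> y y0; apply: (commute1_push (EI y) (ETI y) (dform_frame y0) (fundamental_frame y0)
    (bivector_frame y0)).
  by apply: commute1_std; apply: H_ode => //; exact: rnorm_gt0.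
- move=> y y0; apply: (commute2_push (dform_frame y0) (fundamental_frame y0) (bivector_frame y0)).
  exact: commute2_std.
move=> y y0; have r0 := rnorm_gt0 y0.
exists (- 2 * (rnorm y ^+ 2)^-1 * lambda H22 (rnorm y)).
  have := H_lambda_le0 H22_derivable r0 (H22_gt0 r0) (ltW (H11_gt0 r0)).
  have : 0 <= (rnorm y ^+ 2)^-1 by rewrite invr_ge0 sqr_ge0.
  move: (lambda _ _) (_^-1) => l q q0 l0; nra.
rewrite (trace_push (c := - ((- 2 * (rnorm y ^+ 2)^-1 * lambda H22 (rnorm y)) *+ 2)) (EI y)
  (dform_frame y0) (bivector_frame y0)) ?raddfN//.
  exact: frame_unit.
by rewrite trace_std.
Qed.

End Extension.

Theorem proposition2 (R : realType) (H22 : R -> R)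
    (H22_smooth : smooth_on [set r : R | 0 < r] H22)
    (H11_gt0 : forall r : R, 0 < r -> 0 < H11 H22 r)
    (H22_gt0 : forall r : R, 0 < r -> 0 < H22 r)
    (metric_extends :
       exists g : 'I_3 -> 'rV[R]_(2 + 2) -> 'M[R]_(2 + 2),
         kahler_metric_CP g /\
         forall x : 'rV[R]_(2 + 2), x != 0 ->
           complexify (fundamental_form (g ord0 x)) = hermitian_form H22 x) :
  exists J1 J2 : 'I_3 -> 'rV[R]_(2 + 2) -> 'M[R]_((2 + 2) + (2 + 2)),
    gen_kahler_CP J1 J2 /\
    forall x : 'rV[R]_(2 + 2), x != 0 ->
      defined_by_exp (beta1 R) (J1 ord0 x) /\
      defined_by_exp (beta2 H22 x) (J2 ord0 x).
Proof.
have H22_derivable r : 0 < r -> derivable H22 r 1.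
  by have [_ /(_ 1)[+ _]] := H22_smooth 1%N; exact.
have [g [gK gE]] := metric_extends.
do 2!eexists; split; first exact: (extension_gen_kahler H22_derivable H22_gt0 H11_gt0 gK gE).
have row_exp (A : 'rV[R[i]]_((2 + 2) + (2 + 2))) b :
    rsubmx A = - (lsubmx A *m b) <-> exists X, A = row_mx X (- (X *m b)).
  split=> [e|[X ->]]; last by rewrite row_mxKl row_mxKr.
  by exists (lsubmx A); rewrite -e hsubmxK.
move=> x x0; split=> A; rewrite -row_exp.
  have -> : bivector_coef ord0 x = 1.
    by rewrite /bivector_coef homog_diag expr1n expr0 mul1r.
  by rewrite Jhol_plus_i ?oner_eq0// invr1 scale1r.
rewrite Jsym_plus_i; last exact: fundamental_form_unit (proj2 gK ord0) x.
rewrite (dform_frame H22_derivable H22_gt0 H11_gt0 gK gE x0) (fundamental_frame gE x0) beta2_frame trmx_complexify.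
by rewrite !complexifyM scale_conjmx -mulmxBl -mulmxBr.
Qed.
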